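(* Let $(\Gamma,\psi)\models T_{\log}$ and let $F:\Psi\to\Gamma_\infty$ be a function definable (with parameters) in $(\Gamma,\psi)$. Then there is an increasing sequence $s0=\alpha_0<\alpha_1<\cdots<\alpha_{n-1}<\alpha_n=\infty$ in $\Psi_\infty=\Psi\cup\{\infty\}$ such that for $k=0,\ldots,n-1$, the restriction of $F$ to $[\alpha_k,\alpha_{k+1})_\Psi=\{x\in\Psi:\alpha_k\leq x<\alpha_{k+1}\}$ is given by (i.e. agrees on this set with) an $s$-function.
   Context: Asymptotic couples. An asymptotic couple is a pair $(\Gamma,\psi)$ where $\Gamma$ is a (totally) ordered abelian group and $\psi:\Gamma^{\neq}\to\Gamma$ (with $\Gamma^{\neq}=\Gamma\setminus\{0\}$) satisfies for all $\alpha,\beta\in\Gamma^{\neq}$: (AC1) $\alpha+\beta\neq0\Rightarrow\psi(\alpha+\beta)\geq\min(\psi(\alpha),\psi(\beta))$; (AC2) $\psi(r\alpha)=\psi(\alpha)$ for all nonzero $r\in\mathbb{Z}$; (AC3) $\alpha>0\Rightarrow\alpha+\psi(\alpha)>\psi(\beta)$. It is $H$-asymptotic (of $H$-type) if moreover $0<\alpha\leq\beta\Rightarrow\psi(\alpha)\geq\psi(\beta)$, and divisible if $\Gamma$ is divisible. Put $\Psi=\psi(\Gamma^{\neq})$ and $\gamma'=\gamma+\psi(\gamma)$ for $\gamma\in\Gamma^{\neq}$. $(\Gamma,\psi)$ has asymptotic integration if $\{\gamma':\gamma\in\Gamma^{\neq}\}=\Gamma$; if it is also of $H$-type, then for each $\alpha\in\Gamma$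 there is a unique $\beta\in\Gamma^{\neq}$ with $\beta'=\alpha$, denoted $\int\alpha$, and the successor function is $s:\Gamma\to\Psi$, $s(\alpha)=\psi(\int\alpha)$; write $s\alpha=s(\alpha)$, so $s0=s(0)$. The theory $T_{\log}$. Let $L_0=\{0,+,-,<,\psi,\infty\}$. An asymptotic couple is an $L_0$-structure with underlying set $\Gamma_\infty=\Gamma\cup\{\infty\}$, $\Gamma<\infty$, and $\infty$ as default value: $-\infty=\gamma+\infty=\infty+\gamma=\infty+\infty=\psi(0)=\psi(\infty)=\infty$. $T_0$ is the $L_0$-theory whose models are the divisible $H$-asymptotic couples with asymptotic integration such that: $\Psi$ has a least element, equal to $s0$, and $s0>0$; every $\alpha\in\Psi$ has an immediate successor in the ordered set $\Psi$, namely $s\alpha$; and $\gamma\mapsto s\gamma:\Psi\to\Psi^{>s0}=\{x\in\Psi:x>s0\}$ is a bijection. For a model of $T_0$ let $p:\Psi^{>s0}\to\Psi$ be the inverse of this bijection, extended to $\Gamma_\infty$ by $p(\alpha)=\infty$ for $\alpha\in\Gamma_\infty\setminus\Psi^{>s0}$. Let $L=L_0\cup\{s,p,\delta_1,\delta_2,\dots\}$ with all new symbols unary function symbols; models of $T_0$ are construed as $L$-structures with $s$ interpreted as the successor function $\alpha\mapsto\psi(\int\alpha)$ on $\Gamma$ and $s(\infty)=\infty$, $p$ interpreted as the function $p:\Gamma_\infty\to\Gamma_\infty$ that inverts $\gamma\mapsto s\gamma:\Psi\to\Psi^{>s0}$ on $\Psi^{>s0}$ and takes the value $\infty$ elsewhere,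 and $\delta_n$ interpreted as division by $n$ ($\delta_n(\infty)=\infty$). $T_{\log}$ is the $L$-theory whose models are the models of $T_0$ so construed. $s$-functions. For $x\in\Psi$, $s^0(x)=x$; for $k>0$, $s^k$ is the $k$-fold iterate of $s$; for $k<0$, $s^k(x)=p^{-k}(x)\in\Psi_\infty$. $\Gamma$ is a $\mathbb{Q}$-vector space by divisibility, and $\infty$ is absorbing for addition and multiplication by nonzero rationals. A function $F:\Psi\to\Gamma_\infty$ is an $s$-function if it is constant, or there are $n\geq1$, $k_1<\cdots<k_n$ in $\mathbb{Z}$, $q_1,\dots,q_n\in\mathbb{Q}\setminus\{0\}$ and $\beta\in\Gamma$ such that $F(x)=\sum_{j=1}^nq_js^{k_j}(x)-\beta$ for all $x\in\Psi$. *)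

(* Defs.v *)
From HB Require Import structures.
From mathcomp Require Import all_boot all_order all_algebra.
From mathcomp Require Import boolp classical_sets functions.

Set Implicit Arguments.
Unset Strict Implicit.
Unset Printing Implicit Defensive.

Import Order.TTheory GRing.Theory Num.Theory.
Local Open Scope classical_set_scope.
Local Open Scope ring_scope.

HB.mixin Record POrderedZmodule_isOrdered G of Num.POrderedZmodule G := {
  orderedZ_le_total : total (<=%R : rel G);
  orderedZ_leD2r : forall z x y : G, x <= y -> x + z <= y + z
}.

(* A porderZmodType is only a type with a partial order and an additive group
   law, so that the two axioms above make it an ordered abelian group. *)
#[short(type="orderedZmodType")]
HB.structure Definition OrderedZmodule :=
  { G of POrderedZmodule_isOrdered G & Num.POrderedZmodule G }.

Section AsymptoticCouple.
Variables (G : orderedZmodType) (psi : G -> G).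
Implicit Types (a b c : G).

(* The map psi lives on the nonzero elements of G; the value [psi 0] is junk
   and plays no role in the models of T0. *)
Record asymptotic_couple : Prop := AsymptoticCouple {
  AC1 : forall a b, a != 0 -> b != 0 -> a + b != 0 ->
    Order.min (psi a) (psi b) <= psi (a + b);
  AC2 : forall a (r : int), a != 0 -> r != 0 -> psi (a *~ r) = psi a;
  AC3 : forall a b, a != 0 -> b != 0 -> 0 < a -> psi b < a + psi a
}.

Definition H_type : Prop :=
  forall a b, 0 < a -> a <= b -> psi b <= psi a.

Definition divisible_group : Prop :=
  forall (n : nat) a, (0 < n)%N -> exists b, b *+ n = a.

Definition asymptotic_integration : Prop :=
  forall a, exists2 b, b != 0 & b + psi b = a.

Definition Psi : set G := [set psi a | a in [set a | a != 0]].

(* [xget d A] is an element of A if A is nonempty and d otherwise. In the models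
   of T0 each of the sets to which it is applied below is a singleton. *)
Definition integral a : G := xget 0 [set b | b != 0 /\ b + psi b = a].

Definition succ a : G := psi (integral a).

Definition Psi_gt : set G := [set x | Psi x /\ succ 0 < x].

Record T0_model : Prop := T0Model {
  T0_couple : asymptotic_couple;
  T0_H_type : H_type;
  T0_divisible : divisible_group;
  T0_integration : asymptotic_integration;
  T0_least : Psi (succ 0) /\ forall x, Psi x -> succ 0 <= x;
  T0_pos : 0 < succ 0;
  T0_succ : forall x, Psi x ->
    [/\ Psi (succ x), x < succ x & ~ exists y, [/\ Psi y, x < y & y < succ x]];
  T0_bij : set_bij Psi Psi_gt succ
}.

Definition div_by (n : nat) a : G := xget 0 [set b | b *+ n = a].

Definition qscale (q : rat) a : G := div_by `|denq q|%N (a *~ numq q).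

End AsymptoticCouple.

Section WithInfinity.
Variables (G : orderedZmodType) (psi : G -> G).

(* [None] is the element infinity of [option G]. *)
Definition lt_oo (x y : option G) : bool :=
  match x, y with
  | Some a, Some b => a < b
  | Some _, None => true
  | None, _ => false
  end.

Definition le_oo (x y : option G) : bool := (x == y) || lt_oo x y.

Definition add_oo (x y : option G) : option G :=
  if x is Some a then if y is Some b then Some (a + b) else None else None.

Definition opp_oo : option G -> option G := omap -%R.

Definition psi_oo (x : option G) : option G :=
  if x is Some a then if a == 0 then None else Some (psi a) else None.

Definition succ_oo : option G -> option G := omap (succ psi).

Definition pred_oo (x : option G) : option G :=
  if x is Some a then
    if a \in Psi_gt psi then Some (xget 0 [set b | Psi psi b /\ succ psi b = a])
    else None
  else None.

Definition div_by_oo (n : nat) : option G -> option G := omap (@div_by G n).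

Definition qscale_oo (q : rat) : option G -> option G := omap (qscale q).

Definition Psi_oo : set (option G) :=
  [set x | if x is Some a then Psi psi a else True].

Definition succ_pow (k : int) (x : G) : option G :=
  match k with
  | Posz m => iter m succ_oo (Some x)
  | Negz m => iter m.+1 pred_oo (Some x)
  end.

(* The subtype associated with the set [Psi psi] is the domain of F. *)
Definition s_function (F : Psi psi -> option G) : Prop :=
  (exists c : option G, forall x, F x = c) \/
  exists (n : nat) (k : 'I_n -> int) (q : 'I_n -> rat) (b : G),
    [/\ (0 < n)%N,
        forall i j : 'I_n, (i < j)%N -> k i < k j,
        forall j, q j != 0
      & forall x, F x =
          add_oo (\big[add_oo/Some 0]_(j < n)
                    qscale_oo (q j) (succ_pow (k j) (val x)))
                 (opp_oo (Some b))].

End WithInfinity.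

Record Lstructure := MkLstructure {
  carrier :> Type;
  Lzero : carrier;
  Linfty : carrier;
  Ladd : carrier -> carrier -> carrier;
  Lopp : carrier -> carrier;
  Llt : carrier -> carrier -> Prop;
  Lpsi : carrier -> carrier;
  Lsucc : carrier -> carrier;
  Lpred : carrier -> carrier;
  Ldelta : nat -> carrier -> carrier
}.

(* The function symbols delta_n exist only for n >= 1, so [TDelta m] stands for
   the application of delta_(m.+1). *)
Inductive Lterm : Type :=
| TVar of nat
| TZero
| TInfty
| TAdd of Lterm & Lterm
| TOpp of Lterm
| TPsi of Lterm
| TSucc of Lterm
| TPred of Lterm
| TDelta of nat & Lterm.

Inductive Lformula : Type :=
| FEq of Lterm & Lterm
| FLt of Lterm & Lterm
| FNot of Lformula
| FAnd of Lformula & Lformula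
| FEx of nat & Lformula.

Section Semantics.
Variable M : Lstructure.

Definition update (v : nat -> M) (i : nat) (a : M) : nat -> M :=
  fun j => if j == i then a else v j.

Fixpoint eval (v : nat -> M) (t : Lterm) : M :=
  match t with
  | TVar i => v i
  | TZero => Lzero M
  | TInfty => Linfty M
  | TAdd t1 t2 => Ladd (eval v t1) (eval v t2)
  | TOpp t1 => Lopp (eval v t1)
  | TPsi t1 => Lpsi (eval v t1)
  | TSucc t1 => Lsucc (eval v t1)
  | TPred t1 => Lpred (eval v t1)
  | TDelta m t1 => Ldelta m.+1 (eval v t1)
  end.

Fixpoint sat (v : nat -> M) (phi : Lformula) : Prop :=
  match phi with
  | FEq t1 t2 => eval v t1 = eval v t2
  | FLt t1 t2 => Llt (eval v t1) (eval v t2)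
  | FNot phi1 => ~ sat v phi1
  | FAnd phi1 phi2 => sat v phi1 /\ sat v phi2
  | FEx i phi1 => exists a : M, sat (update v i a) phi1
  end.

(* Variables 0 and 1 are the arguments of R; the valuation v supplies parameters
   for the other free variables of phi, of which there are finitely many. *)
Definition definable_rel (R : M -> M -> Prop) : Prop :=
  exists (phi : Lformula) (v : nat -> M),
    forall x y, R x y <-> sat (update (update v 0 x) 1 y) phi.

End Semantics.

Definition Tlog_structure (G : orderedZmodType) (psi : G -> G) : Lstructure :=
  {| carrier := option G;
     Lzero := Some 0;
     Linfty := None;
     Ladd := @add_oo G;
     Lopp := @opp_oo G;
     Llt := fun x y => lt_oo x y;
     Lpsi := psi_oo psi;
     Lsucc := succ_oo psi;
     Lpred := pred_oo psi;
     Ldelta := @div_by_oo G |}.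

Definition definable_fun (G : orderedZmodType) (psi : G -> G)
    (F : Psi psi -> option G) : Prop :=
  @definable_rel (Tlog_structure psi)
    (fun x y : option G => exists z : Psi psi, x = Some (val z) /\ y = F z).

(* Main.v *)
(* Along the convex valuation psi, a Q-linear combination of the elements
   s^k(g), with g in Psi outside of a substructure K, differs from an element
   of K by something whose value lies in K or in the orbit of g. Hence an
   isomorphism between substructures extends to the orbit of g as soon as the
   image of g fills the corresponding cut, and an element x such that K contains
   all the Psi-elements of K<x> is governed by its cut and by the values
   psi(x - k). In a countably saturated model both kinds of cuts can be filled,
   in more than one way, so that partial isomorphisms between countable
   substructures preserve all formulas and no element outside of a countable
   substructure is definable over it.

   This is applied to an ultrapower of the model. Let A be the countable
   substructure generated by the parameters of F. If F were not piecewise given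
   by s-functions, bisection along Psi_A would give nested intervals [a_n, b_n)
   on which it is not. A point z of the ultrapower in the limit cut has F(z) in
   A<z>, so that F(z) = S(z) for an s-function S over A. All points of the cut
   satisfy the same formulas over A, so F = S on the whole cut, while choosing
   counterexamples w_n in [a_n, b_n) gives a point of the cut where F and S
   differ. *)

Require Import Defs.
From HB Require Import structures.
From mathcomp Require Import all_boot all_order all_algebra.
From mathcomp Require Import boolp classical_sets functions.
From mathcomp Require Import generic_quotient filter.
Set Implicit Arguments.
Unset Strict Implicit.
Unset Printing Implicit Defensive.
Import Order.TTheory GRing.Theory Num.Theory.
Local Open Scope classical_set_scope.
Local Open Scope ring_scope.

(** * Linear identities in abelian groups *)

(** Preservation of formulas needs a one-point extension step. Adjoining a single x may create many
    new Psi-elements, since each difference x - k can have a new value, and each of these brings a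
    whole orbit. The forth step therefore does not adjoin x alone: it takes the countable
    substructure N generated by the domain and x, and a maximal partial isomorphism with domain
    inside N. Maximality puts every Psi-element of N into the domain, one orbit at a time; after
    that any other element of N can be adjoined without new Psi-elements. Countability of N keeps
    each filling problem within reach of countable saturation. Linear combinations over an orbit are
    written as P(s) applied to one of its members, with P an integer polynomial: a shift along the
    orbit is multiplication by X, and denominators are cleared by a factor n. Compared with an
    element below the orbit, all orbit elements look alike and P(s) acts like multiplication by
    P(1); compared with an element above it, the term of lowest degree dominates. *)

Inductive zexpr :=
| ZVar of nat | ZZero | ZAdd of zexpr & zexpr | ZOpp of zexpr.

Fixpoint zeval (V : zmodType) (env : seq V) (e : zexpr) : V :=
  match e with
  | ZVar i => nth 0 env i
  | ZZero => 0
  | ZAdd a b => zeval env a + zeval env b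
  | ZOpp a => - zeval env a
  end.

Fixpoint zcoef (e : zexpr) (i : nat) : int :=
  match e with
  | ZVar j => (i == j)%:Z
  | ZZero => 0
  | ZAdd a b => zcoef a i + zcoef b i
  | ZOpp a => - zcoef a i
  end.

Lemma zevalE (V : zmodType) (env : seq V) (e : zexpr) :
  zeval env e = \sum_(i < size env) nth 0 env i *~ zcoef e i.
Proof.
elim: e => [j||a IHa b IHb|a IH] /=.
- have [lt_j|le_j] := ltnP j (size env).
    rewrite (bigD1 (Ordinal lt_j)) //= eqxx mulr1z big1 ?addr0 // => i.
    by rewrite -val_eqE /= => /negPf ->; rewrite mulr0z.
  rewrite nth_default // big1 // => i _.
  by rewrite ltn_eqF ?mulr0z // (leq_trans (ltn_ord i)).
- by rewrite big1 // => i _; rewrite mulr0z.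
- by rewrite IHa IHb -big_split; apply: eq_bigr => i _; rewrite mulrzDr.
- by rewrite IH -sumrN; apply: eq_bigr => i _; rewrite mulrNz.
Qed.

(** Equality of finitely many integer coefficients is decided by computation; [zlin] reifies both
    sides of a goal over a common list of atoms and applies this. *)
Lemma zlin_correct (V : zmodType) (env : seq V) (e1 e2 : zexpr) :
  all (fun i => zcoef e1 i == zcoef e2 i) (iota 0 (size env)) ->
  zeval env e1 = zeval env e2.
Proof.
move=> /allP H; rewrite !zevalE; apply: eq_bigr => i _; congr (_ *~ _).
by apply/eqP/H; rewrite mem_iota /=.
Qed.

(* The same multiple of an element may occur over different inheritance paths
   to the group structure; elaborating it again makes the atoms identical. *)
Ltac zatom t :=
  lazymatch t with
  | @GRing.natmul _ ?a ?n => constr:((a *+ n)%R)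
  | @intmul _ ?a ?n => constr:((a *~ n)%R)
  | _ => t
  end.
Ltac zadd_var t env :=
  let x := zatom t in
  lazymatch env with
  | context [cons x _] => env
  | _ => constr:(cons x env)
  end.
Ltac zvars t env :=
  lazymatch t with
  | GRing.zero => env
  | (?a + ?b)%R => let e := zvars a env in zvars b e
  | (- ?a)%R => zvars a env
  | _ => zadd_var t env
  end.
Ltac zindex x env :=
  lazymatch env with
  | cons x _ => constr:(O)
  | cons _ ?e => let n := zindex x e in constr:(S n)
  end.
Ltac zreify t env :=
  lazymatch t with
  | GRing.zero => constr:(ZZero)
  | (?a + ?b)%R =>
      let x := zreify a env in let y := zreify b env in constr:(ZAdd x y)
  | (- ?a)%R => let x := zreify a env in constr:(ZOpp x)
  | _ => let x := zatom t in let n := zindex x env in constr:(ZVar n)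
  end.
Ltac zlin :=
  lazymatch goal with
  | |- @eq ?V ?a ?b =>
      let env := zvars a (@nil V) in let env := zvars b env in
      let x := zreify a env in let y := zreify b env in
      by apply: (@zlin_correct _ env x y)
  end.

(** * Ordered abelian groups *)

HB.instance Definition _ (G : orderedZmodType) :=
  Order.POrder_isTotal.Build _ G (@orderedZ_le_total G).

Section OrderedGroup.
Variable G : orderedZmodType.
Implicit Types a b c : G.

Lemma oleD2r c a b : (a + c <= b + c) = (a <= b).
Proof.
apply/idP/idP => [H|]; last exact: orderedZ_leD2r.
by rewrite -(addrK c a) -(addrK c b); apply: orderedZ_leD2r.
Qed.

Lemma oltD2r c a b : (a + c < b + c) = (a < b).
Proof. by rewrite !ltNge oleD2r. Qed.

Lemma osub_gt0 a b : (0 < b - a) = (a < b).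
Proof. by rewrite -(oltD2r a 0) add0r subrK. Qed.

Lemma osub_ge0 a b : (0 <= b - a) = (a <= b).
Proof. by rewrite -(oleD2r a 0) add0r subrK. Qed.

Lemma olt_opp a b : (- a < - b) = (b < a).
Proof. by rewrite -[RHS]osub_gt0 -osub_gt0 opprK addrC. Qed.

Lemma oopp_gt0 a : (0 < - a) = (a < 0).
Proof. by rewrite -[X in _ = X]olt_opp oppr0. Qed.

Lemma oopp_lt0 a : (- a < 0) = (0 < a).
Proof. by rewrite -[X in _ = X]olt_opp oppr0. Qed.

Lemma oaddr_gt0 a b : 0 < a -> 0 < b -> 0 < a + b.
Proof. by move=> a0 b0; apply: (lt_trans b0); rewrite -{1}(add0r b) oltD2r. Qed.

Lemma omulrn_gt0 n a : (0 < n)%N -> (0 < a *+ n) = (0 < a).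
Proof.
case: n => // n _.
have pos (x : G) : 0 < x -> 0 < x *+ n.+1.
  move=> x0; elim: n => [|n IH] //; rewrite mulrS; exact: (oaddr_gt0 x0 IH).
case: (ltgtP a 0) => [a0|/pos //|->]; last by rewrite mul0rn ltxx.
have := a0; rewrite -oopp_gt0 => /pos; rewrite mulNrn oopp_gt0.
by move=> /ltW; rewrite leNgt => /negbTE.
Qed.

Lemma omulrn_eq0 n a : (0 < n)%N -> (a *+ n == 0) = (a == 0).
Proof.
move=> n0; case: (ltgtP a 0) => [a0|a0|->]; last by rewrite mul0rn eqxx.
  have := a0; rewrite -oopp_gt0 -(omulrn_gt0 _ n0) mulNrn oopp_gt0.
  by move=> /lt_eqF ->.
by have := a0; rewrite -(omulrn_gt0 _ n0) => /gt_eqF ->.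
Qed.

Lemma omulrnI n a b : (0 < n)%N -> a *+ n = b *+ n -> a = b.
Proof.
move=> n0 /eqP; rewrite -subr_eq0 -mulrnBl omulrn_eq0 // subr_eq0.
by move/eqP.
Qed.

Lemma omulrz_gt0 (z : int) a : 0 < z -> (0 < a *~ z) = (0 < a).
Proof. by case: z => // n n0; rewrite -pmulrn omulrn_gt0. Qed.

Lemma omulrz_gt0N (z : int) a : z < 0 -> (0 < a *~ z) = (a < 0).
Proof.
move=> z0; rewrite -{1}(opprK z) mulrNz -mulNrz.
by rewrite omulrz_gt0 ?oppr_gt0 // oopp_gt0.
Qed.

Lemma omulrz_eq0 (z : int) a : z != 0 -> (a *~ z == 0) = (a == 0).
Proof.
move=> z0; case: (ltgtP a 0) => [a0|a0|->]; last by rewrite mul0rz eqxx.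
  case: (ltgtP z 0) z0 => // zs _.
    by have := a0; rewrite -(omulrz_gt0N _ zs) => /gt_eqF ->.
  have := a0; rewrite -oopp_gt0 -(omulrz_gt0 _ zs) mulNrz oopp_gt0.
  by move=> /lt_eqF ->.
case: (ltgtP z 0) z0 => // zs _.
  have := a0; rewrite -oopp_lt0 -(omulrz_gt0N _ zs) mulNrz oopp_gt0.
  by move=> /lt_eqF ->.
by have := a0; rewrite -(omulrz_gt0 _ zs) => /gt_eqF ->.
Qed.

End OrderedGroup.

(** * The valuation psi *)

Section Valuation.
Variables (G : orderedZmodType) (psi : G -> G) (HT : T0_model psi).
Implicit Types a b c : G.
Local Notation s := (succ psi).
Local Notation Psi := (Psi psi).
Let AC := T0_couple HT.

Lemma Psi_psi a : a != 0 -> Psi (psi a).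
Proof. by move=> a0; exists a. Qed.

Lemma psi_mulrz a (z : int) : a != 0 -> z != 0 -> psi (a *~ z) = psi a.
Proof. exact: AC2. Qed.

Lemma psi_mulrn a n : a != 0 -> (0 < n)%N -> psi (a *+ n) = psi a.
Proof. by move=> a0 n0; rewrite pmulrn psi_mulrz // -lt0n. Qed.

Lemma psi_opp a : psi (- a) = psi a.
Proof.
have [->|a0] := eqVneq a 0; first by rewrite oppr0.
by rewrite -[RHS](psi_mulrz (z := -1)) // mulrNz mulr1z.
Qed.

(* A convex subgroup: the value of 0 counts as infinity. *)
Definition above c a : Prop := a = 0 \/ c < psi a.

Lemma above0 c : above c 0. Proof. by left. Qed.

Lemma aboveN c a : above c a -> above c (- a).
Proof. by move=> [->|H]; [left; rewrite oppr0|right; rewrite psi_opp]. Qed.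

Lemma aboveD c a b : above c a -> above c b -> above c (a + b).
Proof.
have [->|a0] := eqVneq a 0; first by rewrite add0r.
have [->|b0] := eqVneq b 0; first by rewrite addr0.
have [ab0|ab0] := eqVneq (a + b) 0; first by left.
move=> [/eqP|Ha]; first by rewrite (negPf a0).
move=> [/eqP|Hb]; first by rewrite (negPf b0).
right; apply: lt_le_trans (AC1 AC a0 b0 ab0).
by rewrite lt_min Ha Hb.
Qed.

Lemma aboveB c a b : above c a -> above c b -> above c (a - b).
Proof. by move=> Ha Hb; apply: aboveD => //; apply: aboveN. Qed.

Lemma above_mulrz c a (z : int) : above c a -> above c (a *~ z).
Proof.
have [->|z0] := eqVneq z 0; first by rewrite mulr0z; left.
have [->|a0] := eqVneq a 0; first by rewrite mul0rz; left.
by move=> [/eqP|Ha]; [rewrite (negPf a0)|right; rewrite psi_mulrz].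
Qed.

Lemma above_mulrnE c a n : (0 < n)%N -> above c (a *+ n) <-> above c a.
Proof.
move=> n0; have [->|a0] := eqVneq a 0; first by rewrite mul0rn.
rewrite /above psi_mulrn //; split=> -[/eqP|]; try by right.
  by rewrite omulrn_eq0 // (negPf a0).
by rewrite (negPf a0).
Qed.

Lemma above_sum c n (f : 'I_n -> G) :
  (forall i, above c (f i)) -> above c (\sum_i f i).
Proof.
by move=> H; elim/big_ind: _ => //; [exact: above0|exact: aboveD].
Qed.

Lemma above_le c d a : c <= d -> above d a -> above c a.
Proof. by move=> cd [->|H]; [left|right; apply: le_lt_trans H]. Qed.

Lemma psi_le a b : 0 < a -> a <= b -> psi b <= psi a.
Proof. exact: (T0_H_type HT). Qed.

Lemma aboveP c a : ~ above c a -> a != 0 /\ psi a <= c.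
Proof.
move=> H; split; first by apply/eqP => a0; apply: H; left.
by rewrite leNgt; apply/negP => ca; apply: H; right.
Qed.

(** The strict ultrametric law. The sign statement comes from the H-type axiom: a change of sign
    would force the absolute value of d to be at least that of a, hence [psi d <= psi a]. *)
Lemma above_lead a d : a != 0 -> above (psi a) d ->
  [/\ a + d != 0, psi (a + d) = psi a & (0 < a + d) = (0 < a)].
Proof.
move=> a0 [->|H]; first by rewrite addr0.
have [d0|d0] := eqVneq d 0; first by rewrite d0 addr0.
have ad0 : a + d != 0.
  apply/eqP => /eqP; rewrite addr_eq0 => /eqP E.
  by move: H; rewrite E psi_opp ltxx.
split=> //.
  apply/eqP; rewrite eq_le; apply/andP; split; last first.
    by have := AC1 AC a0 d0 ad0; rewrite (min_idPl (ltW H)).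
  (* Otherwise a = (a + d) - d would be a difference of two elements of value greater than
     [psi a]. *)
  rewrite leNgt; apply/negP => H'.
  have := AC1 AC ad0 (_ : - d != 0); rewrite oppr_eq0 addrK => /(_ d0 a0).
  by rewrite psi_opp leNgt lt_min H H'.
case: (ltgtP a 0) a0 => // sa _.
  apply/negP => h.
  have : psi d <= psi (- a).
    by apply: psi_le; rewrite ?oopp_gt0 // -osub_ge0 opprK addrC ltW.
  by rewrite psi_opp leNgt H.
rewrite ltNge; apply/negP => h.
have : psi (- d) <= psi a.
  by apply: psi_le => //; rewrite -(oleD2r d) addNr.
by rewrite psi_opp leNgt H.
Qed.

Lemma above_lead_out c a d : ~ above c a -> above c d ->
  [/\ a + d != 0, psi (a + d) = psi a & (0 < a + d) = (0 < a)].
Proof.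
by move=> /aboveP [a0 ac] Hd; apply: above_lead => //; apply: above_le Hd.
Qed.

Lemma integralP a : integral psi a != 0 /\ integral psi a + psi (integral psi a) = a.
Proof.
rewrite /integral; case: xgetP => [b _ [b0 bE]//|H].
by have [b b0 bE] := T0_integration HT a; case: (H b).
Qed.

(* AC3 applied to [psi b - psi a] shows that it has value greater than
   [psi a]. *)
Lemma psi_sub_Psi c d : Psi c -> Psi d -> c < d -> c < psi (d - c).
Proof.
move=> _ [b b0 <-] lt_cd.
have d0 : 0 < psi b - c by rewrite osub_gt0.
have d0' : psi b - c != 0 by rewrite gt_eqF.
have := AC3 AC d0' b0 d0.
rewrite -osub_gt0 (_ : _ - _ = psi (psi b - c) - c) ?osub_gt0 //.
by zlin.
Qed.

(** If [psi a < psi b], then a - b has value [psi a] by dominance, but it equals [psi b - psi a],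
    whose value is greater than [psi a]. *)
Lemma integral_inj a b : a != 0 -> b != 0 -> a + psi a = b + psi b -> a = b.
Proof.
wlog ab : a b / psi a <= psi b.
  move=> W a0 b0 E; case: (leP (psi a) (psi b)) => H; first exact: W.
  by apply/esym/W => //; apply: ltW.
move=> a0 b0 E; move: ab; rewrite le_eqVlt => /orP [/eqP E'|lt_ab].
  by move: E; rewrite E' => /addIr.
have E' : a - b = psi b - psi a.
  have Ea : a = b + psi b - psi a by rewrite -E addrK.
  by rewrite {1}Ea; zlin.
have := psi_sub_Psi (Psi_psi a0) (Psi_psi b0) lt_ab.
rewrite -E'; have [|_ -> _] := @above_lead a (- b) a0; last by rewrite ltxx.
by right; rewrite psi_opp.
Qed.

Lemma integral_succ a : integral psi a = a - s a.
Proof. by have [_ {2}<-] := integralP a; rewrite addrK. Qed.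

Lemma sub_succ_neq0 a : a - s a != 0.
Proof. by rewrite -integral_succ; have [] := integralP a. Qed.

Lemma psi_sub_succ a : psi (a - s a) = s a.
Proof. by rewrite -integral_succ. Qed.

Lemma Psi_succ a : Psi (s a).
Proof. by apply: Psi_psi; have [] := integralP a. Qed.

(** Such an a - c is an integral of a, and integrals are unique. This fixed-point description of the
    successor is what later identifies successors in extensions. *)
Lemma succ_unique a c : a != c -> psi (a - c) = c -> s a = c.
Proof.
move=> ac E; rewrite /succ.
have [i0 iE] := integralP a.
have -> // : integral psi a = a - c.
by apply: integral_inj => //; rewrite ?subr_eq0 // iE E subrK.
Qed.

Lemma succ_gt c : Psi c -> c < s c.
Proof. by case/(T0_succ HT). Qed.

Lemma succ_le c d : Psi c -> Psi d -> c < d -> s c <= d.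
Proof.
move=> Pc Pd cd; have [_ _ H] := T0_succ HT Pc; rewrite leNgt.
by apply/negP => dc; apply: H; exists d.
Qed.

Lemma succ_homo c d : Psi c -> Psi d -> c < d -> s c < s d.
Proof.
by move=> Pc Pd /(succ_le Pc Pd) /le_lt_trans; apply; apply: succ_gt.
Qed.

Lemma succ_inj c d : Psi c -> Psi d -> s c = s d -> c = d.
Proof.
move=> Pc Pd E; case: (ltgtP c d) => // /succ_homo.
  by move=> /(_ Pc Pd); rewrite E ltxx.
by move=> /(_ Pd Pc); rewrite E ltxx.
Qed.

Lemma Psi_succ0 : Psi (s 0). Proof. by case: (T0_least HT). Qed.

Lemma succ0_le c : Psi c -> s 0 <= c.
Proof. by case: (T0_least HT) => _; apply. Qed.

Lemma Psi_gt_pred c : Psi_gt psi c -> exists2 d, Psi d & s d = c.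
Proof. by have [_ _ surj] := T0_bij HT; move=> /surj [d Pd <-]; exists d. Qed.

Lemma Psi_gt_succ c : Psi c -> Psi_gt psi (s c).
Proof. by have [H _ _] := T0_bij HT; exact: H. Qed.

(** In d - c = (s c - c) + (d - s c) the first term has value s c and the second is zero or has
    larger value, so only the smaller of the two Psi-elements matters. *)
Lemma psi_subPsi c d : Psi c -> Psi d -> c < d ->
  d - c != 0 /\ psi (d - c) = s c.
Proof.
move=> Pc Pd cd; split; first by rewrite subr_eq0 gt_eqF.
have E : psi (s c - c) = s c by rewrite -psi_opp opprB psi_sub_succ.
have := succ_le Pc Pd cd; rewrite le_eqVlt => /orP [/eqP <- //|lt_sd].
have -> : d - c = (s c - c) + (d - s c) by zlin.
have := @above_lead (s c - c) (d - s c); rewrite -opprB oppr_eq0 opprB E.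
move=> /(_ (sub_succ_neq0 _)) [] //; right.
exact: psi_sub_Psi (Psi_succ c) Pd lt_sd.
Qed.

Lemma above_subPsi c d : Psi c -> Psi d -> c <= d -> above c (d - c).
Proof.
move=> Pc Pd; rewrite le_eqVlt => /orP [/eqP <-|cd].
  by left; rewrite subrr.
by right; have [_ ->] := psi_subPsi Pc Pd cd; apply: succ_gt.
Qed.

End Valuation.

(** * Orbits of the successor function *)

Section Orbits.
Variables (G : orderedZmodType) (psi : G -> G) (HT : T0_model psi).
Implicit Types a b c : G.
Local Notation s := (succ psi).
Local Notation Psi := (Psi psi).
Local Notation above := (above psi).

Definition predf c : G := xget 0 [set b | Psi b /\ s b = c].

Lemma predfP c : Psi_gt psi c -> Psi (predf c) /\ s (predf c) = c.
Proof.
move=> /(Psi_gt_pred HT) [d Pd dE].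
by rewrite /predf; case: xgetP => [b _ //|/(_ d)]; case.
Qed.

Lemma succK c : Psi c -> predf (s c) = c.
Proof.
move=> Pc; have [Pp E] := predfP (Psi_gt_succ HT Pc).
exact: succ_inj Pp Pc E.
Qed.

Lemma Psi_iter_succ i c : Psi c -> Psi (iter i s c).
Proof. by move=> Pc; case: i => // i; rewrite iterS; apply: Psi_succ. Qed.

Lemma iter_succ_ge i c : Psi c -> c <= iter i s c.
Proof.
move=> Pc; elim: i => // i IH; rewrite iterS; apply: (le_trans IH).
by apply/ltW/succ_gt => //; apply: Psi_iter_succ.
Qed.

Lemma iter_succ_lt i j c : Psi c -> (i < j)%N -> iter i s c < iter j s c.
Proof.
move=> Pc; elim: j => // j IH; rewrite ltnS leq_eqVlt iterS.
have H := succ_gt HT (Psi_iter_succ j Pc).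
by case/orP => [/eqP -> //|/IH /lt_trans]; apply.
Qed.

(** Such a g lies above all finite iterates of s at s0, so its orbit is indexed by all integers and
    [p] never takes the value infinity on it. *)
Definition deep g := Psi g /\ forall m, Psi_gt psi (iter m predf g).

Definition orbit g (k : int) : G :=
  match k with Posz m => iter m s g | Negz m => iter m.+1 predf g end.

Lemma Psi_orbit g k : deep g -> Psi (orbit g k).
Proof.
by case: k => m [Pg H] /=; [exact: Psi_iter_succ | case: (predfP (H m))].
Qed.

Lemma orbitS g k : deep g -> s (orbit g k) = orbit g (k + 1).
Proof.
case: k => m [Pg H]; first by rewrite -PoszD addn1.
have [Pp E] := predfP (H m); rewrite [in LHS]/orbit iterS E.
case: m {Pp E} => // m.
by rewrite NegzE -(addn1 m.+1) PoszD opprD subrK -NegzE.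
Qed.

Lemma orbit_iter g k i : deep g -> iter i s (orbit g k) = orbit g (k + i%:Z).
Proof.
move=> Dg; elim: i => [|i IH]; first by rewrite addr0.
by rewrite iterS IH orbitS // -addrA -PoszD addn1.
Qed.

Lemma orbit_pred g k : deep g -> predf (orbit g k) = orbit g (k - 1).
Proof.
move=> Dg; rewrite -{1}(subrK 1 k) -orbitS // succK //.
exact: Psi_orbit.
Qed.

(* The element [P(s) c]. *)
Definition hcomb (P : {poly int}) c : G :=
  \sum_(i < size P) iter i s c *~ P`_i.

Lemma hcombE n (P : {poly int}) c : (size P <= n)%N ->
  hcomb P c = \sum_(i < n) iter i s c *~ P`_i.
Proof.
move=> le_n; rewrite /hcomb (big_ord_widen n (fun i => iter i s c *~ P`_i)) //.
rewrite big_mkcond; apply: eq_bigr => i _; case: ifP => // /negbT.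
by rewrite -leqNgt => /leq_sizeP -> //; rewrite mulr0z.
Qed.

Lemma hcombD (P Q : {poly int}) c : hcomb (P + Q) c = hcomb P c + hcomb Q c.
Proof.
pose n := maxn (size P) (size Q).
rewrite !(@hcombE n) ?leq_maxl ?leq_maxr //; last exact: size_polyD.
rewrite -big_split; apply: eq_bigr => i _.
by rewrite coefD mulrzDr.
Qed.

Lemma hcombN (P : {poly int}) c : hcomb (- P) c = - hcomb P c.
Proof.
rewrite /hcomb size_polyN -sumrN; apply: eq_bigr => i _.
by rewrite coefN mulrNz.
Qed.

Lemma hcomb0 c : hcomb 0 c = 0.
Proof. by rewrite /hcomb size_poly0 big_ord0. Qed.

Lemma hcombMn (P : {poly int}) n c : hcomb (P *+ n) c = hcomb P c *+ n.
Proof.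
by elim: n => [|n IH]; rewrite ?mulr0n ?hcomb0 // !mulrS hcombD IH.
Qed.

Lemma hcombMX (P : {poly int}) c : hcomb (P * 'X) c = hcomb P (s c).
Proof.
rewrite (@hcombE (size P).+1); last first.
  by rewrite (leq_trans (size_polyMleq _ _)) // size_polyX addn2.
rewrite big_ord_recl coefMX /= mulr0z add0r; apply: eq_bigr => i _.
by rewrite coefMX /= -iterS iterSr.
Qed.

Lemma hcombMXn (P : {poly int}) n c : hcomb (P * 'X^n) c = hcomb P (iter n s c).
Proof.
elim: n c => [|n IH] c; first by rewrite expr0 mulr1.
by rewrite exprSr mulrA hcombMX IH iterSr.
Qed.

Lemma hcombX c : hcomb 'X c = s c.
Proof.
by rewrite /hcomb size_polyX !big_ord_recl big_ord0 !coefX /= mulr0z mulr1z add0r addr0.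
Qed.

Lemma hcomb_sub (P : {poly int}) c d :
  hcomb P c - d *~ P.[1] = \sum_(i < size P) (iter i s c - d) *~ P`_i.
Proof.
rewrite horner_coef mulrz_sumr -sumrB; apply: eq_bigr => i _.
by rewrite expr1n mulr1 mulrzDl mulNrz.
Qed.

(** Each iterate of s at c differs from a only by something of value greater than a. Replacing all
    iterates by a turns P(s) c into the multiple of a by the sum of the coefficients, which is
    P(1). *)
Lemma hcomb_above (P : {poly int}) a c : Psi a -> Psi c -> a <= c ->
  above a (hcomb P c - a *~ P.[1]).
Proof.
move=> Pa Pc ac; rewrite hcomb_sub; apply: above_sum => // i.
apply: above_mulrz => //; apply: above_subPsi => //.
  exact: Psi_iter_succ.
exact: le_trans (iter_succ_ge _ _).
Qed.

(** With d beyond all the iterates, the i-th difference has value equal to the iterate of index i +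
    1. These values increase with i, so the constant term leads; the sign is reversed because c - d
    is negative. *)
Lemma hcomb_lead (P : {poly int}) c d : Psi c -> Psi d -> P`_0 != 0 ->
    (forall i, (i < size P)%N -> iter i s c < d) ->
  let D := hcomb P c - d *~ P.[1] in
  [/\ D != 0, psi D = s c & (0 < D) = (P`_0 < 0)].
Proof.
move=> Pc Pd P0 lt_d /=; rewrite hcomb_sub.
case E : (size P) => [|n].
  by move: P0; rewrite nth_default ?eqxx // E.
have lt0 : c < d by apply: (lt_d 0%N); rewrite E.
rewrite big_ord_recl /=.
have [dc0 dcE] := psi_subPsi HT Pc Pd lt0.
have cd0 : c - d != 0 by rewrite -opprB oppr_eq0.
have cdE : psi (c - d) = s c by rewrite -(psi_opp HT) opprB.
have lead0 : (c - d) *~ P`_0 != 0 by rewrite omulrz_eq0.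
have leadE : psi ((c - d) *~ P`_0) = s c by rewrite (psi_mulrz HT cd0 P0).
have [|-> -> ->] := above_lead HT lead0
    (d := \sum_(i < n) (iter (lift ord0 i) s c - d) *~ P`_(lift ord0 i)).
  rewrite leadE; apply: above_sum => // i; apply: above_mulrz => //.
  right; rewrite -(psi_opp HT) opprB.
  have [|_ ->] := psi_subPsi HT (Psi_iter_succ (lift ord0 i) Pc) Pd.
    by apply: lt_d; rewrite E ltnS; apply: (ltn_ord i).
  by rewrite -iterS; apply: (iter_succ_lt (i := 1)).
split=> //; case: (ltgtP (P`_0) 0) P0 => // P0 _.
  by rewrite omulrz_gt0N // -oopp_gt0 opprB osub_gt0.
by rewrite omulrz_gt0 // osub_gt0 ltNge (ltW lt0).
Qed.

(** A power of X can be absorbed into the base point on the orbit, which leaves the nonzero constant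
    coefficient that the dominance argument needs. *)
Lemma poly_val_factor (P : {poly int}) : P != 0 ->
  exists k, exists2 Q : {poly int}, Q`_0 != 0 & P = Q * 'X^k.
Proof.
elim/poly_ind: P => [|P c IH]; first by rewrite eqxx.
have [->|c0] := eqVneq c 0.
  rewrite addr0 mulf_eq0 polyX_eq0 orbF => /IH [k [Q Q0 ->]].
  by exists k.+1, Q => //; rewrite exprSr mulrA.
by exists 0%N, (P * 'X + c%:P); rewrite ?expr0 ?mulr1 // coefD coefMX coefC add0r.
Qed.

End Orbits.

(** * Partial isomorphisms *)

Section PartialIso.
Variables (G : orderedZmodType) (psi : G -> G) (HT : T0_model psi).
Implicit Types a b c : G.
Local Notation s := (succ psi).
Local Notation Psi := (Psi psi).
Local Notation above := (above psi).
Local Notation predf := (predf psi).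

(* The graph of an isomorphism between two substructures of the model. *)
Record piso (R : set (G * G)) : Prop := PIso {
  piso0 : R (0, 0);
  pisoB : forall a a' b b', R (a, a') -> R (b, b') -> R (a - b, a' - b');
  piso_div : forall n a a', (0 < n)%N -> R (a *+ n, a' *+ n) -> R (a, a');
  piso_gt0 : forall a a', R (a, a') -> (0 < a) = (0 < a');
  piso_psi : forall a a', a != 0 -> R (a, a') -> R (psi a, psi a');
  piso_succ : forall a a', R (a, a') -> R (s a, s a');
  piso_Psi : forall a a', R (a, a') -> Psi a <-> Psi a';
  piso_pred : forall a a', R (a, a') -> Psi_gt psi a ->
    R (predf a, predf a')
}.

Section Theory.
Variables (R : set (G * G)) (HR : piso R).

Lemma pisoN a a' : R (a, a') -> R (- a, - a').
Proof. by move=> H; rewrite -(sub0r a) -(sub0r a'); apply: (pisoB HR (piso0 HR) H). Qed.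

Lemma pisoD a a' b b' : R (a, a') -> R (b, b') -> R (a + b, a' + b').
Proof.
by move=> Ha Hb; rewrite -(opprK b) -(opprK b'); apply: (pisoB HR Ha); apply: pisoN.
Qed.

Lemma piso_mulrn a a' n : R (a, a') -> R (a *+ n, a' *+ n).
Proof.
move=> H; elim: n => [|n IH]; first by rewrite !mulr0n; apply: (piso0 HR).
by rewrite !mulrS; apply: pisoD.
Qed.

Lemma piso_mulrz a a' (z : int) : R (a, a') -> R (a *~ z, a' *~ z).
Proof.
case: z => n H; first by rewrite -!pmulrn; apply: piso_mulrn.
by rewrite NegzE !mulrNz -!pmulrn; apply/pisoN/piso_mulrn.
Qed.

Lemma piso_lt a a' b b' : R (a, a') -> R (b, b') -> (a < b) = (a' < b').
Proof.
move=> Ha Hb; rewrite -(osub_gt0 a b) -(osub_gt0 a' b').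
by apply: (piso_gt0 HR); apply: (pisoB HR).
Qed.

Lemma piso_eq a a' b b' : R (a, a') -> R (b, b') -> (a == b) = (a' == b').
Proof.
move=> Ha Hb; rewrite !eq_le !leNgt.
by rewrite (piso_lt Ha Hb) (piso_lt Hb Ha).
Qed.

Lemma piso_eq0 a a' : R (a, a') -> (a == 0) = (a' == 0).
Proof. by move=> Ha; apply: piso_eq => //; apply: (piso0 HR). Qed.

Lemma piso_fun a a' b' : R (a, a') -> R (a, b') -> a' = b'.
Proof. by move=> Ha Hb; apply/eqP; rewrite -(piso_eq Ha Hb). Qed.

Lemma piso_succ0 : R (s 0, s 0).
Proof. by apply/(piso_succ HR)/(piso0 HR). Qed.

Lemma piso_Psi_gt a a' : R (a, a') -> Psi_gt psi a <-> Psi_gt psi a'.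
Proof.
move=> Ha; have [H1 H2] := piso_Psi HR Ha.
by split=> -[/= Pa lt_a]; split; try exact: H1; try exact: H2;
  move: lt_a; rewrite (piso_lt piso_succ0 Ha).
Qed.

Lemma piso_above a a' c c' : R (a, a') -> R (c, c') -> above c a -> above c' a'.
Proof.
move=> Ha Hc; have [-> _|a0] := eqVneq a' 0; first by left.
have a0' : a != 0 by rewrite (piso_eq0 Ha).
move=> [E|H]; first by rewrite E eqxx in a0'.
by right; rewrite -(piso_lt Hc (piso_psi HR a0' Ha)).
Qed.

Lemma piso_divz a a' (z : int) : z != 0 -> R (a, a') ->
  exists b b', [/\ R (b, b'), a = b *~ z & a' = b' *~ z].
Proof.
move=> z0 Ha.
have n0 : (0 < `|z|)%N by rewrite absz_gt0.
have [b bE] := T0_divisible HT a n0; have [b' bE'] := T0_divisible HT a' n0.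
have Hb : R (b, b') by apply: (piso_div HR n0); rewrite bE bE'.
case: z {z0 n0} bE bE' => n /= bE bE'; first by exists b, b'.
exists (- b), (- b'); rewrite NegzE !mulrNz !mulNrz !opprK -bE -bE'.
by split=> //; apply: pisoN.
Qed.

End Theory.

(** The inverse isomorphism, by which facts proved about the domain also apply to the range. *)
Definition flip (R : set (G * G)) : set (G * G) := [set x | R (x.2, x.1)].

Lemma piso_flip R : piso R -> piso (flip R).
Proof.
move=> HR; split=> /=; rewrite /flip /=.
- exact: piso0 HR.
- by move=> a a' b b'; apply: pisoB.
- by move=> n a a'; apply: piso_div.
- by move=> a a' /(piso_gt0 HR).
- by move=> a a' a0 H; apply: piso_psi => //; rewrite (piso_eq0 HR H).
- by move=> a a'; apply: piso_succ.
- by move=> a a' /(piso_Psi HR) [].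
- by move=> a a' H /(piso_Psi_gt HR H); apply: piso_pred.
Qed.

(* [g] and [g'] lie in corresponding cuts of the Psi-sets of the domain and of
   the range of [R]. *)
Record cut_match (R : set (G * G)) g g' : Prop := CutMatch {
  cut_Psi : Psi g;
  cut_Psi' : Psi g';
  cut_lt : forall a a', R (a, a') -> Psi a -> (a < g) = (a' < g');
  cut_neq : forall a a', R (a, a') -> a != g;
  cut_neq' : forall a a', R (a, a') -> a' != g'
}.

Lemma cut_match_flip R g g' : piso R -> cut_match R g g' ->
  cut_match (flip R) g' g.
Proof.
move=> HR [Pg Pg' Hlt Hn Hn']; split=> //; rewrite /flip /=.
- by move=> a a' H /(piso_Psi HR H) Pa; rewrite (Hlt _ _ H Pa).
- by move=> a a' /Hn'.
- by move=> a a' /Hn.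
Qed.

(** If g' were the image of some a, then g < a. The predecessor of a has its image below g', so it
    lies below g itself, and its successor a would be at most g. *)
Lemma cut_matchI R g g' : piso R -> Psi g -> Psi g' ->
  (forall a a', R (a, a') -> Psi a -> (a < g) = (a' < g')) ->
  (forall a a', R (a, a') -> a != g) -> cut_match R g g'.
Proof.
move=> HR Pg Pg' Hlt Hn; split=> // a a' H; apply/eqP => E.
have Pa' : Psi a' by rewrite E.
have /(piso_Psi HR H) Pa := Pa'.
have ga : g < a.
  by rewrite lt_neqAle eq_sym (Hn _ _ H) /= leNgt (Hlt _ _ H) // E ltxx.
have gt_a : Psi_gt psi a.
  by split=> //=; apply: le_lt_trans ga; apply: succ0_le.
have [Pp pE] := predfP HT gt_a.
have Hp := piso_pred HR H gt_a.
have [Pp' pE'] := predfP HT (iffLR (piso_Psi_gt HR H) gt_a).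
have : predf a' < g' by rewrite -E -{2}pE'; apply: succ_gt.
rewrite -(Hlt _ _ Hp Pp) => /(succ_le HT Pp Pg).
by rewrite pE leNgt ga.
Qed.

(** * The orbit of a Psi-element that fills a cut *)

Section Cut.
Variables (R : set (G * G)) (HR : piso R) (g g' : G) (Hg : cut_match R g g').

Lemma cut_succ a a' : R (a, a') -> Psi a -> a < g -> s a < g.
Proof.
move=> H Pa lt_a; rewrite lt_neqAle (cut_neq Hg (piso_succ HR H)) /=.
exact: succ_le (cut_Psi Hg) lt_a.
Qed.

(** The induction ranges over all a below the cut: s a is again below it, and the bound by s a for
    one predecessor gives the bound by a for the next. *)
Lemma cut_iter_pred m a a' : R (a, a') -> Psi a -> a < g ->
  Psi (iter m predf g) /\ a < iter m predf g.
Proof.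
elim: m a a' => [|m IH] a a' H Pa lt_a; first by split=> //; apply: cut_Psi Hg.
have Hs := piso_succ HR H.
have [Pm lt_m] := IH _ _ Hs (Psi_succ HT a) (cut_succ H Pa lt_a).
have gt_m : Psi_gt psi (iter m predf g).
  by split=> //=; apply: le_lt_trans lt_m; apply: succ0_le (Psi_succ HT a).
have [Pp pE] := predfP HT gt_m; split=> //; rewrite ltNge; apply/negP => /=.
rewrite le_eqVlt => /orP [/eqP E|/(succ_homo HT Pp Pa)].
  by move: lt_m; rewrite -pE /= -E ltxx.
by rewrite pE ltNge (ltW lt_m).
Qed.

Lemma cut_succ0 : s 0 < g.
Proof.
rewrite lt_neqAle (cut_neq Hg (piso_succ0 HR)) /=.
exact: succ0_le (cut_Psi Hg).
Qed.

Lemma cut_deep : deep psi g.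
Proof.
split=> [|m]; first exact: cut_Psi Hg.
exact: cut_iter_pred (piso_succ0 HR) (Psi_succ0 HT) cut_succ0.
Qed.

Lemma cut_orbit_gt k a a' : R (a, a') -> Psi a -> a < g -> a < orbit psi g k.
Proof.
move=> H Pa lt_a; case: k => m; last by have [] := cut_iter_pred m.+1 H Pa lt_a.
by apply: lt_le_trans (iter_succ_ge HT m (cut_Psi Hg)).
Qed.

(** Predecessors of a stay above g because g is not in the domain, so finitely many successor steps
    from g cannot reach a. An arbitrary index k is bounded by its absolute value. *)
Lemma cut_orbit_lt k a a' : R (a, a') -> Psi a -> g < a -> orbit psi g k < a.
Proof.
have Dg := cut_deep; move=> H Pa ga.
have pos m : forall b b', R (b, b') -> Psi b -> g < b -> iter m s g < b.
  elim: m => // m IH b b' Hb Pb gb; rewrite iterS.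
  have gt_b : Psi_gt psi b.
    by split=> //=; apply: le_lt_trans gb; apply: succ0_le (cut_Psi Hg).
  have [Pp pE] := predfP HT gt_b.
  have Hp := piso_pred HR Hb gt_b.
  rewrite -pE; apply: (succ_homo HT) => //.
    exact: (Psi_iter_succ HT _ (cut_Psi Hg)).
  apply: (IH _ _ Hp) => //; rewrite lt_neqAle eq_sym (cut_neq Hg Hp) /=.
  rewrite leNgt; apply/negP => /(succ_le HT Pp (cut_Psi Hg)).
  by rewrite pE leNgt gb.
apply: le_lt_trans (pos `|k|%N _ _ H Pa ga).
have Dk : k <= `|k|%:Z by rewrite abszE ler_norm.
have Pk := Psi_orbit HT k Dg.
rewrite (_ : iter _ _ _ = orbit psi g `|k|%:Z) //.
rewrite -(subrK k `|k|%:Z) addrC.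
have : 0 <= `|k|%:Z - k by rewrite subr_ge0.
case: (_ - _) => // i _; rewrite -(orbit_iter HT) //.
exact: iter_succ_ge.
Qed.

Lemma hcomb_shift (P : {poly int}) j k : deep psi g ->
  hcomb psi P (orbit psi g k) = hcomb psi (P * 'X^j) (orbit psi g (k - j%:Z)).
Proof. by move=> Dg; rewrite hcombMXn orbit_iter // subrK. Qed.

(* The element [a * P(1) - b] approximates [P(s) g - b] up to [above a]. *)
Lemma adjoin_low (P : {poly int}) k a a' b b' :
    R (a, a') -> Psi a -> a < g -> R (b, b') ->
    ~ above a (a *~ P.[1] - b) ->
  let D := hcomb psi P (orbit psi g k) - b in
  [/\ D != 0, psi D = psi (a *~ P.[1] - b) & (0 < D) = (0 < a *~ P.[1] - b)].
Proof.
move=> Ha Pa lt_a Hb Hn /=.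
have -> : hcomb psi P (orbit psi g k) - b =
    (a *~ P.[1] - b) + (hcomb psi P (orbit psi g k) - a *~ P.[1]) by zlin.
apply: (above_lead_out HT Hn).
apply: hcomb_above => //; first exact: Psi_orbit cut_deep.
exact: ltW (cut_orbit_gt _ Ha Pa lt_a).
Qed.

(** The hypothesis pushes b beyond the cut. If P(1) = 0, a nonzero b must have its value above g, so
    b is negligible. Otherwise b is a multiple by P(1) of some b1; since s b1 - b1 has value s b1,
    the element s b1 must lie above g, and P(s) is compared with s b1 in place of b1. *)
Lemma adjoin_high (P : {poly int}) k b b' : P`_0 != 0 -> R (b, b') ->
    (forall a a', R (a, a') -> Psi a -> a < g -> above a (a *~ P.[1] - b)) ->
  let D := hcomb psi P (orbit psi g k) - b in
  [/\ D != 0, psi D = s (orbit psi g k) & (0 < D) = (P`_0 < 0)].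
Proof.
have Dg := cut_deep; set c := orbit psi g k => P0 Hb Hab /=.
have Pc : Psi c by apply: Psi_orbit.
have [z0|z0] := eqVneq P.[1] 0.
  have [||E0 EV E] := hcomb_lead HT (d := iter (size P) s c) Pc _ P0.
  - exact: Psi_iter_succ.
  - by move=> i Hi; apply: iter_succ_lt.
  rewrite z0 mulr0z subr0 in E0 EV E.
  rewrite -EV -E; apply: above_lead => //; rewrite EV; apply: aboveN => //.
  have [->|b0] := eqVneq b 0; first by left.
  right; rewrite orbitS //.
  have Hpb := piso_psi HR b0 Hb; have Ppb := Psi_psi psi b0.
  apply: (cut_orbit_lt _ Hpb Ppb).
  rewrite lt_neqAle eq_sym (cut_neq Hg Hpb) /= leNgt; apply/negP => lt_b.
  have := Hab _ _ Hpb Ppb lt_b; rewrite z0 mulr0z sub0r.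
  by case=> [/eqP|]; rewrite ?oppr_eq0 ?(negPf b0) // (psi_opp HT) ltxx.
have [b1 [b1' [Hb1 bE bE']]] := piso_divz HR z0 Hb.
have Hs := piso_succ HR Hb1.
have Ps := Psi_succ HT b1.
have [lt_s|le_s] := ltP (s b1) g.
  have := Hab _ _ Hs Ps lt_s; rewrite bE -mulrzBl.
  have sb0 : s b1 - b1 != 0 by rewrite -opprB oppr_eq0 sub_succ_neq0.
  case=> [/eqP|]; first by rewrite omulrz_eq0 // (negPf sb0).
  by rewrite psi_mulrz // -opprB (psi_opp HT) (psi_sub_succ HT) ltxx.
have gs : g < s b1 by rewrite lt_neqAle eq_sym (cut_neq Hg Hs).
have [|E0 EV E] := hcomb_lead HT (d := s b1) Pc Ps P0.
  by move=> i Hi; rewrite orbit_iter //; apply: cut_orbit_lt Hs Ps gs.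
have -> : hcomb psi P c - b =
    (hcomb psi P c - s b1 *~ P.[1]) + (s b1 - b1) *~ P.[1].
  by rewrite bE mulrzBl; zlin.
rewrite -EV -E; apply: above_lead => //; apply: above_mulrz => //; right.
rewrite EV -[X in _ < X](psi_opp HT) opprB (psi_sub_succ HT) orbitS //.
exact: cut_orbit_lt Hs Ps gs.
Qed.

End Cut.
End PartialIso.

(** * Adjoining an orbit to a partial isomorphism *)

Section Adjoin.
Variables (G : orderedZmodType) (psi : G -> G) (HT : T0_model psi).
Implicit Types a b c : G.
Local Notation s := (succ psi).
Local Notation Psi := (Psi psi).
Local Notation above := (above psi).
Local Notation predf := (predf psi).
Local Notation orbit := (orbit psi).
Local Notation hcomb := (hcomb psi).

(** The divisible hull of R and the two orbits. The free index k lets ordinary polynomials serve as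
    Laurent polynomials in s. *)
Definition adjoin (R : set (G * G)) g g' : set (G * G) :=
  [set f | exists n (P : {poly int}) k b b', [/\ (0 < n)%N, R (b, b'),
     f.1 *+ n = hcomb P (orbit g k) - b & f.2 *+ n = hcomb P (orbit g' k) - b']].

Lemma adjoin_flip R g g' x : adjoin (flip R) g' g (x.2, x.1) <-> adjoin R g g' x.
Proof.
by split=> -[n [P [k [b [b' [n0 H E E']]]]]]; exists n, P, k, b', b.
Qed.

Section Half.
Variables (R : set (G * G)) (HR : piso psi R) (g g' : G).
Hypothesis Hg : cut_match psi R g g'.
Let Hg' : cut_match psi (flip R) g' g := cut_match_flip HR Hg.
Let HR' := piso_flip HR.
Let Dg := cut_deep HT HR Hg.
Let Dg' := cut_deep HT HR' Hg'.

Lemma adjoin_sub f f' : R (f, f') -> adjoin R g g' (f, f').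
Proof.
move=> Hf; exists 1%N, 0, 0, (- f), (- f'); split=> //=; first exact: (pisoN HR).
  by rewrite hcomb0 mulr1n sub0r opprK.
by rewrite hcomb0 mulr1n sub0r opprK.
Qed.

Lemma adjoin_orbit k : adjoin R g g' (orbit g k, orbit g' k).
Proof.
exists 1%N, 'X, (k - 1), 0, 0; split=> //=; first exact: piso0 HR.
  by rewrite mulr1n hcombX orbitS // subrK subr0.
by rewrite mulr1n hcombX orbitS // subrK subr0.
Qed.

Lemma adjoinB f1 f1' f2 f2' : adjoin R g g' (f1, f1') ->
  adjoin R g g' (f2, f2') -> adjoin R g g' (f1 - f2, f1' - f2').
Proof.
move=> [n1 [P1 [k1 [b1 [b1' [/= n10 H1 E1 E1']]]]]].
move=> [n2 [P2 [k2 [b2 [b2' [/= n20 H2 E2 E2']]]]]].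
(* A common base point at or below both indices; the nonnegative shifts from it become powers of
   X. *)
pose k : int := - (`|k1| + `|k2|).
have absD (x : int) : 0 <= x + `|x|.
  by have := ler_norm (- x); rewrite normrN -subr_ge0 opprK addrC.
have [j1 Ej1] : exists j : nat, k1 - j%:Z = k.
  exists `|k1 - k|%N; rewrite abszE ger0_norm ?subKr // /k opprK addrA.
  by rewrite addr_ge0.
have [j2 Ej2] : exists j : nat, k2 - j%:Z = k.
  exists `|k2 - k|%N; rewrite abszE ger0_norm ?subKr // /k opprK addrCA.
  by rewrite addr_ge0.
pose Q1 := P1 * 'X^j1 *+ n2; pose Q2 := P2 * 'X^j2 *+ n1.
exists (n1 * n2)%N, (Q1 - Q2), k, (b1 *+ n2 - b2 *+ n1), (b1' *+ n2 - b2' *+ n1).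
have aux h x1 x2 y1 y2 : deep psi h ->
    x1 *+ n1 = hcomb P1 (orbit h k1) - y1 ->
    x2 *+ n2 = hcomb P2 (orbit h k2) - y2 ->
    (x1 - x2) *+ (n1 * n2) =
    hcomb (Q1 - Q2) (orbit h k) - (y1 *+ n2 - y2 *+ n1).
  move=> Dh; rewrite (hcomb_shift HT P1 j1) // (hcomb_shift HT P2 j2) // Ej1 Ej2.
  move=> A1 A2; rewrite mulrnBl mulrnA A1 mulnC mulrnA A2.
  rewrite hcombD hcombN !hcombMn !mulrnBl; zlin.
split=> /=; first by rewrite muln_gt0 n10.
- by apply: (pisoB HR); apply: (piso_mulrn HR).
- exact: aux.
- exact: aux.
Qed.

Lemma adjoin_div n f f' : (0 < n)%N -> adjoin R g g' (f *+ n, f' *+ n) ->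
  adjoin R g g' (f, f').
Proof.
move=> n0 [m [P [k [b [b' [/= m0 H E E']]]]]].
exists (n * m)%N, P, k, b, b'; rewrite /= !mulrnA.
by split; rewrite // muln_gt0 n0.
Qed.

Lemma adjoin_normal f f' : adjoin R g g' (f, f') -> R (f, f') \/
  exists n (P : {poly int}) k b b', [/\ (0 < n)%N, P`_0 != 0, R (b, b'),
     f *+ n = hcomb P (orbit g k) - b & f' *+ n = hcomb P (orbit g' k) - b'].
Proof.
move=> [n [P [k [b [b' [/= n0 H E E']]]]]].
have [P0|/poly_val_factor [j [Q Q0 PE]]] := eqVneq P 0.
  left; apply: (piso_div HR n0); rewrite E E' P0 !hcomb0 !sub0r.
  exact: (pisoN HR).
right; exists n, Q, (k + j%:Z), b, b'; split=> //.
  by rewrite E PE hcombMXn orbit_iter.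
by rewrite E' PE hcombMXn orbit_iter.
Qed.

(* Either some element of the cut below [g] separates [b] from the orbit of
   [g], and the image of that element does the same, or none does. *)
Lemma adjoin_core (P : {poly int}) k b b' : P`_0 != 0 -> R (b, b') ->
  let D := hcomb P (orbit g k) - b in
  let D' := hcomb P (orbit g' k) - b' in
  [/\ D != 0, (0 < D) = (0 < D') & adjoin R g g' (psi D, psi D')] /\
  ((forall a a', R (a, a') -> Psi a -> a < g -> above a (a *~ P.[1] - b)) ->
   psi D = s (orbit g k) /\ psi D' = s (orbit g' k)).
Proof.
move=> P0 Hb D D'.
have [low|high] := pselect (exists a a', [/\ R (a, a'), Psi a, a < g &
  ~ above a (a *~ P.[1] - b)]).
  have [a [a' [Ha Pa lt_a Hn]]] := low.
  have Pa' := iffLR (piso_Psi HR Ha) Pa.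
  have lt_a' : a' < g' by rewrite -(cut_lt Hg Ha).
  have Hc : R (a *~ P.[1] - b, a' *~ P.[1] - b').
    by apply: (pisoB HR) => //; apply: (piso_mulrz HR).
  have Hn' : ~ above a' (a' *~ P.[1] - b').
    by move=> H; apply/Hn/(piso_above HR' (a := a' *~ P.[1] - b') (c := a')).
  have [D0 DV DE] := adjoin_low HT HR Hg k Ha Pa lt_a Hb Hn.
  have [D0' DV' DE'] := adjoin_low HT HR' Hg' k
    (Ha : flip R (a', a)) Pa' lt_a' (Hb : flip R (b', b)) Hn'.
  split; last by move=> H; case: Hn; apply: H Ha Pa lt_a.
  split=> //; first by rewrite DE DE' (piso_gt0 HR Hc).
  rewrite DV DV'; apply: adjoin_sub; apply: (piso_psi HR) => //.
  by case: (aboveP Hn).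
have Hab a a' : R (a, a') -> Psi a -> a < g -> above a (a *~ P.[1] - b).
  by move=> Ha Pa lt_a; apply: contrapT => H; apply: high; exists a, a'.
have [D0 DV DE] := adjoin_high HT HR Hg k P0 Hb Hab.
have [|D0' DV' DE'] := adjoin_high HT HR' Hg' k P0 (Hb : flip R (b', b)).
  move=> a a' Ha Pa lt_a.
  have Pa' := iffRL (piso_Psi HR Ha) Pa.
  have H := Hab _ _ Ha Pa'; rewrite (cut_lt Hg Ha Pa') in H.
  apply: (piso_above HR _ Ha (H lt_a)).
  by apply: (pisoB HR) => //; apply: (piso_mulrz HR).
split; last by move=> _; split.
split=> //; first by rewrite DE DE'.
by rewrite DV DV' !orbitS //; apply: adjoin_orbit.
Qed.

Lemma adjoin_gt0 f f' : adjoin R g g' (f, f') -> (0 < f) = (0 < f').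
Proof.
move=> /adjoin_normal [/(piso_gt0 HR)//|].
move=> [n [P [k [b [b' [n0 P0 Hb E E']]]]]].
rewrite -(omulrn_gt0 f n0) -(omulrn_gt0 f' n0) E E'.
by have [[]] := adjoin_core k P0 Hb.
Qed.

Lemma adjoin_psi f f' : f != 0 -> adjoin R g g' (f, f') ->
  adjoin R g g' (psi f, psi f').
Proof.
move=> f0 H; have f0' : f' != 0.
  move: f0; rewrite !neq_lt -!oopp_gt0 (adjoin_gt0 H).
  have HN : adjoin R g g' (- f, - f').
    rewrite -(sub0r f) -(sub0r f'); apply: adjoinB => //.
    exact/adjoin_sub/(piso0 HR).
  by rewrite (adjoin_gt0 HN).
move: H => /adjoin_normal [/(piso_psi HR f0)|]; first exact: adjoin_sub.
move=> [n [P [k [b [b' [n0 P0 Hb E E']]]]]].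
rewrite -(psi_mulrn HT f0 n0) -(psi_mulrn HT f0' n0) E E'.
by have [[]] := adjoin_core k P0 Hb.
Qed.

Lemma adjoin_fun f f1 f2 : adjoin R g g' (f, f1) -> adjoin R g g' (f, f2) ->
  f1 = f2.
Proof.
move=> H1 H2.
have := adjoin_gt0 (adjoinB H1 H2); have := adjoin_gt0 (adjoinB H2 H1).
rewrite subrr ltxx !osub_gt0; by case: ltgtP.
Qed.

(* The successor of an element of the extension lies in [R] unless the element
   agrees with the Psi-elements of [R] below [g]. *)
Lemma adjoin_succ_cases f f' : adjoin R g g' (f, f') ->
  R (s f, s f') \/ exists k, s f = orbit g k /\ s f' = orbit g' k.
Proof.
move=> /adjoin_normal [/(piso_succ HR)|]; first by left.
move=> [n [P [k [b [b' [n0 P0 Hb E E']]]]]].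
have [low|high] := pselect (exists a a', [/\ R (a, a'), Psi a, a < g &
  ~ above a (f - a)]).
  left; have [a [a' [Ha Pa lt_a Hn]]] := low.
  have Pa' := iffLR (piso_Psi HR Ha) Pa.
  have lt_a' : a' < g' by rewrite -(cut_lt Hg Ha).
  have Hc : R (a *~ P.[1] - b, a' *~ P.[1] - b').
    by apply: (pisoB HR) => //; apply: (piso_mulrz HR).
  (* The element e arises from f when all orbit elements are replaced by a. It lies in the domain of
     R and differs from f by something of value greater than a, whereas s e <= a; hence f and e have
     the same successor. *)
  have [e eE] := T0_divisible HT (a *~ P.[1] - b) n0.
  have [e' eE'] := T0_divisible HT (a' *~ P.[1] - b') n0.
  have He : R (e, e') by apply: (piso_div HR n0); rewrite eE eE'.
  have close h x y z w d : Psi w -> deep psi h -> w < orbit h k ->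
      x *+ n = hcomb P (orbit h k) - y -> z *+ n = w *~ P.[1] - y ->
      z != d -> psi (z - d) = d -> d <= w -> s x = d.
    move=> Pw Dh lt_w xE zE zd dE le_d.
    have Hxz : above w (x - z).
      apply/(above_mulrnE HT _ _ n0); rewrite mulrnBl xE zE.
      rewrite (_ : _ - _ = hcomb P (orbit h k) - w *~ P.[1]); last by zlin.
      by apply: hcomb_above => //; [exact: Psi_orbit|exact: ltW].
    have zd0 : z - d != 0 by rewrite subr_eq0.
    have [|xd0 xdE _] := above_lead HT zd0 (d := x - z).
      by rewrite dE; apply: above_le Hxz.
    have dx : z - d + (x - z) = x - d by zlin.
    by rewrite dx dE in xdE; rewrite dx in xd0;
       apply: (succ_unique HT); rewrite // -subr_eq0.
  have Hfe : above a (f - e).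
    apply/(above_mulrnE HT _ _ n0); rewrite mulrnBl E eE.
    rewrite (_ : _ - _ = hcomb P (orbit g k) - a *~ P.[1]); last by zlin.
    apply: hcomb_above => //; first exact: Psi_orbit.
    exact/ltW/(cut_orbit_gt HT HR Hg k Ha Pa lt_a).
  have le_se : s e <= a.
    (* If a < s e, then f - a would be a sum of three terms of value greater than a. *)
    rewrite leNgt; apply/negP => lt_se; apply: Hn.
    rewrite (_ : f - a = (f - e) + ((e - s e) + (s e - a))); last by zlin.
    apply: aboveD => //; apply: aboveD => //.
      by right; rewrite psi_sub_succ.
    by apply: above_subPsi => //; [exact: Psi_succ|exact: ltW].
  have Hs := piso_succ HR He.
  have le_se' : s e' <= a' by rewrite leNgt -(piso_lt HR Ha Hs) -leNgt.
  have nz x : x != s x by rewrite -subr_eq0 sub_succ_neq0.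
  rewrite (close _ _ _ _ _ (s e) Pa Dg _ E eE) ?psi_sub_succ //; last first.
    exact: (cut_orbit_gt HT HR Hg k Ha Pa lt_a).
  rewrite (close _ _ _ _ _ (s e') Pa' Dg' _ E' eE') ?psi_sub_succ //.
  exact: (cut_orbit_gt HT HR' Hg' k (Ha : flip R (a', a)) Pa' lt_a').
right; exists (k + 1).
(* With this Q, the combination Q(s) - b at index k is n times the difference of f and the orbit
   element of index k + 1. Its value is that same orbit element, which is therefore s f. *)
pose Q := P - 'X *+ n.
have Q0 : Q`_0 != 0 by rewrite coefB coefMn coefX mul0rn subr0.
have Q1 : Q.[1] = P.[1] - n%:Z by rewrite hornerD hornerN hornerMn hornerX natz.
have HQ h x y : deep psi h -> x *+ n = hcomb P (orbit h k) - y ->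
    hcomb Q (orbit h k) - y = (x - orbit h (k + 1)) *+ n.
  move=> Dh xE; rewrite mulrnBl xE hcombD hcombN hcombMn hcombX orbitS //.
  by zlin.
have [[D0 Dgt _] []] := adjoin_core k Q0 Hb.
  move=> a a' Ha Pa lt_a.
  have Hfa : above a (f - a).
    by apply: contrapT => H; apply: high; exists a, a'.
  rewrite (_ : _ - _ = (f - a) *+ n - (hcomb P (orbit g k) - a *~ P.[1])).
    apply: aboveB => //; first exact/(above_mulrnE HT).
    apply: hcomb_above => //; first exact: Psi_orbit.
    exact/ltW/(cut_orbit_gt HT HR Hg k Ha Pa lt_a).
  by rewrite Q1 mulrzBr -pmulrn mulrnBl E; zlin.
have [[D0' _ _] _] : [/\ hcomb Q (orbit g' k) - b' != 0, True & True] /\ True.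
  split=> //; split=> //; apply/eqP => E0.
  have HDN : adjoin R g g' (- (hcomb Q (orbit g k) - b),
                            - (hcomb Q (orbit g' k) - b')).
    exists 1%N, (- Q), k, (- b), (- b'); split=> //=; first exact: (pisoN HR).
      by rewrite hcombN mulr1n; zlin.
    by rewrite hcombN mulr1n; zlin.
  move: D0 Dgt (adjoin_gt0 HDN); rewrite E0 oppr0 ltxx oopp_gt0.
  by case: ltgtP.
have nzn h x : (x - orbit h (k + 1)) *+ n != 0 -> x - orbit h (k + 1) != 0.
  by apply: contraNneq => ->; rewrite mul0rn.
rewrite (HQ g f) // (HQ g' f') // !orbitS //.
move: D0 D0'; rewrite (HQ g f) // (HQ g' f') // => /nzn D0 /nzn D0'.
rewrite !psi_mulrn // => V V'.
by split; apply: succ_unique; rewrite // -subr_eq0.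
Qed.

Lemma adjoin_succ f f' : adjoin R g g' (f, f') -> adjoin R g g' (s f, s f').
Proof.
by move=> /adjoin_succ_cases [/adjoin_sub//|[k [-> ->]]]; apply: adjoin_orbit.
Qed.

(** An element of Psi is the predecessor of its successor, and the successor is in R or on the
    orbit. *)
Lemma adjoin_Psi_cases f f' : adjoin R g g' (f, f') -> Psi f ->
  R (f, f') \/ exists k, f = orbit g k /\ f' = orbit g' k.
Proof.
move=> Hf Pf; have [Hs|[k [E _]]] := adjoin_succ_cases Hf.
  have Hp := piso_pred HR Hs (Psi_gt_succ HT Pf).
  rewrite succK // in Hp.
  by left; rewrite (adjoin_fun Hf (adjoin_sub Hp)).
right; exists (k - 1); have E' : f = orbit g (k - 1).
  apply: (succ_inj HT) => //; first exact: Psi_orbit.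
  by rewrite orbitS // subrK.
split=> //; apply: (adjoin_fun Hf); rewrite E'; exact: adjoin_orbit.
Qed.

Lemma adjoin_Psi f f' : adjoin R g g' (f, f') -> Psi f -> Psi f'.
Proof.
move=> Hf Pf; case: (adjoin_Psi_cases Hf Pf) => [/(piso_Psi HR) H|].
  exact/H.
by move=> [k [_ ->]]; apply: Psi_orbit.
Qed.

Lemma adjoin_pred f f' : adjoin R g g' (f, f') -> Psi_gt psi f ->
  adjoin R g g' (predf f, predf f').
Proof.
move=> Hf Pf; case: (adjoin_Psi_cases Hf Pf.1) => [H|].
  exact/adjoin_sub/(piso_pred HR).
by move=> [k [-> ->]]; rewrite !orbit_pred //; apply: adjoin_orbit.
Qed.

End Half.

Lemma piso_adjoin R g g' : piso psi R -> cut_match psi R g g' ->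
  piso psi (adjoin R g g').
Proof.
move=> HR Hg; split.
- exact/adjoin_sub/(piso0 HR).
- by move=> a a' b b'; apply: adjoinB.
- by move=> n a a'; apply: adjoin_div.
- by move=> a a'; apply: adjoin_gt0.
- by move=> a a'; apply: adjoin_psi.
- by move=> a a'; apply: adjoin_succ.
- move=> a a' H; split; first exact: adjoin_Psi H.
  have H' : adjoin (flip R) g' g (a', a) by apply/(adjoin_flip _ _ _ (a, a')).
  exact: (adjoin_Psi (piso_flip HR) (cut_match_flip HR Hg) H').
- by move=> a a'; apply: adjoin_pred.
Qed.

End Adjoin.

(** * Adjoining an element without new Psi-elements *)

Section Extend.
Variables (G : orderedZmodType) (psi : G -> G) (HT : T0_model psi).
Implicit Types a b c : G.
Local Notation s := (succ psi).
Local Notation Psi := (Psi psi).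
Local Notation predf := (predf psi).
Variables (R : set (G * G)) (HR : piso psi R) (x y : G).

(** Only the group operations and division are applied to x and y: under the two hypotheses below,
    all values and successors of new elements already lie in R. *)
Definition extend : set (G * G) :=
  [set f | exists n (z : int) k k', [/\ (0 < n)%N, R (k, k'),
     f.1 *+ n = k + x *~ z & f.2 *+ n = k' + y *~ z]].

Hypothesis xP : forall k k', R (k, k') ->
  [/\ k != x, k' != y, (k < x) = (k' < y) & R (psi (x - k), psi (y - k'))].
Hypothesis succP : forall f f', extend (f, f') -> exists c, R (s f, c).

Lemma extend_sub f f' : R (f, f') -> extend (f, f').
Proof.
by move=> Hf; exists 1%N, 0, f, f'; split=> //=; rewrite mulr0z addr0.
Qed.

Lemma extend_self : extend (x, y).
Proof.
exists 1%N, 1, 0, 0; split=> //=; first exact: piso0 HR.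
  by rewrite add0r.
by rewrite add0r.
Qed.

Lemma extendB f1 f1' f2 f2' : extend (f1, f1') -> extend (f2, f2') ->
  extend (f1 - f2, f1' - f2').
Proof.
move=> [n1 [z1 [k1 [k1' [/= n10 H1 E1 E1']]]]].
move=> [n2 [z2 [k2 [k2' [/= n20 H2 E2 E2']]]]].
exists (n1 * n2)%N, (z1 * n2%:Z - z2 * n1%:Z), (k1 *+ n2 - k2 *+ n1),
  (k1' *+ n2 - k2' *+ n1).
have aux (a1 a2 b1 b2 t : G) : a1 *+ n1 = b1 + t *~ z1 ->
    a2 *+ n2 = b2 + t *~ z2 -> (a1 - a2) *+ (n1 * n2) =
    b1 *+ n2 - b2 *+ n1 + t *~ (z1 * n2%:Z - z2 * n1%:Z).
  move=> A1 A2; rewrite mulrnBl mulrnA A1 mulnC mulrnA A2 !mulrnDl.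
  rewrite mulrzBr !mulrzA -!pmulrn; zlin.
split=> /=; first by rewrite muln_gt0 n10.
- by apply: (pisoB HR); apply: (piso_mulrn HR).
- exact: aux.
- exact: aux.
Qed.

Lemma extend_normal f f' : extend (f, f') -> R (f, f') \/
  exists n (z : int) k k', [/\ (0 < n)%N, z != 0, R (k, k'),
    f *+ n = (x - k) *~ z & f' *+ n = (y - k') *~ z].
Proof.
move=> [n [z [k [k' [/= n0 Hk E E']]]]].
have [z0|z0] := eqVneq z 0.
  by left; apply: (piso_div HR n0); rewrite E E' z0 !mulr0z !addr0.
have [b [b' [Hb bE bE']]] := piso_divz HT HR z0 Hk.
right; exists n, z, (- b), (- b'); split=> //; first exact: (pisoN HR).
  by rewrite E bE opprK addrC mulrzDl.
by rewrite E' bE' opprK addrC mulrzDl.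
Qed.

Lemma extend_gt0 f f' : extend (f, f') -> (0 < f) = (0 < f').
Proof.
move=> /extend_normal [/(piso_gt0 HR)//|[n [z [k [k' [n0 z0 Hk E E']]]]]].
rewrite -(omulrn_gt0 f n0) -(omulrn_gt0 f' n0) E E'.
have [kx ky lt_kx _] := xP Hk.
case: (ltgtP z 0) z0 => // z0 _.
  rewrite !omulrz_gt0N // -!oopp_gt0 !opprB !osub_gt0.
  by rewrite !ltNge !le_eqVlt (negPf kx) (negPf ky) lt_kx.
by rewrite !omulrz_gt0 // !osub_gt0 lt_kx.
Qed.

Lemma extend_eq0 f f' : extend (f, f') -> (f == 0) = (f' == 0).
Proof.
move=> H; have H0 := extend_sub (piso0 HR).
have := extend_gt0 (extendB H0 H); rewrite !sub0r !oopp_gt0.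
by have := extend_gt0 H; case: (ltgtP f 0); case: (ltgtP f' 0).
Qed.

Lemma extend_fun f f1 f2 : extend (f, f1) -> extend (f, f2) -> f1 = f2.
Proof.
move=> H1 H2; have := extend_eq0 (extendB H1 H2).
by rewrite subrr eqxx subr_eq0 => /esym/eqP.
Qed.

Lemma extend_inj f1 f2 f : extend (f1, f) -> extend (f2, f) -> f1 = f2.
Proof.
move=> H1 H2; have := extend_eq0 (extendB H1 H2).
by rewrite subrr eqxx subr_eq0 => /eqP.
Qed.

Lemma extend_psi f f' : f != 0 -> extend (f, f') -> R (psi f, psi f').
Proof.
move=> f0 H; have f0' : f' != 0 by rewrite -(extend_eq0 H).
case/extend_normal: H => [/(piso_psi HR f0)//|[n [z [k [k' [n0 z0 Hk E E']]]]]].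
have [kx ky _ Hpsi] := xP Hk.
rewrite -(psi_mulrn HT f0 n0) -(psi_mulrn HT f0' n0) E E'.
by rewrite !psi_mulrz // subr_eq0 eq_sym.
Qed.

(** Let c be the partner of s f. The equation psi(f - s f) = s f is carried to psi(f' - c) = c,
    which characterizes c as the successor of f'. *)
Lemma extend_succ f f' : extend (f, f') -> R (s f, s f').
Proof.
move=> H; have [c Hc] := succP H.
have Hd := extendB H (extend_sub Hc).
have fs := sub_succ_neq0 HT f.
have := extend_psi fs Hd; rewrite psi_sub_succ // => /(piso_fun HR Hc) cE.
have fc : f' != c by rewrite -subr_eq0 -(extend_eq0 Hd).
by rewrite (succ_unique HT fc (esym cE)).
Qed.

Lemma extend_Psi f f' : extend (f, f') -> Psi f -> R (f, f').
Proof.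
move=> H Pf; have := piso_pred HR (extend_succ H) (Psi_gt_succ HT Pf).
rewrite succK // => Hp.
by rewrite (extend_fun H (extend_sub Hp)).
Qed.

Lemma extend_Psi' f f' : extend (f, f') -> Psi f' -> R (f, f').
Proof.
move=> H Pf; have Hs := extend_succ H.
have gt_s : Psi_gt psi (s f) by apply/(piso_Psi_gt HR Hs)/(Psi_gt_succ HT).
have := piso_pred HR Hs gt_s; rewrite (succK HT Pf) => Hp.
by rewrite (extend_inj H (extend_sub Hp)).
Qed.

Lemma piso_extend : piso psi extend.
Proof.
split.
- exact/extend_sub/(piso0 HR).
- by move=> a a' b b'; apply: extendB.
- move=> n a a' n0 [m [z [k [k' [/= m0 H E E']]]]].
  exists (n * m)%N, z, k, k'; rewrite /= !mulrnA.
  by split; rewrite // muln_gt0 n0.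
- by move=> a a'; apply: extend_gt0.
- by move=> a a' a0 H; apply/extend_sub/extend_psi.
- by move=> a a' H; apply/extend_sub/extend_succ.
- move=> a a' H; split=> Pa.
    exact/(piso_Psi HR (extend_Psi H Pa)).
  exact/(piso_Psi HR (extend_Psi' H Pa)).
- move=> a a' H Pa; apply/extend_sub/(piso_pred HR) => //.
  by apply: extend_Psi => //; case: Pa.
Qed.

End Extend.

(** * Filling cuts in saturated models *)

Definition enumerable T (A : set T) :=
  exists e : nat -> option T, forall x, A x -> exists i, e i = Some x.

(** Variable 0 is the unknown, and each formula has its own valuation, so a type may use countably
    many parameters. Initial segments stand for finite subsets. *)
Definition countably_saturated (G : orderedZmodType) (psi : G -> G) : Prop :=
  forall (phi : nat -> Lformula) (v : nat -> nat -> Tlog_structure psi),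
    (forall m, exists y, forall i, (i < m)%N -> sat (update (v i) 0 y) (phi i)) ->
    exists y, forall i, sat (update (v i) 0 y) (phi i).

Lemma seq_max (T : eqType) (G : orderedZmodType) (f : T -> G) (l : seq T) x0 :
  x0 \in l -> exists2 x, x \in l & forall y, y \in l -> f y <= f x.
Proof.
elim: l x0 => // a l IH x0 _; case: l IH => [_|b l /(_ b (mem_head _ _))].
  by exists a; rewrite ?mem_head // => y; rewrite inE => /eqP ->.
move=> [x xl Hx]; have [le_ax|/ltW le_xa] := leP (f a) (f x).
  exists x; first by rewrite inE xl orbT.
  by move=> y; rewrite inE => /orP [/eqP -> //|/Hx].
exists a; first exact: mem_head.
by move=> y; rewrite inE => /orP [/eqP -> //|/Hx /le_trans]; apply.
Qed.

Section Realize.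
Variables (G : orderedZmodType) (psi : G -> G) (HT : T0_model psi).
Implicit Types a b c : G.
Local Notation s := (succ psi).
Local Notation Psi := (Psi psi).
Local Notation M := (Tlog_structure psi).
Hypothesis Hsat : countably_saturated psi.

Definition definable1 (D : set G) : Prop :=
  exists (phi : Lformula) (v : nat -> M),
    forall y, sat (update v 0 y) phi <-> exists2 w, y = Some w & D w.

Lemma saturated_definable (D : nat -> set G) : (forall i, definable1 (D i)) ->
    (forall m, exists w, forall i, (i < m)%N -> D i w) ->
  exists w, forall i, D i w.
Proof.
move=> /choice [phi] /choice [v] H fin.
have [|y Hy] := Hsat (phi := phi) (v := v).
  move=> m; have [w Hw] := fin m; exists (Some w) => i im.
  by apply/H; exists w => //; apply: Hw.
have [w yE _] := iffLR (H 0%N y) (Hy 0%N).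
exists w => i; have [w' E] := iffLR (H i y) (Hy i).
by move: E; rewrite yE => -[->].
Qed.

Lemma definable1_iff (D E : set G) : (forall w, D w <-> E w) ->
  definable1 D -> definable1 E.
Proof.
move=> H [phi [v Hv]]; exists phi, v => y; rewrite Hv.
by split=> -[w ? ?]; exists w => //; apply/H.
Qed.

Definition par3 (x y z : option G) : nat -> M :=
  fun j => nth None [:: None; x; y; z] j.

Lemma definable1_Psi_cut z a (b : bool) :
  definable1 [set w | [/\ Psi w, w != z & (a < w) = b]].
Proof.
pose lt := FLt (TVar 2) (TVar 0).
(* The bound variable 4 is distinct from the unknown 0 and from the parameters 1 to 3. *)
exists (FAnd (FEx 4 (FEq (TPsi (TVar 4)) (TVar 0)))
  (FAnd (FNot (FEq (TVar 0) TInfty))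
  (FAnd (FNot (FEq (TVar 0) (TVar 1))) (if b then lt else FNot lt)))).
exists (par3 (Some z) (Some a) None) => -[w|] /=; last first.
  by split=> [[_ [H _]]|[w]] //; case: H.
rewrite /update /par3 /=.
split=> [[[u uE] [_ [wz lt_w]]]|[_ [<-] [[u u0 uE] wz lt_w]]].
  exists w => //; split.
  - case: u uE => [u|] //=; case: ifP => // /negbT u0 [<-].
    exact: Psi_psi.
  - by apply/eqP => E; apply: wz; rewrite E.
  - by case: (b) lt_w => //= /negP/negbTE.
split; last split => //; last split.
- by exists (Some u) => /=; rewrite (negPf u0) uE.
- by move=> -[/eqP]; rewrite (negPf wz).
- by rewrite /lt; case: (b) lt_w => /= ->.
Qed.

Lemma definable1_ball z k c (b : bool) :
  definable1 [set w | [/\ w != z, w != k, (k < w) = b & psi (w - k) = c]].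
Proof.
pose lt := FLt (TVar 2) (TVar 0).
exists (FAnd (FNot (FEq (TVar 0) TInfty))
  (FAnd (FNot (FEq (TVar 0) (TVar 1)))
  (FAnd (if b then lt else FNot lt)
        (FEq (TPsi (TAdd (TVar 0) (TOpp (TVar 2)))) (TVar 3))))).
exists (par3 (Some z) (Some k) (Some c)) => -[w|] /=; last first.
  by split=> [[H _]|[w]] //; case: H.
rewrite /update /par3 /= subr_eq0.
split=> [[_ [wz [lt_w E]]]|[_ [<-] [wz wk lt_w <-]]].
  case: ifP E => // /negbT wk [<-]; exists w => //; split=> //.
    by apply/eqP => E; apply: wz; rewrite E.
  by move: lt_w; case: (b) => //= /negP/negbTE.
split=> //; split; first by move=> -[/eqP]; rewrite (negPf wz).
by split; [rewrite /lt; case: (b) lt_w => /= -> | rewrite (negPf wk)].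
Qed.

Lemma definable1_neq z : definable1 [set w | w != z].
Proof.
exists (FAnd (FNot (FEq (TVar 0) TInfty)) (FNot (FEq (TVar 0) (TVar 1)))).
exists (par3 (Some z) None None) => -[w|] /=; last first.
  by split=> [[H _]|[w]] //; case: H.
rewrite /update /par3 /=; split=> [[_ wz]|[_ [<-] wz]].
  by exists w => //; apply/eqP => E; apply: wz; rewrite E.
by split=> // -[/eqP]; rewrite (negPf wz).
Qed.

Variables (R : set (G * G)) (HR : piso psi R) (HRe : enumerable R).

(** Finitely many conditions give a largest Psi-element b below g, starting from s0. Since g is not
    in the domain, s b and s (s b) are below g too, so their images both satisfy the conditions;
    having two candidates allows z to be avoided. *)
Lemma cut_realize g z : Psi g -> (forall a a', R (a, a') -> a != g) ->
  exists2 g', cut_match psi R g g' & g' != z.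
Proof.
move=> Pg Hn; have [e He] := HRe.
pose D i : set G := [set w | [/\ Psi w, w != z & if e i is Some (a, a') then
   R (a, a') -> Psi a -> (a' < w) = (a < g) else True]].
have [||g' Hg'] := @saturated_definable D.
- move=> i; case E: (e i) => [[a a']|]; last first.
    (* An index without a condition receives [0 < w], which holds throughout Psi because s0 is
       positive. *)
    apply: definable1_iff (definable1_Psi_cut z 0 true) => w.
    rewrite /D /= E; split=> [[]|[Pw]] //; split=> //.
    by apply: lt_le_trans (T0_pos HT) _; apply: succ0_le.
  have [[Ra Pa]|Hna] := pselect (R (a, a') /\ Psi a).
    apply: definable1_iff (definable1_Psi_cut z a' (a < g)) => w.
    rewrite /D /= E; split=> [[? ? ?]|[? ? H]]; split=> //.
    exact: H.
  apply: definable1_iff (definable1_Psi_cut z 0 true) => w.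
  rewrite /D /= E; split=> [[? ? _]|[Pw ? _]]; split=> //.
    by move=> Ra Pa; case: Hna.
  by apply: lt_le_trans (T0_pos HT) _; apply: succ0_le.
- move=> m.
  have succ_lt b b' : R (b, b') -> Psi b -> b < g -> s b < g.
    move=> Rb Pb lt_b; rewrite lt_neqAle (Hn _ _ (piso_succ HR Rb)) /=.
    exact: succ_le.
  have [b [b' [Rb Pb lt_b Hb]]] : exists b b', [/\ R (b, b'), Psi b, b < g &
      forall i a a', (i < m)%N -> e i = Some (a, a') -> R (a, a') -> Psi a ->
      a < g -> a <= b].
    elim: m => [|m [b [b' [Rb Pb lt_b Hb]]]].
      exists (s 0), (s 0); split=> //; first exact: (piso_succ0 HR).
        exact: Psi_succ0.
      rewrite lt_neqAle (Hn _ _ (piso_succ0 HR)) /=; exact: succ0_le.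
    case E : (e m) => [[a a']|]; last first.
      exists b, b'; split=> // i c c' im Ei; apply: (Hb i) => //.
      move: im; rewrite ltnS leq_eqVlt => /orP [/eqP im|//].
      by rewrite im E in Ei.
    have [[Ra Pa lt_a ba]|Hna] :=
        pselect [/\ R (a, a'), Psi a, a < g & b < a].
      exists a, a'; split=> // i c c' im Ei Rc Pc lt_c.
      move: im; rewrite ltnS leq_eqVlt => /orP [/eqP im|im].
        by move: Ei; rewrite im E => -[-> _].
      exact: le_trans (Hb _ _ _ im Ei Rc Pc lt_c) (ltW ba).
    exists b, b'; split=> // i c c' im Ei Rc Pc lt_c.
    move: im; rewrite ltnS leq_eqVlt => /orP [/eqP im|im]; last first.
      exact: (Hb _ _ _ im Ei).
    move: Ei; rewrite im E => -[ac ac']; rewrite leNgt; apply/negP => bc.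
    by apply: Hna; split; rewrite ?ac ?ac'.
  have Pb' := iffLR (piso_Psi HR Rb) Pb.
  have Rs := piso_succ HR Rb; have Rss := piso_succ HR Rs.
  have Ps := Psi_succ HT b; have lt_s := succ_lt _ _ Rb Pb lt_b.
  have Pss := Psi_succ HT (s b); have lt_ss := succ_lt _ _ Rs Ps lt_s.
  have good w : Psi w -> w != z -> b' < w -> w <= s (s b') ->
      forall i, (i < m)%N -> D i w.
    move=> Pw wz bw wss i im; split=> //.
    case E : (e i) => [[a a']|] // Ra Pa.
    have [lt_a|le_a] := ltP a g.
      apply: le_lt_trans bw; rewrite leNgt -(piso_lt HR Rb Ra) -leNgt.
      exact: (Hb _ _ _ im E).
    apply/negbTE; rewrite -leNgt; apply: (le_trans wss).
    rewrite leNgt -(piso_lt HR Ra Rss) -leNgt.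
    exact: le_trans (ltW lt_ss) le_a.
  have bs' := succ_gt HT Pb'; have bss' := succ_gt HT (Psi_succ HT b').
  have [E|sz] := eqVneq (s b') z.
    exists (s (s b')); apply: good => //; first exact: Psi_succ.
      by rewrite -E gt_eqF.
    exact: lt_trans bss'.
  exists (s b'); apply: good => //; [exact: Psi_succ|exact: ltW].
have [Pg' g'z _] := Hg' 0%N; exists g' => //.
apply: cut_matchI => // a a' Ra Pa; have [i Ei] := He _ Ra.
by have [_ _] := Hg' i; rewrite Ei => /(_ Ra Pa) ->.
Qed.

(** Nonnegative terms cannot cancel: the sum is at least a, so the H-type axiom bounds its value
    from above, and AC1 bounds it from below. *)
Lemma psi_eq_add a b c : 0 < a -> psi a = c -> 0 <= b -> (b = 0 \/ c <= psi b) ->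
  0 < a + b /\ psi (a + b) = c.
Proof.
move=> a0 ac b0 [->|cb]; first by rewrite addr0.
have ab0 : a <= a + b by rewrite -osub_ge0 addrC addKr.
split; first exact: lt_le_trans ab0.
have [->|bn0] := eqVneq b 0; first by rewrite addr0.
apply/eqP; rewrite eq_le; apply/andP; split.
  by rewrite -ac psi_le.
have := AC1 (T0_couple HT) _ bn0 _; move=> /(_ a); rewrite !gt_eqF //.
  by move=> /(_ isT isT); apply: le_trans; rewrite le_min ac lexx.
exact: lt_le_trans ab0.
Qed.

End Realize.

(** * Filling the place of an element given by its cut and its values *)

Section Realize2.
Variables (G : orderedZmodType) (psi : G -> G) (HT : T0_model psi).
Implicit Types a b c : G.
Local Notation s := (succ psi).
Local Notation Psi := (Psi psi).
Variables (R : set (G * G)) (HR : piso psi R) (x : G).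
Hypothesis xP : forall k k', R (k, k') -> k != x /\ exists c, R (psi (x - k), c).

(* [w] stands to [k'] as [x] stands to [k]. *)
Definition same_place w (p : G * G) : Prop :=
  [/\ w != p.2, (p.2 < w) = (p.1 < x) & R (psi (x - p.1), psi (w - p.2))].

Section Residue.
Variables (l : seq (G * G)) (a a' : G).
Hypothesis Raa : R (a, a').
Hypothesis lP : forall p, p \in l -> R p /\ psi (x - p.1) = a.

(** The nearest point on one side decides for all points on that side: w - k' is the sum of w - k0'
    and the nonnegative k0' - k', whose value is not smaller. *)
Lemma same_place_lower p0 w : p0 \in l -> p0.1 < x ->
    (forall p, p \in l -> p.1 < x -> p.1 <= p0.1) ->
    p0.2 < w -> psi (w - p0.2) = a' ->
  forall p, p \in l -> p.1 < x -> same_place w p.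
Proof.
case: p0 => k0 k0' /= l0 lt0 Hmax lt0w E0 [k k'] lk /= lt_k.
have [Rk Ek] := lP lk; have [R0 E0'] := lP l0; rewrite /= in Ek E0'.
have Rd : R (k0 - k, k0' - k') by apply: (pisoB HR).
have [||||lt_w Ew] := @psi_eq_add _ _ HT (w - k0') (k0' - k') a'.
- by rewrite osub_gt0.
- exact: E0.
- by rewrite osub_ge0 leNgt -(piso_lt HR R0 Rk) -leNgt; apply: (Hmax (k, k')).
- have [->|d0] := eqVneq (k0' - k') 0; first by left.
  right; rewrite leNgt; have d0' : k0 - k != 0 by rewrite (piso_eq0 HR Rd).
  rewrite -(piso_lt HR (piso_psi HR d0' Rd) Raa) -leNgt -Ek.
  apply: psi_le; rewrite ?osub_gt0 //.
    rewrite lt_neqAle -subr_eq0 -oppr_eq0 opprB d0' /=.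
    exact: (Hmax (k, k')).
  by rewrite oleD2r ltW.
rewrite (_ : _ + _ = w - k') in lt_w Ew; last by zlin.
rewrite osub_gt0 in lt_w.
by split=> /=; rewrite ?Ew ?Ek ?lt_k ?lt_w // gt_eqF.
Qed.

Lemma same_place_upper p0 w : p0 \in l -> x < p0.1 ->
    (forall p, p \in l -> x < p.1 -> p0.1 <= p.1) ->
    w < p0.2 -> psi (w - p0.2) = a' ->
  forall p, p \in l -> x < p.1 -> same_place w p.
Proof.
case: p0 => k0 k0' /= l0 lt0 Hmin lt0w E0 [k k'] lk /= lt_k.
have [Rk Ek] := lP lk; have [R0 E0'] := lP l0; rewrite /= in Ek E0'.
have Rd : R (k - k0, k' - k0') by apply: (pisoB HR).
have [||||lt_w Ew] := @psi_eq_add _ _ HT (k0' - w) (k' - k0') a'.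
- by rewrite osub_gt0.
- by rewrite -(psi_opp HT) opprB.
- by rewrite osub_ge0 leNgt -(piso_lt HR Rk R0) -leNgt; apply: (Hmin (k, k')).
- have [->|d0] := eqVneq (k' - k0') 0; first by left.
  right; rewrite leNgt; have d0' : k - k0 != 0 by rewrite (piso_eq0 HR Rd).
  rewrite -(piso_lt HR (piso_psi HR d0' Rd) Raa) -leNgt -Ek.
  rewrite -[X in _ <= X](psi_opp HT) opprB -[X in _ <= X](psi_opp HT) opprB.
  rewrite -[psi (x - k)](psi_opp HT) opprB.
  apply: psi_le; rewrite ?osub_gt0 //.
    rewrite lt_neqAle eq_sym -subr_eq0 d0' /=.
    exact: (Hmin (k, k')).
  by rewrite -osub_ge0 (_ : _ - _ = k0 - x) ?osub_ge0 ?ltW //; zlin.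
rewrite (_ : _ + _ = k' - w) in lt_w Ew; last by zlin.
rewrite osub_gt0 in lt_w.
split=> /=; first by rewrite lt_eqF.
  by rewrite !ltNge !ltW.
by rewrite Ek -(psi_opp HT) opprB Ew.
Qed.

(** All points of l are at the same value a from x. It remains to put w between the images of the
    nearest points on either side, at value a' from each. *)
Lemma same_place_residue : l != [::] ->
  exists w1 w2, [/\ w1 != w2, forall p, p \in l -> same_place w1 p
                  & forall p, p \in l -> same_place w2 p].
Proof.
move=> l0.
pose L := [seq p <- l | p.1 < x]; pose U := [seq p <- l | x < p.1].
have inL p : p \in L = (p \in l) && (p.1 < x) by rewrite mem_filter andbC.
have inU p : p \in U = (p \in l) && (x < p.1) by rewrite mem_filter andbC.
have LU p : p \in l -> (p \in L) || (p \in U).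
  move=> lp; rewrite inL inU lp /=; have [Rp _] := lP lp.
  by case: p Rp {lp} => k k' /xP [kx _] /=; case: ltgtP kx.
have max p0 : p0 \in L -> exists2 p, p \in L & forall q, q \in L -> q.1 <= p.1.
  exact: seq_max.
have min p0 : p0 \in U -> exists2 p, p \in U & forall q, q \in U -> p.1 <= q.1.
  move=> /(seq_max (fun p => - p.1)) [p pU H]; exists p => // q /H.
  by rewrite !leNgt olt_opp.
(* The candidates are at distance e and 2e from the extremal bound. *)
have build e : 0 < e -> psi e = a' ->
  (forall p q, p \in L -> q \in U -> (forall r, r \in L -> r.1 <= p.1) ->
     (forall r, r \in U -> q.1 <= r.1) -> e *+ 3 = q.2 - p.2) ->
  exists w1 w2, [/\ w1 != w2, forall p, p \in l -> same_place w1 p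
                  & forall p, p \in l -> same_place w2 p].
  move=> e0 eE gap.
  have e0' : e != 0 by rewrite gt_eqF.
  have en n : (0 < n)%N -> 0 < e *+ n /\ psi (e *+ n) = a'.
    by move=> n0; rewrite omulrn_gt0 // psi_mulrn.
  have low p w n : p \in L -> (forall r, r \in L -> r.1 <= p.1) -> (0 < n)%N ->
      w = p.2 + e *+ n -> forall q, q \in L -> same_place w q.
    rewrite inL => /andP [lp lt_p] Hp n0 -> q; rewrite inL => /andP [lq lt_q].
    have [en0 enE] := en _ n0.
    apply: (same_place_lower lp lt_p) => //.
    - by move=> r lr lt_r; apply: Hp; rewrite inL lr.
    - by rewrite -osub_gt0 addrC addKr.
    - by rewrite addrC addKr.
  have up p w n : p \in U -> (forall r, r \in U -> p.1 <= r.1) -> (0 < n)%N ->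
      w = p.2 - e *+ n -> forall q, q \in U -> same_place w q.
    rewrite inU => /andP [lp lt_p] Hp n0 -> q; rewrite inU => /andP [lq lt_q].
    have [en0 enE] := en _ n0.
    apply: (same_place_upper lp lt_p) => //.
    - by move=> r lr lt_r; apply: Hp; rewrite inU lr.
    - by rewrite -osub_gt0 opprB addrC subrK.
    - by rewrite addrC addKr psi_opp.
  have e2 : e != e *+ 2.
    by rewrite mulr2n -subr_eq0 opprD addrA subrr add0r oppr_eq0.
  have [E|[p pL]] : U = [::] \/ exists q, q \in U.
      by case: (U) => [|q ?]; [left|right; exists q; rewrite mem_head].
    have [p pL] : exists p, p \in L.
      case: (l) l0 LU => // p l' _ /(_ p (mem_head _ _)); rewrite E orbF => H.
      by exists p.
    have {pL} [{}p pL Hp] := max _ pL.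
    have good n : (0 < n)%N -> forall q, q \in l -> same_place (p.2 + e *+ n) q.
      move=> n0 q /LU; rewrite E orbF; exact: (low p _ n).
    exists (p.2 + e *+ 1), (p.2 + e *+ 2); split; try exact: good.
    by rewrite (inj_eq (addrI _)).
  have {pL} [q qU Hq] := min _ pL.
  have [E|[p' pL]] : L = [::] \/ exists q, q \in L.
      by case: (L) => [|r ?]; [left|right; exists r; rewrite mem_head].
    have good n : (0 < n)%N -> forall r, r \in l -> same_place (q.2 - e *+ n) r.
      move=> n0 r /LU; rewrite E; exact: (up q _ n).
    exists (q.2 - e *+ 1), (q.2 - e *+ 2); split; try exact: good.
    by rewrite (inj_eq (addrI _)) (inj_eq oppr_inj).
  have {pL} [r rL Hr] := max _ pL.
  have E := gap _ _ rL qU Hr Hq.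
  have good n : (0 < n < 3)%N ->
      forall t, t \in l -> same_place (r.2 + e *+ n) t.
    move=> /andP [n0 n3] t /LU /orP [|]; first exact: (low r _ n).
    apply: (up q _ (3 - n)%N) => //; first by rewrite subn_gt0.
    have -> : q.2 = r.2 + e *+ 3 by rewrite E addrC subrK.
    rewrite mulrnBr; last exact: ltnW.
    zlin.
  exists (r.2 + e *+ 1), (r.2 + e *+ 2); split; try exact: good.
  by rewrite (inj_eq (addrI _)).
have [[[p0 q0] [/= p0L q0U]]|none] :=
    pselect (exists pq, pq.1 \in L /\ pq.2 \in U); last first.
  have Pa' : Psi a'.
    case: (l) l0 lP => // p l' _ /(_ p (mem_head _ _)) [Rp pE].
    have Rp' : R (p.1, p.2) by rewrite -surjective_pairing.
    have [px _] := xP Rp'.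
    apply/(piso_Psi HR Raa); rewrite -pE; apply: Psi_psi.
    by rewrite subr_eq0 eq_sym.
  have [e0 /= e00 eE] := Pa'.
  have [e epos eE'] : exists2 e, 0 < e & psi e = a'.
    case: (ltgtP e0 0) e00 => // lt_e _; last by exists e0.
    by exists (- e0); rewrite ?oopp_gt0 ?(psi_opp HT).
  by apply: (build e) => // p q pL qU; case: none; exists (p, q).
have [[k1 k1'] pL Hp] := max _ p0L; have [[k2 k2'] qU Hq] := min _ q0U.
have /= := pL; rewrite inL /= => /andP [lp lt_p].
have /= := qU; rewrite inU /= => /andP [lq lt_q].
have [Rp Ep] := lP lp; have [Rq Eq] := lP lq; rewrite /= in Ep Eq.
have Rd : R (k2 - k1, k2' - k1') by apply: (pisoB HR).
have lt_pq := lt_trans lt_p lt_q.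
have d0 : k2 - k1 != 0 by rewrite subr_eq0 gt_eqF.
have psid : psi (k2 - k1) = a.
  apply/eqP; rewrite eq_le; apply/andP; split.
    rewrite -Ep; apply: psi_le; rewrite ?osub_gt0 //.
    by rewrite oleD2r ltW.
  have qx0 : k2 - x != 0 by rewrite subr_eq0 gt_eqF.
  have xp0 : x - k1 != 0 by rewrite subr_eq0 gt_eqF.
  have := AC1 (T0_couple HT) qx0 xp0; rewrite addrA subrK => /(_ d0).
  by rewrite -(psi_opp HT (k2 - x)) opprB Ep Eq minxx.
(* A third of the gap has the same value as the gap, and both e and 2e stay strictly inside. *)
have [e eE] := T0_divisible HT (k2' - k1') (isT : (0 < 3)%N).
have epos : 0 < e.
  by rewrite -(omulrn_gt0 e (isT : (0 < 3)%N)) eE osub_gt0 -(piso_lt HR Rp Rq).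
have e0 : e != 0 by rewrite gt_eqF.
apply: (build e) => //.
  rewrite -(psi_mulrn HT e0 (isT : (0 < 3)%N)) eE.
  apply: (piso_fun HR _ Raa); rewrite -psid; exact: (piso_psi HR).
move=> [k3 k3'] [k4 k4'] p3 p4 H3 H4 /=; rewrite eE.
have E31 : k3 = k1.
  by apply/le_anti; rewrite (H3 _ pL) (Hp _ p3).
have E42 : k4 = k2.
  by apply/le_anti; rewrite (H4 _ qU) (Hq _ p4).
move: p3 p4; rewrite inL inU => /andP [l3 _] /andP [l4 _].
have [R3 _] := lP l3; have [R4 _] := lP l4.
rewrite E31 in R3; rewrite E42 in R4.
by rewrite (piso_fun HR R3 Rp) (piso_fun HR R4 Rq).
Qed.

End Residue.

(** Only the points for which psi(x - k) is maximal matter. For any other k, the difference x - k is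
    dominated by k0 - k with k0 maximal, and this difference is controlled by R. *)
Lemma same_place_seq (l : seq (G * G)) : (forall p, p \in l -> R p) ->
  exists w1 w2, [/\ w1 != w2, forall p, p \in l -> same_place w1 p
                  & forall p, p \in l -> same_place w2 p].
Proof.
(* The pair of zeros makes the list nonempty, so that a maximum exists. *)
move=> lP; pose l' := (0, 0) :: l.
have lP' p : p \in l' -> R p.
  by rewrite inE => /orP [/eqP ->|/lP //]; apply: (piso0 HR).
have [[k0 k0'] l0 Hmax] := seq_max (fun p => psi (x - p.1)) (mem_head (0, 0) l).
have R0 := lP' _ l0; have [k0x [a' Ra]] := xP R0.
pose a := psi (x - k0); rewrite -/a in Ra; rewrite /= -/a in Hmax.
pose I := [seq p <- l' | psi (x - p.1) == a].
have I0 : (k0, k0') \in I by rewrite mem_filter eqxx.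
have [||w1 [w2 [w12 H1 H2]]] := @same_place_residue I a a' Ra.
- by move=> p; rewrite mem_filter => /andP [/eqP ? /lP'].
- by apply/eqP => E; rewrite E in I0.
have good w : (forall p, p \in I -> same_place w p) ->
    forall p, p \in l -> same_place w p.
  move=> Hw [k k'] lk; have lk' : (k, k') \in l' by rewrite inE lk orbT.
  have [E|ne] := eqVneq (psi (x - k)) a; first by apply: Hw; rewrite mem_filter E eqxx.
  have lt_ka : psi (x - k) < a by rewrite lt_neqAle ne; apply: (Hmax _ lk').
  have Rk := lP _ lk; have [kx _] := xP Rk.
  have Rd : R (k0 - k, k0' - k') by apply: (pisoB HR).
  have [/= w0 lt_w Rw] := Hw _ I0.
  have xk0 : x - k != 0 by rewrite subr_eq0 eq_sym.
  have [|d0 dE ds] := above_lead HT xk0 (d := k0 - x).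
    by right; rewrite -(psi_opp HT (k0 - x)) opprB.
  have xE : x - k + (k0 - x) = k0 - k by zlin.
  rewrite xE in d0 dE ds.
  have Rpd := piso_psi HR d0 Rd.
  have d0' : k0' - k' != 0 by rewrite -(piso_eq0 HR Rd).
  have [|e0 eE es] := above_lead HT d0' (d := w - k0').
    by right; rewrite -(piso_lt HR Rpd Rw) dE.
  have wE : k0' - k' + (w - k0') = w - k' by zlin.
  rewrite wE in e0 eE es.
  split=> /=; first by rewrite -subr_eq0.
    by rewrite -osub_gt0 es -(piso_gt0 HR Rd) ds osub_gt0.
  by rewrite eE -dE.
by exists w1, w2; split=> //; apply: good.
Qed.

Hypothesis Hsat : countably_saturated psi.
Hypothesis HRe : enumerable R.

Lemma place_realize z : exists2 y, y != z & forall k k', R (k, k') ->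
  [/\ k != x, k' != y, (k < x) = (k' < y) & R (psi (x - k), psi (y - k'))].
Proof.
have [e He] := HRe.
pose D i : set G := [set w | w != z /\ if e i is Some p then
   R p -> same_place w p else True].
have [||y Hy] := saturated_definable Hsat (D := D).
- move=> i; case E: (e i) => [[k k']|]; last first.
    apply: definable1_iff (definable1_neq psi z) => w.
    by rewrite /D /= E; split=> [|[]].
  have [Rk|Hn] := pselect (R (k, k')); last first.
    apply: definable1_iff (definable1_neq psi z) => w.
    by rewrite /D /= E; split=> [|[]].
  have [_ [c Rc]] := xP Rk.
  apply: definable1_iff (definable1_ball psi z k' c (k < x)) => w.
  rewrite /D /= E /same_place /=.
  split=> [[wz wk lt_w E']|[wz /(_ Rk) [wk lt_w Rw]]]; split=> //.
    by move=> _; split=> //; rewrite E'.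
  exact: (piso_fun HR Rw Rc).
- move=> m.
  have [w1 [w2 [w12 H1 H2]]] : exists w1 w2, [/\ w1 != w2,
     forall p, p \in [seq p <- pmap e (iota 0 m) | `[< R p >]] -> same_place w1 p
   & forall p, p \in [seq p <- pmap e (iota 0 m) | `[< R p >]] -> same_place w2 p].
    by apply: same_place_seq => p; rewrite mem_filter => /andP [/asboolP].
  have good w : w != z -> (forall p,
      p \in [seq p <- pmap e (iota 0 m) | `[< R p >]] -> same_place w p) ->
      forall i, (i < m)%N -> D i w.
    move=> wz Hw i im; split=> //; case E: (e i) => [p|] // Rp.
    apply: Hw; rewrite mem_filter asboolT //= mem_pmap -E map_f //.
    by rewrite mem_iota.
  have [E|w1z] := eqVneq w1 z; last by exists w1; apply: good.
  by exists w2; apply: good => //; rewrite -E eq_sym.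
have [yz _] := Hy 0%N; exists y => // k k' Rk.
have [i Ei] := He _ Rk; have [kx _] := xP Rk.
have [_] := Hy i; rewrite Ei => /(_ Rk) [/= ? -> ?]; split=> //.
by rewrite eq_sym.
Qed.

End Realize2.

(** * Extending partial isomorphisms *)

(** An encoding into a countable type; it is the source of the countability of generated
    substructures. *)
Fixpoint term_tree (t : Lterm) : GenTree.tree nat :=
  match t with
  | TVar i => GenTree.Node 0 [:: GenTree.Leaf i]
  | TZero => GenTree.Node 1 [::]
  | TInfty => GenTree.Node 2 [::]
  | TAdd t u => GenTree.Node 3 [:: term_tree t; term_tree u]
  | TOpp t => GenTree.Node 4 [:: term_tree t]
  | TPsi t => GenTree.Node 5 [:: term_tree t]
  | TSucc t => GenTree.Node 6 [:: term_tree t]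
  | TPred t => GenTree.Node 7 [:: term_tree t]
  | TDelta n t => GenTree.Node 8 [:: GenTree.Leaf n; term_tree t]
  end.

Lemma term_tree_inj : injective term_tree.
Proof.
elim=> [i||| t IHt u IHu|t IH|t IH|t IH|t IH|n t IH] [j|||t' u'|t'|t'|t'|t'|m t'] //=.
- by case=> ->.
- by case=> /IHt -> /IHu ->.
- by case=> /IH ->.
- by case=> /IH ->.
- by case=> /IH ->.
- by case=> /IH ->.
- by case=> -> /IH ->.
Qed.

Lemma enumerable_terms : enumerable [set: Lterm].
Proof.
exists (fun i => if pselect (exists t, pickle (term_tree t) = i) is left H
  then Some (projT1 (cid H)) else None) => t _.
exists (pickle (term_tree t)); case: pselect => [H|[]]; last by exists t.
by case: cid => u /= /(pcan_inj pickleK) /term_tree_inj ->.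
Qed.

Lemma enumerable_sub T (A B : set T) : A `<=` B -> enumerable B -> enumerable A.
Proof. by move=> AB [e He]; exists e => x /AB /He. Qed.

Lemma enumerable_pmap T U (f : T -> option U) (A : set T) :
  enumerable A -> enumerable [set y | exists2 x, A x & f x = Some y].
Proof.
move=> [e He]; exists (fun i => obind f (e i)) => y [x /He [i Ei] E].
by exists i; rewrite Ei.
Qed.

Lemma enumerable_setU1 T x (A : set T) : enumerable A -> enumerable (x |` A).
Proof.
move=> [e He]; exists (fun i => if i is j.+1 then e j else Some x) => y.
by case=> [->|/He [i Ei]]; [exists 0%N|exists i.+1].
Qed.

(** * Generated substructures and back-and-forth *)

Section Generated.
Variables (G : orderedZmodType) (psi : G -> G) (HT : T0_model psi).
Implicit Types a b c : G.
Local Notation s := (succ psi).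
Local Notation Psi := (Psi psi).
Local Notation predf := (predf psi).
Local Notation M := (Tlog_structure psi).

Record lclosed (N : set G) : Prop := LClosed {
  lclosed0 : N 0;
  lclosedB : forall a b, N a -> N b -> N (a - b);
  lclosed_div : forall n a, (0 < n)%N -> N (a *+ n) -> N a;
  lclosed_psi : forall a, a != 0 -> N a -> N (psi a);
  lclosed_succ : forall a, N a -> N (s a);
  lclosed_pred : forall a, Psi_gt psi a -> N a -> N (predf a)
}.

Definition lgen (X : set G) : set G :=
  [set a | forall N, lclosed N -> X `<=` N -> N a].

Lemma lgen_sub X : X `<=` lgen X.
Proof. by move=> a Xa N _; apply. Qed.

Lemma lclosed_lgen X : lclosed (lgen X).
Proof.
split.
- by move=> N HN _; apply: lclosed0.
- by move=> a b Ha Hb N HN XN; apply: lclosedB => //; [apply: Ha|apply: Hb].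
- by move=> n a n0 Ha N HN XN; apply: (lclosed_div HN n0); apply: Ha.
- by move=> a a0 Ha N HN XN; apply: (lclosed_psi HN a0); apply: Ha.
- by move=> a Ha N HN XN; apply: (lclosed_succ HN); apply: Ha.
- by move=> a a0 Ha N HN XN; apply: (lclosed_pred HN a0); apply: Ha.
Qed.

Lemma div_by_mulrn n a : (0 < n)%N -> div_by n a *+ n = a.
Proof.
move=> n0; have [b bE] := T0_divisible HT a n0.
by rewrite /div_by; case: xgetP => [c _ //|/(_ b)].
Qed.

Lemma div_by_eq n a b : (0 < n)%N -> b *+ n = a -> div_by n a = b.
Proof. by move=> n0 E; apply: (omulrnI n0); rewrite div_by_mulrn. Qed.

Lemma enumerable_lgen X : enumerable X -> enumerable (lgen X).
Proof.
move=> [e He].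
(* The enumeration of X serves as the valuation, so each element of X is the value of a variable. *)
pose N1 := [set a | exists t, eval (M := M) e t = Some a].
have HN : lclosed N1.
  split.
  - by exists TZero.
  - by move=> a b [t Et] [u Eu]; exists (TAdd t (TOpp u)); rewrite /= Et Eu.
  - move=> n a n0 [t Et]; exists (TDelta n.-1 t); rewrite /= Et /= prednK //.
    by congr Some; apply: div_by_eq.
  - by move=> a a0 [t Et]; exists (TPsi t); rewrite /= Et /= (negPf a0).
  - by move=> a [t Et]; exists (TSucc t); rewrite /= Et.
  - move=> a Pa [t Et]; exists (TPred t); rewrite /= Et /=.
    by rewrite (mem_set Pa).
apply: enumerable_sub (enumerable_pmap (eval (M := M) e) enumerable_terms).
move=> a Ha; have [t Et] : N1 a; last by exists t.
apply: Ha => // x /He [i Ei]; by exists (TVar i).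
Qed.

Section Closed.
Variables (N : set G) (HN : lclosed N).

Lemma lclosedN a : N a -> N (- a).
Proof. by rewrite -(sub0r a); apply: (lclosedB HN (lclosed0 HN)). Qed.

Lemma lclosedD a b : N a -> N b -> N (a + b).
Proof. by move=> Ha /lclosedN Hb; rewrite -(opprK b); apply: (lclosedB HN). Qed.

Lemma lclosed_mulrz a (z : int) : N a -> N (a *~ z).
Proof.
move=> Ha; have Hn n : N (a *+ n).
  elim: n => [|n IH]; first exact: (lclosed0 HN).
  by rewrite mulrS; apply: lclosedD.
case: z => n; first by rewrite -pmulrn.
by rewrite NegzE mulrNz -pmulrn; apply: lclosedN.
Qed.

Lemma lclosed_orbit g k : deep psi g -> N g -> N (orbit psi g k).
Proof.
move=> Dg Ng; case: k => m /=.
  by elim: m => //= m; apply: lclosed_succ.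
elim: m => [|m IH]; apply: (lclosed_pred HN) => //; first exact: (Dg.2 0%N).
exact: (Dg.2 m.+1).
Qed.

Lemma lclosed_hcomb P c : N c -> N (hcomb psi P c).
Proof.
move=> Nc; rewrite /hcomb; elim/big_ind: _ => //; first exact: (lclosed0 HN).
  exact: lclosedD.
move=> i _; apply: lclosed_mulrz.
by elim: (i : nat) => //= m; apply: (lclosed_succ HN).
Qed.

Lemma adjoin_lclosed R g g' f f' : piso psi R -> cut_match psi R g g' ->
  (forall a a', R (a, a') -> N a) -> N g -> adjoin psi R g g' (f, f') -> N f.
Proof.
move=> HR Hg RN Ng [n [P [k [b [b' [/= n0 Hb E _]]]]]].
apply: (lclosed_div HN n0); rewrite E; apply: (lclosedB HN); last exact: RN Hb.
apply: lclosed_hcomb; apply: lclosed_orbit => //.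
exact: (cut_deep HT HR Hg).
Qed.

Lemma extend_lclosed R x y f f' :
  (forall a a', R (a, a') -> N a) -> N x -> extend R x y (f, f') -> N f.
Proof.
move=> RN Nx [n [z [b [b' [/= n0 Hb E _]]]]].
apply: (lclosed_div HN n0); rewrite E; apply: lclosedD; first exact: RN Hb.
exact: lclosed_mulrz.
Qed.

Lemma enumerable_piso R : piso psi R -> enumerable N ->
  (forall a a', R (a, a') -> N a) -> enumerable R.
Proof.
move=> HR EN RN.
pose f a := if pselect (exists a', R (a, a')) is left H
  then Some (a, projT1 (cid H)) else None.
apply: enumerable_sub (enumerable_pmap f EN) => -[a a'] Ra.
exists a; first exact: RN Ra.
rewrite /f; case: pselect => [H|[]]; last by exists a'.
by case: cid => b /= Rb; rewrite (piso_fun HR Ra Rb).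
Qed.

End Closed.

Hypothesis Hsat : countably_saturated psi.

(** Each clause of [piso] has at most two pairs as premises, and these lie in a single member of the
    chain. Joining R0 to every member also covers the empty chain. *)
Lemma piso_chain (R0 : set (G * G)) (F : set (set (G * G))) :
    piso psi R0 -> (forall X, F X -> piso psi (R0 `|` X)) ->
    total_on F subset -> piso psi (R0 `|` \bigcup_(X in F) X).
Proof.
move=> HR0 HF tot.
have up1 p : (R0 `|` \bigcup_(X in F) X) p ->
    exists2 R, piso psi R & R `<=` R0 `|` \bigcup_(X in F) X /\ R p.
  case=> [Rp|[X FX Xp]]; first by exists R0 => //; split=> // q; left.
  exists (R0 `|` X); first exact: HF.
  by split=> [q [|Xq]|]; [left|right; exists X|right].
have up2 p q : (R0 `|` \bigcup_(X in F) X) p -> (R0 `|` \bigcup_(X in F) X) q ->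
    exists2 R, piso psi R & [/\ R `<=` R0 `|` \bigcup_(X in F) X, R p & R q].
  case=> [Rp|[X FX Xp]]; case=> [Rq|[Y FY Yq]].
  - by exists R0 => //; split=> // r; left.
  - exists (R0 `|` Y); first exact: HF.
    by split=> [r [|Yr]| |]; [left|right; exists Y|left|right].
  - exists (R0 `|` X); first exact: HF.
    by split=> [r [|Yr]| |]; [left|right; exists X|right|left].
  - have [XY|YX] := tot _ _ FX FY.
      exists (R0 `|` Y); first exact: HF.
      by split=> [r [|Yr]| |]; [left|right; exists Y|right; apply: XY|right].
    exists (R0 `|` X); first exact: HF.
    by split=> [r [|Yr]| |]; [left|right; exists X|right|right; apply: YX].
split.
- by left; apply: (piso0 HR0).
- move=> a a' b b' Ha Hb; have [R HR [RU Ra Rb]] := up2 _ _ Ha Hb.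
  exact/RU/(pisoB HR).
- move=> n a a' n0 /up1 [R HR [RU Ra]]; exact/RU/(piso_div HR n0).
- by move=> a a' /up1 [R HR [RU Ra]]; apply: piso_gt0 HR _ _ Ra.
- by move=> a a' a0 /up1 [R HR [RU Ra]]; apply/RU/(piso_psi HR).
- by move=> a a' /up1 [R HR [RU Ra]]; apply/RU/(piso_succ HR).
- by move=> a a' /up1 [R HR [RU Ra]]; apply: piso_Psi HR _ _ Ra.
- by move=> a a' /up1 [R HR [RU Ra]] Pa; apply/RU/(piso_pred HR).
Qed.

Lemma place_hyp R N x : piso psi R -> lclosed N ->
    (forall a a', R (a, a') -> N a) -> N x ->
    (forall h, Psi h -> N h -> exists h', R (h, h')) ->
    ~ (exists y, R (x, y)) ->
  forall k k', R (k, k') -> k != x /\ exists c, R (psi (x - k), c).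
Proof.
move=> HR HN RN Nx Hh xn k k' Rk.
have kx : k != x by apply/eqP => E; apply: xn; exists k'; rewrite -E.
split=> //; have xk : x - k != 0 by rewrite subr_eq0 eq_sym.
apply: Hh; first exact: Psi_psi.
by apply: (lclosed_psi HN xk); apply: (lclosedB HN) => //; apply: RN Rk.
Qed.

Lemma piso_extension (R0 : set (G * G)) (N : set G) : piso psi R0 ->
    lclosed N -> enumerable N -> (forall a a', R0 (a, a') -> N a) ->
  exists R, [/\ piso psi R, R0 `<=` R, forall a a', R (a, a') -> N a
              & forall a, N a -> exists a', R (a, a')].
Proof.
move=> HR0 HN EN RN0.
pose P X := piso psi (R0 `|` X) /\ forall a a', (R0 `|` X) (a, a') -> N a.
have [|X [[HR RN] Xmax]] := @Zorn_bigcup _ P.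
  move=> F FP tot; split.
    by apply: piso_chain => // X /FP [].
  move=> a a' [/RN0 //|[X /FP [_ H] Xa]].
  by apply: (H a a'); right.
set R := R0 `|` X in HR RN.
have Rmax R' : piso psi R' -> R `<=` R' -> (forall a a', R' (a, a') -> N a) ->
    R' `<=` R.
  move=> HR' RR' RN' p R'p; apply: contrapT => Rp.
  have R'E : R0 `|` R' = R'.
    by rewrite setUC setUidl // => q R0q; apply: RR'; left.
  apply: (Xmax R'); last by rewrite /P R'E.
  split; last by move=> /(_ p R'p) Xp; apply: Rp; right.
  by move=> q Xq; apply: RR'; right.
exists R; split=> //; first by move=> p; left.
have ER := enumerable_piso HR EN RN.
(* This comes before the general case, where it supplies partners for the values psi(x - k) and for
   all successors of new elements. *)
have HPsi h : Psi h -> N h -> exists h', R (h, h').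
  move=> Ph Nh; apply: contrapT => Hn.
  have [a a' Ra|g' Hg _] := cut_realize HT Hsat HR ER 0 Ph.
    by apply/eqP => E; apply: Hn; exists a'; rewrite -E.
  apply: Hn; exists g'; apply: (Rmax (adjoin psi R h g')).
  - exact: (piso_adjoin HT HR Hg).
  - by move=> [a a']; apply: adjoin_sub.
  - by move=> a a'; apply: (adjoin_lclosed HN HR Hg).
  - exact: (adjoin_orbit HT HR Hg 0).
move=> x Nx; apply: contrapT => Hn.
have xP := place_hyp HR HN RN Nx HPsi Hn.
have [y _ yP] := place_realize HT HR xP Hsat ER 0.
apply: Hn; exists y; apply: (Rmax (extend R x y)).
- apply: (piso_extend HT HR yP) => f f' Hf.
  apply: HPsi; first exact: Psi_succ.
  apply: (lclosed_succ HN); exact: extend_lclosed Hf.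
- by move=> [a a']; apply: extend_sub.
- by move=> a a'; apply: (extend_lclosed HN).
- exact: (extend_self HR).
Qed.

Lemma piso_forth R0 x : piso psi R0 -> enumerable R0 ->
  exists R, [/\ piso psi R, enumerable R, R0 `<=` R & exists y, R (x, y)].
Proof.
move=> HR0 ER0.
pose X := x |` [set a | exists2 p, R0 p & Some p.1 = Some a].
have EN : enumerable (lgen X).
  exact/enumerable_lgen/enumerable_setU1/(enumerable_pmap (fun p => Some p.1)).
have HN := lclosed_lgen X.
have [|R [HR R0R RN NR]] := piso_extension HR0 HN EN.
  by move=> a a' Ra; apply: lgen_sub; right; exists (a, a').
exists R; split=> //; first exact: enumerable_piso HR EN RN.
by apply: NR; apply: lgen_sub; left.
Qed.

Definition rel_oo (R : set (G * G)) (x y : option G) : Prop :=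
  match x, y with
  | Some a, Some b => R (a, b)
  | None, None => True
  | _, _ => False
  end.

Lemma eval_piso R (v w : nat -> M) t : piso psi R ->
  (forall i, rel_oo R (v i) (w i)) -> rel_oo R (eval v t) (eval w t).
Proof.
move=> HR H; elim: t => [i|||t IHt u IHu|t|t|t|t|n t] //=.
- exact: (piso0 HR).
- case: (eval v t) (eval w t) IHt => [a|] [a'|] //= Ra.
  case: (eval v u) (eval w u) IHu => [b|] [b'|] //= Rb.
  exact: (pisoD HR).
- by case: (eval v t) (eval w t) => [a|] [a'|] //=; apply: (pisoN HR).
- case: (eval v t) (eval w t) => [a|] [a'|] //= Ra.
  rewrite (piso_eq0 HR Ra); case: ifP => // /negbT a0.
  by apply: (piso_psi HR) => //; rewrite (piso_eq0 HR Ra).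
- by case: (eval v t) (eval w t) => [a|] [a'|] //=; apply: (piso_succ HR).
- case: (eval v t) (eval w t) => [a|] [a'|] //= Ra.
  have [Pa|Pa] := pselect (Psi_gt psi a).
    rewrite (mem_set Pa) (mem_set (iffLR (piso_Psi_gt HR Ra) Pa)).
    exact: (piso_pred HR).
  rewrite (memNset Pa) (memNset _) // => Pa'; apply: Pa.
  exact: (iffRL (piso_Psi_gt HR Ra)).
- case: (eval v t) (eval w t) => [a|] [a'|] //= Ra.
  by apply: (piso_div HR (ltn0Sn n)); rewrite !div_by_mulrn.
Qed.

Lemma enumerable_flip R : enumerable R -> enumerable (flip R : set (G * G)).
Proof.
move=> /(enumerable_pmap (fun p => Some (p.2, p.1))); apply: enumerable_sub.
by move=> [a b] Rba; exists (b, a).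
Qed.

(** The relation is quantified inside the induction because it grows at each quantifier; the back
    direction is the forth direction for the flipped relation. *)
Lemma sat_piso phi : forall R (v w : nat -> M), piso psi R -> enumerable R ->
  (forall i, rel_oo R (v i) (w i)) -> sat v phi <-> sat w phi.
Proof.
have flipP R (v w : nat -> M) : (forall i, rel_oo R (v i) (w i)) ->
    forall i, rel_oo (flip R) (w i) (v i).
  by move=> H i; move: (H i); case: (v i) (w i) => [a|] [b|].
elim: phi => [t u|t u|phi IH|phi IHphi chi IHchi|i phi IH] R v w HR ER H /=.
- have := eval_piso t HR H; have := eval_piso u HR H.
  case: (eval v u) (eval w u) (eval v t) (eval w t) => [a|] [a'|] //= [b|] [b'|] //= Ra Rb.
  split=> -[/eqP]; first by rewrite (piso_eq HR Rb Ra) => /eqP ->.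
  by rewrite -(piso_eq HR Rb Ra) => /eqP ->.
- have := eval_piso t HR H; have := eval_piso u HR H.
  case: (eval v u) (eval w u) (eval v t) (eval w t) => [a|] [a'|] //= [b|] [b'|] //= Ra Rb.
  by rewrite (piso_lt HR Rb Ra).
- by rewrite (IH R v w).
- by rewrite (IHphi R v w) // (IHchi R v w).
- have one R' (v' w' : nat -> M) : piso psi R' -> enumerable R' ->
    (forall i, rel_oo R' (v' i) (w' i)) ->
    (exists a : M, sat (update v' i a) phi) ->
    exists a : M, sat (update w' i a) phi.
    move=> HR' ER' H' [[x|] Hx]; last first.
      exists (None : M).
      apply: (iffLR (IH R' _ _ HR' ER' _) Hx) => j.
      by rewrite /update; case: ifP.
    have [R1 [HR1 ER1 R'R1 [y Ry]]] := piso_forth x HR' ER'.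
    exists (Some y : M); apply: (iffLR (IH R1 _ _ HR1 ER1 _) Hx) => j.
    rewrite /update; case: ifP => // _; move: (H' j).
    by case: (v' j) (w' j) => [a|] [b|] //=; apply: R'R1.
  split; first exact: (one R v w HR ER H).
  exact: (one (flip R) w v (piso_flip HR) (enumerable_flip ER) (flipP _ _ _ H)).
Qed.

Definition diag (K : set G) : set (G * G) := [set p | K p.1 /\ p.2 = p.1].

Lemma piso_diag K : lclosed K -> piso psi (diag K).
Proof.
move=> HK; rewrite /diag; split=> /=.
- by split=> //; apply: (lclosed0 HK).
- by move=> a a' b b' [Ka ->] [Kb ->]; split=> //; apply: (lclosedB HK).
- move=> n a a' n0 [Ka /(omulrnI n0) ->]; split=> //.
  exact: (lclosed_div HK n0).
- by move=> a a' [_ ->].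
- by move=> a a' a0 [Ka ->]; split=> //; apply: (lclosed_psi HK).
- by move=> a a' [Ka ->]; split=> //; apply: (lclosed_succ HK).
- by move=> a a' [_ ->].
- by move=> a a' [Ka ->] Pa; split=> //; apply: (lclosed_pred HK).
Qed.

Lemma enumerable_diag K : enumerable K -> enumerable (diag K).
Proof.
move=> /(enumerable_pmap (fun a => Some (a, a))); apply: enumerable_sub.
by move=> [a b] [/= Ka ->]; exists a.
Qed.

Lemma lclosed_fixed R : piso psi R -> lclosed [set a | R (a, a)].
Proof.
move=> HR; split=> /=.
- exact: (piso0 HR).
- by move=> a b; apply: (pisoB HR).
- by move=> n a; apply: (piso_div HR).
- by move=> a; apply: (piso_psi HR).
- by move=> a; apply: (piso_succ HR).
- by move=> a Pa Ra; apply: (piso_pred HR).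
Qed.

(* Hence no element outside of [K] is definable over [K]. *)
Lemma piso_move K y : lclosed K -> enumerable K -> ~ K y ->
  exists R, [/\ piso psi R, enumerable R, diag K `<=` R
              & exists2 y', R (y, y') & y' != y].
Proof.
move=> HK EK Ky; have HD := piso_diag HK; have ED := enumerable_diag EK.
pose N := lgen (y |` K).
have HN : lclosed N := lclosed_lgen _.
have EN : enumerable N by apply/enumerable_lgen/enumerable_setU1.
have KN a : K a -> N a by move=> Ka; apply: lgen_sub; right.
have DN a a' : diag K (a, a') -> N a by move=> [/= /KN].
have Ny : N y by apply: lgen_sub; left.
have [[h [Ph Nh Kh]]|none] := pselect (exists h, [/\ Psi h, N h & ~ K h]).
  have [a a' [/= Ka _]|h' Hh h'h] := cut_realize HT Hsat HD ED h Ph.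
    by apply/eqP => E; apply: Kh; rewrite -E.
  have HA := piso_adjoin HT HD Hh.
  have EA : enumerable (adjoin psi (diag K) h h').
    apply: (enumerable_piso HA EN) => a a'; exact: (adjoin_lclosed HN HD Hh).
  have [R [HR ER AR [y' Ry]]] := piso_forth y HA EA.
  exists R; split=> //.
    by move=> [a a'] Da; apply/AR/adjoin_sub.
  exists y' => //; apply/eqP => E; rewrite E in Ry.
  (* The elements fixed by R form a closed set. If y were among them, so would be everything
     generated by y and K, in particular h, which was moved on purpose. *)
  have Rh : R (h, h).
    apply: (Nh _ (lclosed_fixed HR)) => a [->//|Ka].
    by apply/AR/adjoin_sub.
  have Rh' : R (h, h') by apply/AR/(adjoin_orbit HT HD Hh 0).
  by move: h'h; rewrite (piso_fun HR Rh' Rh) eqxx.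
have HPsi h : Psi h -> N h -> exists h', diag K (h, h').
  move=> Ph Nh; exists h; split=> //=.
  by apply: contrapT => Kh; apply: none; exists h.
have xP := place_hyp HD HN DN Ny HPsi.
have {}xP : forall k k', diag K (k, k') -> k != y /\ exists c, diag K (psi (y - k), c).
  by apply: xP => -[y' [/=]].
have [y' y'y yP] := place_realize HT HD xP Hsat ED y.
have HE : piso psi (extend (diag K) y y').
  apply: (piso_extend HT HD yP) => f f' Hf.
  apply: HPsi; first exact: Psi_succ.
  apply: (lclosed_succ HN); exact: extend_lclosed Hf.
exists (extend (diag K) y y'); split=> //.
- by apply: (enumerable_piso HE EN) => a a'; apply: extend_lclosed.
- by move=> [a a'] Da; apply: extend_sub.
- by exists y' => //; apply: (extend_self HD).
Qed.

End Generated.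

(** * Ultrapowers *)

Local Open Scope quotient_scope.

Section Ultrafilter.
Context {U : set_system nat} {HU : UltraFilter U}.

Lemma ultraN (P : nat -> Prop) : ~ U [set n | P n] <-> U [set n | ~ P n].
Proof.
split=> [H|H1 H2]; first by case: (in_ultra_setVsetC [set n | P n] HU).
by have [n []] := filter_ex (filterI H1 H2).
Qed.

Lemma ultra_or (P Q : nat -> Prop) : U [set n | P n \/ Q n] ->
  U [set n | P n] \/ U [set n | Q n].
Proof.
move=> H; have [|] := in_ultra_setVsetC [set n | P n] HU; first by left.
by move=> HN; right; apply: filterS2 H HN => n [].
Qed.

Lemma ultra_and (P Q : nat -> Prop) : U [set n | P n /\ Q n] <->
  U [set n | P n] /\ U [set n | Q n].
Proof.
split=> [H|[H1 H2]]; last exact: filterI.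
by split; apply: filterS H => n [].
Qed.

Lemma ultraE (P : nat -> Prop) : (forall n, P n) -> U [set n | P n].
Proof. exact: filterE. Qed.

Lemma ultra_ex (T : choiceType) (t0 : T) (P : nat -> T -> Prop) : U [set n | exists t, P n t] ->
  exists f, U [set n | P n (f n)].
Proof.
move=> H; exists (fun n => xget t0 (P n)); apply: filterS H => n /= [t Pt].
by case: (xgetP t0 (P n)) => [t' -> //|/(_ t)].
Qed.

Variable G : orderedZmodType.

Definition ueq (f g : nat -> G) : bool := `[< U [set n | f n = g n] >].

Lemma ueq_refl : reflexive ueq.
Proof. by move=> f; apply/asboolP/ultraE. Qed.

Lemma ueq_sym : symmetric ueq.
Proof.
by move=> f g; apply/asboolP/asboolP; apply: filterS => n /= ->.
Qed.

Lemma ueq_trans : transitive ueq.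
Proof.
move=> g f h /asboolP H1 /asboolP H2; apply/asboolP.
by apply: filterS2 H1 H2 => n /= -> ->.
Qed.

Canonical ueq_equiv := EquivRel ueq ueq_refl ueq_sym ueq_trans.

Definition upow := {eq_quot ueq_equiv}.
HB.instance Definition _ := EqQuotient.copy upow {eq_quot ueq_equiv}.
HB.instance Definition _ := Choice.copy upow {eq_quot ueq_equiv}.

Definition cls (f : nat -> G) : upow := \pi_upow f.

Lemma clsE (f g : nat -> G) : cls f = cls g <-> U [set n | f n = g n].
Proof.
split=> [/eqmodP /asboolP //|H]; apply/eqmodP; exact/asboolP.
Qed.

Lemma clsP (x : upow) : exists f, x = cls f.
Proof. by exists (repr x); rewrite /cls reprK. Qed.

Lemma repr_cls f : U [set n | repr (cls f) n = f n].
Proof. by apply/clsE; rewrite /cls reprK. Qed.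

Definition uadd (x y : upow) := cls (fun n => repr x n + repr y n).
Definition uopp (x : upow) := cls (fun n => - repr x n).
Definition uzero : upow := cls (fun=> 0).
Definition ule (x y : upow) : bool := `[< U [set n | repr x n <= repr y n] >].

Lemma uaddE f g : uadd (cls f) (cls g) = cls (fun n => f n + g n).
Proof.
by apply/clsE; apply: filterS2 (repr_cls f) (repr_cls g) => n /= -> ->.
Qed.

Lemma uoppE f : uopp (cls f) = cls (fun n => - f n).
Proof. by apply/clsE; apply: filterS (repr_cls f) => n /= ->. Qed.

Lemma uleE f g : ule (cls f) (cls g) <-> U [set n | f n <= g n].
Proof.
split=> [/asboolP|] H.
  by apply: filterS3 (repr_cls f) (repr_cls g) H => n /= -> ->.
apply/asboolP.
by apply: filterS3 (repr_cls f) (repr_cls g) H => n /= -> ->.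
Qed.

Lemma uaddA : associative uadd.
Proof.
move=> x y z; have [f ->] := clsP x; have [g ->] := clsP y.
have [h ->] := clsP z; rewrite !uaddE; apply/clsE/ultraE => n.
by rewrite addrA.
Qed.

Lemma uaddC : commutative uadd.
Proof.
move=> x y; have [f ->] := clsP x; have [g ->] := clsP y.
by rewrite !uaddE; apply/clsE/ultraE => n; rewrite addrC.
Qed.

Lemma uadd0 : left_id uzero uadd.
Proof.
move=> x; have [f ->] := clsP x.
by rewrite uaddE; apply/clsE/ultraE => n; rewrite add0r.
Qed.

Lemma uaddN : left_inverse uzero uopp uadd.
Proof.
move=> x; have [f ->] := clsP x.
by rewrite uoppE uaddE; apply/clsE/ultraE => n; rewrite addNr.
Qed.

HB.instance Definition _ := GRing.isZmodule.Build upow uaddA uaddC uadd0 uaddN.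

Lemma ule_refl : reflexive ule.
Proof. by move=> x; apply/asboolP/ultraE. Qed.

Lemma ule_anti : antisymmetric ule.
Proof.
move=> x y; have [f ->] := clsP x; have [g ->] := clsP y.
move=> /andP [/uleE H1 /uleE H2]; apply/clsE.
by apply: filterS2 H1 H2 => n /= h1 h2; apply/le_anti; rewrite h1.
Qed.

Lemma ule_trans : transitive ule.
Proof.
move=> y x z /asboolP H1 /asboolP H2; apply/asboolP.
by apply: filterS2 H1 H2 => n /=; apply: le_trans.
Qed.

HB.instance Definition _ :=
  Order.Le_isPOrder.Build ring_display upow ule_refl ule_anti ule_trans.

Lemma ule_total : total (<=%R : rel upow).
Proof.
move=> x y; have [f ->] := clsP x; have [g ->] := clsP y.
have : U [set n | f n <= g n \/ g n <= f n].
  by apply: ultraE => n; apply/orP/le_total.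
by case/ultra_or => H; apply/orP; [left|right]; apply/uleE.
Qed.

Lemma ule_D2r (z x y : upow) : x <= y -> x + z <= y + z.
Proof.
have [f ->] := clsP x; have [g ->] := clsP y; have [h ->] := clsP z.
move=> /uleE H; change (is_true (ule (uadd (cls f) (cls h)) (uadd (cls g) (cls h)))).
rewrite !uaddE; apply/uleE; apply: filterS H => n /=.
by rewrite oleD2r.
Qed.

HB.instance Definition _ :=
  POrderedZmodule_isOrdered.Build upow ule_total ule_D2r.

End Ultrafilter.

Arguments upow U {HU} G.

Section Ultrapower.
Context {U : set_system nat} {HU : UltraFilter U}.
Variables (G : orderedZmodType) (psi : G -> G) (HT : T0_model psi).
Local Notation GU := (upow U G).
Local Notation cls := (@cls U HU G).

Lemma clsN f : - cls f = cls (fun n => - f n).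
Proof. exact: uoppE. Qed.

Lemma clsD f g : cls f + cls g = cls (fun n => f n + g n).
Proof. exact: uaddE. Qed.

Lemma clsB f g : cls f - cls g = cls (fun n => f n - g n).
Proof. by rewrite clsN clsD. Qed.

Lemma cls0 : 0 = cls (fun=> 0). Proof. by []. Qed.

Lemma clsMn f k : cls f *+ k = cls (fun n => f n *+ k).
Proof.
elim: k => [|k IH]; first by rewrite mulr0n.
by rewrite mulrS IH clsD; apply/clsE/ultraE => n; rewrite mulrS.
Qed.

Lemma clsMz f (z : int) : cls f *~ z = cls (fun n => f n *~ z).
Proof. by case: z => k; rewrite ?NegzE -?pmulrn -?nmulrn clsMn // clsN. Qed.

Lemma cls_le f g : (cls f <= cls g : bool) <-> U [set n | f n <= g n].
Proof. exact: uleE. Qed.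

Lemma cls_eq0 f : cls f = 0 <-> U [set n | f n = 0].
Proof. by rewrite cls0; apply: clsE. Qed.

Lemma cls_neq f g : (cls f != cls g : bool) <-> U [set n | f n != g n].
Proof.
split=> [/eqP H|H].
  have := iffLR (ultraN (HU := HU) (fun n => f n = g n)) (fun E => H (iffRL (clsE f g) E)).
  by move=> HN; apply: filterS HN => n /= /eqP.
apply/eqP => /clsE E; have [n [/eqP]] := filter_ex (filterI H E).
by [].
Qed.

Lemma cls_neq0 f : (cls f != 0 : bool) <-> U [set n | f n != 0].
Proof. by rewrite cls0; apply: cls_neq. Qed.

Lemma cls_lt f g : (cls f < cls g : bool) <-> U [set n | f n < g n].
Proof.
rewrite lt_neqAle; split=> [/andP [/cls_neq H1 /cls_le H2]|H].
  by apply: filterS2 H1 H2 => n /= h1 h2; rewrite lt_neqAle h1.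
apply/andP; split.
  by apply/cls_neq; apply: filterS H => n /= /lt_eqF ->.
by apply/cls_le; apply: filterS H => n /= /ltW.
Qed.

Lemma cls_gt0 f : (0 < cls f : bool) <-> U [set n | 0 < f n].
Proof. by rewrite cls0; apply: cls_lt. Qed.

Definition upsi (x : GU) : GU := cls (fun n => psi (repr x n)).

Lemma upsiE f : upsi (cls f) = cls (fun n => psi (f n)).
Proof. by apply/clsE; apply: filterS (repr_cls f) => n /= ->. Qed.

Lemma upow_couple : asymptotic_couple upsi.
Proof.
have AC := T0_couple HT; split.
- move=> a b; have [f ->] := clsP a; have [g ->] := clsP b.
  rewrite clsD => /cls_neq0 a0 /cls_neq0 b0 /cls_neq0 ab0.
  rewrite !upsiE ge_min.
  have : U [set n | psi (f n) <= psi (f n + g n) \/ psi (g n) <= psi (f n + g n)].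
    apply: filterS3 a0 b0 ab0 => n /= a0 b0 ab0.
    by apply/orP; rewrite -ge_min; apply: AC1.
  by case/ultra_or => H; apply/orP; [left|right]; apply/cls_le.
- move=> a r; have [f ->] := clsP a; rewrite clsMz !upsiE => /cls_neq0 a0 r0.
  by apply/clsE; apply: filterS a0 => n /= a0; apply: AC2.
- move=> a b; have [f ->] := clsP a; have [g ->] := clsP b.
  rewrite !upsiE clsD => /cls_neq0 a0 /cls_neq0 b0 /cls_gt0 apos.
  by apply/cls_lt; apply: filterS3 a0 b0 apos => n /=; apply: AC3.
Qed.

(** The integral in the ultrapower is picked by [xget]; uniqueness of integrals in almost every
    coordinate identifies it with the class of the coordinatewise integrals. *)
Lemma usuccE f : succ upsi (cls f) = cls (fun n => succ psi (f n)).
Proof.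
have Hg : U [set n | integral psi (f n) != 0 /\
    integral psi (f n) + psi (integral psi (f n)) = f n].
  by apply: ultraE => n; apply: integralP.
rewrite /succ /integral; case: xgetP => [b _ [b0 bE]|/(_ (cls (fun n => integral psi (f n))))].
  have [g gE] := clsP b; rewrite gE upsiE; apply/clsE.
  move: b0 bE; rewrite gE upsiE clsD => /cls_neq0 g0 /clsE E.
  apply: filterS3 Hg g0 E => n /= [i0 iE] g0 E.
  rewrite -/(integral psi (f n)); congr psi.
  by apply: (integral_inj HT) => //; rewrite E.
case; split; first by apply/cls_neq0; apply: filterS Hg => n [].
by rewrite upsiE clsD; apply/clsE; apply: filterS Hg => n [].
Qed.

Lemma uPsiE f : Psi upsi (cls f) <-> U [set n | Psi psi (f n)].
Proof.
split=> [[a /= a0 E]|].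
  have [g gE] := clsP a; move: a0 E; rewrite gE upsiE => /cls_neq0 g0 /clsE E.
  by apply: filterS2 g0 E => n /= g0 <-; exists (g n).
move=> H; have [g Hg] : exists g, U [set n | g n != 0 /\ psi (g n) = f n].
  apply: (ultra_ex 0 (P := fun n t => t != 0 /\ psi t = f n)).
  by apply: filterS H => n [a a0 E]; exists a.
exists (cls g); first by apply/cls_neq0; apply: filterS Hg => n [].
by rewrite upsiE; apply/clsE; apply: filterS Hg => n [].
Qed.

Lemma uPsi_gtE f : Psi_gt upsi (cls f) <-> U [set n | Psi_gt psi (f n)].
Proof.
rewrite /Psi_gt /= cls0 usuccE; split=> [[/uPsiE H1 /cls_lt H2]|H].
  exact: filterS2 H1 H2.
by split; [apply/uPsiE|apply/cls_lt]; apply: filterS H => n [].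
Qed.

(** The axioms are transferred one by one, before any transfer of formulas: the evaluation of [p]
    and of division in the ultrapower already relies on them. *)
Lemma upow_T0 : T0_model upsi.
Proof.
split; first exact: upow_couple.
- move=> a b; have [f ->] := clsP a; have [g ->] := clsP b.
  rewrite !upsiE => /cls_gt0 a0 /cls_le ab; apply/cls_le.
  by apply: filterS2 a0 ab => n; apply: (T0_H_type HT).
- move=> k a k0; have [f ->] := clsP a.
  have /choice [g gE] n : exists b, b *+ k = f n by apply: (T0_divisible HT).
  by exists (cls g); rewrite clsMn; apply/clsE/ultraE.
- move=> a; have [f ->] := clsP a.
  have Hf n := integralP HT (f n).
  exists (cls (fun n => integral psi (f n))).
    by apply/cls_neq0/ultraE => n; case: (Hf n).
  by rewrite upsiE clsD; apply/clsE/ultraE => n; case: (Hf n).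
- rewrite cls0 usuccE; split.
    by apply/uPsiE/ultraE => n; apply: Psi_succ0.
  move=> x; have [f ->] := clsP x; move=> /uPsiE Pf; apply/cls_le.
  by apply: filterS Pf => n /=; apply: succ0_le.
- rewrite {2}cls0 usuccE; apply/cls_gt0/ultraE => n; exact: (T0_pos HT).
- move=> x; have [f ->] := clsP x; move=> /uPsiE Pf; rewrite usuccE; split.
  + by apply/uPsiE/ultraE => n; apply: Psi_succ.
  + by apply/cls_lt; apply: filterS Pf => n /=; apply: succ_gt.
  + move=> [y []]; have [g ->] := clsP y; move=> /uPsiE Pg /cls_lt H1 /cls_lt H2.
    have [n [Pfn [Pgn [h1 h2]]]] := filter_ex (filterI Pf (filterI Pg (filterI H1 H2))).
    have [_ _] := T0_succ HT Pfn; apply; by exists (g n).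
- split.
  + move=> x; have [f ->] := clsP x; move=> /uPsiE Pf; rewrite usuccE.
    by apply/uPsi_gtE; apply: filterS Pf => n; apply: Psi_gt_succ.
  + move=> x y; have [f ->] := clsP x; have [g ->] := clsP y.
    move=> /set_mem /uPsiE Pf /set_mem /uPsiE Pg; rewrite !usuccE => /clsE E.
    apply/clsE; apply: filterS3 Pf Pg E => n /=; exact: (succ_inj HT).
  + move=> x; have [f ->] := clsP x; move=> /uPsi_gtE Pf.
    exists (cls (fun n => predf psi (f n))).
      by apply/uPsiE; apply: filterS Pf => n /(predfP HT) [].
    by rewrite usuccE; apply/clsE; apply: filterS Pf => n /(predfP HT) [].
Qed.

Lemma upredE f : Psi_gt upsi (cls f) ->
  predf upsi (cls f) = cls (fun n => predf psi (f n)).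
Proof.
move=> Pf; have [Pp pE] := predfP upow_T0 Pf.
move/uPsi_gtE: Pf => Pf.
apply: (succ_inj upow_T0) => //.
  by apply/uPsiE; apply: filterS Pf => n /(predfP HT) [].
rewrite pE usuccE; apply/clsE.
by apply: filterS Pf => n /(predfP HT) [].
Qed.

(** A sequence is infinite at almost all indices or finite at almost all; in the second case 0 is a
    placeholder on the negligible rest. *)
Definition cls_oo (f : nat -> option G) : option GU :=
  if pselect (U [set n | f n = None]) is left _ then None
  else Some (cls (fun n => odflt 0 (f n))).

Lemma cls_oo_Some f : cls_oo (fun n => Some (f n)) = Some (cls f).
Proof.
by rewrite /cls_oo; case: pselect => // /filter_ex [].
Qed.

Lemma cls_oo_None : cls_oo (fun=> None) = None.
Proof. by rewrite /cls_oo; case: pselect => // -[]; apply: ultraE. Qed.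

Lemma cls_oo_eq f g : U [set n | f n = g n] -> cls_oo f = cls_oo g.
Proof.
move=> H; rewrite /cls_oo; case: pselect => H1; case: pselect => H2 //.
- by case: H2; apply: filterS2 H H1 => n /= <-.
- by case: H1; apply: filterS2 H H2 => n /= <-.
- by congr Some; apply/clsE; apply: filterS H => n /= ->.
Qed.

Lemma cls_ooP (f : nat -> option G) : U [set n | f n = None] \/
  exists g, U [set n | f n = Some (g n)].
Proof.
have [|H] := pselect (U [set n | f n = None]); first by left.
right; exists (fun n => odflt 0 (f n)); have := iffLR (ultraN (HU := HU) _) H.
by move=> HN; apply: filterS HN => n /=; case: (f n).
Qed.

Lemma cls_oo_eqE f g : cls_oo f = cls_oo g <-> U [set n | f n = g n].
Proof.
split; last exact: cls_oo_eq.
have [Hf|[f' Hf]] := cls_ooP f; have [Hg|[g' Hg]] := cls_ooP g;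
  rewrite (cls_oo_eq Hf) (cls_oo_eq Hg) ?cls_oo_None ?cls_oo_Some //.
- by move=> _; apply: filterS2 Hf Hg => n /= -> ->.
- by case=> /clsE E; apply: filterS3 Hf Hg E => n /= -> -> ->.
Qed.

Lemma cls_oo_surj x : exists f, cls_oo f = x.
Proof.
case: x => [x|]; last by exists (fun=> None); apply: cls_oo_None.
by have [f ->] := clsP x; exists (fun n => Some (f n)); apply: cls_oo_Some.
Qed.

Lemma cls_oo_lt f g : (lt_oo (cls_oo f) (cls_oo g) : bool) <->
  U [set n | lt_oo (f n) (g n)].
Proof.
have [Hf|[f' Hf]] := cls_ooP f; have [Hg|[g' Hg]] := cls_ooP g;
  rewrite (cls_oo_eq Hf) (cls_oo_eq Hg) ?cls_oo_None ?cls_oo_Some /=.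
- split=> // H; have [n [/= E]] := filter_ex (filterI Hf H).
  by rewrite E.
- split=> // H; have [n [/= E]] := filter_ex (filterI Hf H).
  by rewrite E.
- by split=> // _; apply: filterS2 Hf Hg => n /= -> ->.
- rewrite cls_lt; split=> H; apply: filterS3 Hf Hg H => n /= -> -> //.
Qed.

Lemma cls_oo_omap (h : G -> G) (h' : GU -> GU) :
  (forall f, h' (cls f) = cls (fun n => h (f n))) ->
  forall f, omap h' (cls_oo f) = cls_oo (fun n => omap h (f n)).
Proof.
move=> E f; have [Hf|[f' Hf]] := cls_ooP f; rewrite (cls_oo_eq Hf).
  rewrite cls_oo_None /= -[LHS]cls_oo_None; apply: cls_oo_eq.
  by apply: filterS Hf => n /= ->.
rewrite cls_oo_Some /= E -[LHS]cls_oo_Some; apply: cls_oo_eq.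
by apply: filterS Hf => n /= ->.
Qed.

Lemma cls_oo_add f g :
  add_oo (cls_oo f) (cls_oo g) = cls_oo (fun n => add_oo (f n) (g n)).
Proof.
have [Hf|[f' Hf]] := cls_ooP f; have [Hg|[g' Hg]] := cls_ooP g;
  rewrite (cls_oo_eq Hf) (cls_oo_eq Hg) ?cls_oo_None ?cls_oo_Some /=.
- rewrite -[LHS]cls_oo_None; apply: cls_oo_eq.
  by apply: filterS2 Hf Hg => n /= -> ->.
- rewrite -[LHS]cls_oo_None; apply: cls_oo_eq.
  by apply: filterS2 Hf Hg => n /= -> ->.
- rewrite -[LHS]cls_oo_None; apply: cls_oo_eq.
  by apply: filterS2 Hf Hg => n /= -> ->.
- rewrite clsD -cls_oo_Some; apply: cls_oo_eq.
  by apply: filterS2 Hf Hg => n /= -> ->.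
Qed.

Lemma cls_oo_opp f : opp_oo (cls_oo f) = cls_oo (fun n => opp_oo (f n)).
Proof. by apply: cls_oo_omap => g; apply: clsN. Qed.

Lemma cls_oo_succ f :
  succ_oo upsi (cls_oo f) = cls_oo (fun n => succ_oo psi (f n)).
Proof. by apply: cls_oo_omap => g; apply: usuccE. Qed.

Lemma cls_div_by k f : (0 < k)%N ->
  div_by k (cls f) = cls (fun n => div_by k (f n)).
Proof.
move=> k0; apply: (div_by_eq upow_T0) => //; rewrite clsMn.
by apply/clsE/ultraE => n; apply: (div_by_mulrn HT).
Qed.

Lemma cls_oo_div k f : (0 < k)%N ->
  div_by_oo k (cls_oo f) = cls_oo (fun n => div_by_oo k (f n)).
Proof. by move=> k0; apply: cls_oo_omap => g; apply: cls_div_by. Qed.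

Lemma cls_oo_qscale q f :
  qscale_oo q (cls_oo f) = cls_oo (fun n => qscale_oo q (f n)).
Proof.
apply: cls_oo_omap => g; rewrite /qscale clsMz cls_div_by //.
by rewrite absz_gt0 denq_eq0.
Qed.

Lemma cls_oo_psi f : psi_oo upsi (cls_oo f) = cls_oo (fun n => psi_oo psi (f n)).
Proof.
have [Hf|[f' Hf]] := cls_ooP f; rewrite (cls_oo_eq Hf).
  rewrite cls_oo_None /= -[LHS]cls_oo_None; apply: cls_oo_eq.
  by apply: filterS Hf => n /= ->.
rewrite cls_oo_Some /= upsiE; case: ifP => [/eqP/cls_eq0 E|/negbT/cls_neq0 E].
  rewrite -[LHS]cls_oo_None; apply: cls_oo_eq.
  by apply: filterS2 Hf E => n /= -> ->; rewrite /= eqxx.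
rewrite -[LHS]cls_oo_Some; apply: cls_oo_eq.
by apply: filterS2 Hf E => n /= -> /negPf E; rewrite /= E.
Qed.

Lemma pred_oo_in (H : orderedZmodType) (chi : H -> H) a : Psi_gt chi a ->
  pred_oo chi (Some a) = Some (predf chi a).
Proof. by move=> Pa; rewrite /= (mem_set Pa). Qed.

Lemma pred_oo_out (H : orderedZmodType) (chi : H -> H) a : ~ Psi_gt chi a ->
  pred_oo chi (Some a) = None.
Proof. by move=> Pa; rewrite /= (memNset Pa). Qed.

Lemma cls_oo_pred f :
  pred_oo upsi (cls_oo f) = cls_oo (fun n => pred_oo psi (f n)).
Proof.
have [Hf|[f' Hf]] := cls_ooP f; rewrite (cls_oo_eq Hf).
  rewrite cls_oo_None -[LHS]cls_oo_None; apply: cls_oo_eq.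
  by apply: filterS Hf => n /= ->.
rewrite cls_oo_Some; have [Pf|Pf] := pselect (Psi_gt upsi (cls f')).
  rewrite pred_oo_in // upredE // -cls_oo_Some; apply: cls_oo_eq.
  move/uPsi_gtE: Pf => Pf.
  by apply: filterS2 Hf Pf => n /= -> Pn; rewrite pred_oo_in.
rewrite pred_oo_out // -[LHS]cls_oo_None; apply: cls_oo_eq.
have {}Pf : ~ U [set n | Psi_gt psi (f' n)] by move=> /uPsi_gtE.
have {}Pf := iffLR (ultraN (HU := HU) _) Pf.
by apply: filterS2 Hf Pf => n /= -> Pn; rewrite pred_oo_out.
Qed.

(** * The theorem of Los and countable saturation *)

Local Notation M := (Tlog_structure psi).
Local Notation MU := (Tlog_structure upsi).

Lemma eval_cls (v : nat -> nat -> option G) t :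
  eval (M := MU) (fun i => cls_oo (v i)) t =
  cls_oo (fun n => eval (M := M) (fun i => v i n) t).
Proof.
elim: t => [i|||t IHt u IHu|t IH|t IH|t IH|t IH|k t IH] //=.
- by rewrite cls_oo_Some.
- by rewrite cls_oo_None.
- by rewrite IHt IHu cls_oo_add.
- by rewrite IH cls_oo_opp.
- by rewrite IH cls_oo_psi.
- by rewrite IH cls_oo_succ.
- by rewrite IH cls_oo_pred.
- by rewrite IH cls_oo_div.
Qed.

Lemma update_cls (v : nat -> nat -> option G) i a :
  update (M := MU) (fun i => cls_oo (v i)) i (cls_oo a) =
  fun j => cls_oo (if j == i then a else v j).
Proof. by apply: funext => j; rewrite /update; case: ifP. Qed.

Lemma Los phi : forall v : nat -> nat -> option G,
  sat (M := MU) (fun i => cls_oo (v i)) phi <->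
  U [set n | sat (M := M) (fun i => v i n) phi].
Proof.
have upd (v : nat -> nat -> option G) i a n :
    (fun j => (if j == i then a else v j) n) =
    update (M := M) (fun j => v j n) i (a n).
  by apply: funext => j; rewrite /update; case: ifP.
elim: phi => [t u|t u|phi IH|phi IHphi chi IHchi|i phi IH] v /=.
- by rewrite !eval_cls cls_oo_eqE.
- by rewrite !eval_cls cls_oo_lt.
- by rewrite IH ultraN.
- by rewrite IHphi IHchi ultra_and.
- split=> [[a]|H].
    have [f <-] := cls_oo_surj a; rewrite update_cls IH.
    by move=> HN; apply: filterS HN => n /=; rewrite upd => H; exists (f n).
  have [f Hf] := ultra_ex (HU := HU) None H.
  exists (cls_oo f); rewrite update_cls IH.
  by apply: filterS Hf => n /=; rewrite upd.
Qed.

Lemma sat_update_cls phi (v : nat -> nat -> option G) i a :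
  sat (update (M := MU) (fun i => cls_oo (v i)) i (cls_oo a)) phi <->
  U [set n | sat (update (M := M) (fun j => v j n) i (a n)) phi].
Proof.
rewrite update_cls Los; split=> HN; apply: filterS HN => n /=.
  by congr sat; apply: funext => j; rewrite /update; case: ifP.
by congr sat; apply: funext => j; rewrite /update; case: ifP.
Qed.

Hypothesis U_oo : forall m, U [set n | (m <= n)%N].

Lemma longest_prefix (T : Type) (t0 : T) (S : nat -> T -> Prop) n :
  exists y, forall k, (k <= n)%N -> (exists z, forall i, (i < k)%N -> S i z) ->
    forall i, (i < k)%N -> S i y.
Proof.
elim: n => [|n [y Hy]]; first by exists t0; case.
have [[z Hz]|H] := pselect (exists z, forall i, (i < n.+1)%N -> S i z).
  exists z => k kn _ i ik; apply: Hz; exact: leq_trans kn.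
exists y => k; rewrite leq_eqVlt => /orP [/eqP -> /H //|]; exact: Hy.
Qed.

(** Coordinate n realizes every initial segment of length at most n that is satisfiable there. A
    fixed initial segment is satisfiable in almost every coordinate, and almost every n exceeds its
    length. *)
Lemma upow_saturated : countably_saturated upsi.
Proof.
move=> phi v fin.
have /choice [w wE] i : exists w : nat -> nat -> option G,
    (fun j => cls_oo (w j)) = v i.
  have /choice [w Hw] j := cls_oo_surj (v i j).
  by exists w; apply: funext.
pose S n i y := sat (update (M := M) (fun j => w i j n) 0 y) (phi i).
have /choice [y Hy] n := longest_prefix None (S n) n.
exists (cls_oo y) => i; rewrite -wE; apply/sat_update_cls.
have [z] := fin i.+1; have [f <-] := cls_oo_surj z => Hf.
have Hall m : (m <= i.+1)%N ->
    U [set n | forall k, (k < m)%N -> S n k (f n)].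
  elim: m => [|m IH] le_m; first exact: ultraE.
  have := Hf m le_m; rewrite -wE => /sat_update_cls Hm.
  apply: filterS2 (IH (ltnW le_m)) Hm => n /= H1 H2 k.
  by rewrite ltnS leq_eqVlt => /orP [/eqP ->|/H1].
apply: filterS2 (U_oo i.+1) (Hall i.+1 (leqnn _)) => n /= le_n Hn.
by apply: (Hy n i.+1 le_n) => //; exists (f n).
Qed.

End Ultrapower.

(** * s-functions and nested intervals *)

Lemma nonprincipal_ultrafilter : exists U : set_system nat,
  UltraFilter U /\ forall m, U [set n | (m <= n)%N].
Proof.
have [U [HU EU]] := ultraFilterLemma eventually_filter.
by exists U; split=> // m; apply: EU; exists m.
Qed.

Section SFunction.
Variables (G : orderedZmodType) (psi : G -> G) (HT : T0_model psi).
Local Notation s := (succ psi).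

Definition sfun m (k : 'I_m -> int) (q : 'I_m -> rat) (b x : G) : option G :=
  add_oo (\big[@add_oo G/Some 0]_(j < m)
            qscale_oo (q j) (succ_pow psi (k j) x)) (opp_oo (Some b)).

Lemma succ_pow_orbit g k : deep psi g -> succ_pow psi k g = Some (orbit psi g k).
Proof.
move=> Dg; have iter_succ m : iter m (succ_oo psi) (Some g) = Some (iter m s g).
  by elim: m => //= m ->.
case: k => m; first exact: iter_succ.
have pred m' : iter m' (pred_oo psi) (Some g) = Some (iter m' (predf psi) g).
  elim: m' => // m' IH; rewrite !iterS IH pred_oo_in //; exact: (Dg.2 m').
exact: (pred m.+1).
Qed.

(** [qscale] uses the reduced fraction, so the claim is checked after multiplication by the reduced
    denominator, where it becomes a cross-multiplication. *)
Lemma qscale_ratio (p : int) n (a : G) : (0 < n)%N ->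
  qscale (p%:~R / n%:R) a *+ n = a *~ p.
Proof.
move=> n0; set q := (_ / _ : rat).
have d0 : (0 < `|denq q|)%N by rewrite absz_gt0 denq_eq0.
have dE : `|denq q|%N%:Z = denq q by rewrite abszE ger0_norm // denq_ge0.
have E : numq q * n%:Z = p * denq q.
  have n0' : n%:R != 0 :> rat by rewrite pnatr_eq0 -lt0n.
  have : q * n%:R = p%:~R by rewrite /q mulfVK.
  rewrite -{1}(divq_num_den q) => H; apply/eqP; rewrite -(eqr_int rat) !intrM.
  by rewrite -H mulrAC mulfVK ?intr_eq0 ?denq_eq0 // mulrC.
apply: (omulrnI d0); rewrite -mulrnA mulnC mulrnA /qscale.
rewrite (div_by_mulrn HT) // !pmulrn dE -!mulrzA.
by rewrite -E.
Qed.

Lemma big_add_oo (I : Type) (r : seq I) (f : I -> G) :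
  \big[@add_oo G/Some 0]_(i <- r) Some (f i) = Some (\sum_(i <- r) f i).
Proof. by elim: r => [|i r IH]; rewrite ?big_nil // !big_cons IH. Qed.

(** An s-function has nonzero coefficients, so the vanishing terms of P are dropped; the list stays
    increasing, as required of the exponents. *)
Definition support (P : {poly int}) := [seq i <- iota 0 (size P) | P`_i != 0].

Lemma hcomb_sfun (P : {poly int}) k n (b c g y : G) : deep psi g ->
    (0 < n)%N -> y *+ n = hcomb psi P (orbit psi g k) - b -> c *+ n = b ->
  sfun (fun j : 'I_(size (support P)) => k + (nth 0%N (support P) j)%:Z)
       (fun j => (P`_(nth 0%N (support P) j))%:~R / n%:R) c g = Some y.
Proof.
move=> Dg n0 E cE; rewrite /sfun.
under eq_bigr => j _ do rewrite succ_pow_orbit //=.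
rewrite big_add_oo /=; congr Some; apply: (omulrnI n0).
rewrite mulrnBl E cE; congr (_ - _); rewrite -sumrMnl.
rewrite /hcomb -(big_mkord xpredT (fun i => iter i s (orbit psi g k) *~ P`_i)).
rewrite /index_iota subn0.
transitivity (\sum_(i <- support P) iter i s (orbit psi g k) *~ P`_i).
  rewrite (big_nth 0%N) big_mkord; apply: eq_bigr => j _.
  by rewrite qscale_ratio // -orbit_iter.
rewrite big_filter big_mkcond; apply: eq_bigr => i _.
by case: eqP => // ->; rewrite mulr0z.
Qed.

End SFunction.

(** * Piecewise s-functions and bisection *)

Section Definable.
Variables (G : orderedZmodType) (psi : G -> G) (HT : T0_model psi).
Local Notation s := (succ psi).
Local Notation Psi := (Psi psi).
Local Notation M := (Tlog_structure psi).
Variable F : Psi -> option G.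

Lemma lt_oo_trans (H : orderedZmodType) (y x z : option H) :
  lt_oo x y -> lt_oo y z -> lt_oo x z.
Proof.
by case: x y z => [x|] [y|] [z|] //=; apply: lt_trans.
Qed.

Lemma le_oo_trans (H : orderedZmodType) (y x z : option H) :
  le_oo x y -> le_oo y z -> le_oo x z.
Proof.
rewrite /le_oo => /orP [/eqP -> //|xy] /orP [/eqP <-|yz]; first by rewrite xy orbT.
by rewrite (lt_oo_trans xy yz) orbT.
Qed.

Lemma lt_le_oo_trans (H : orderedZmodType) (y x z : option H) :
  lt_oo x y -> le_oo y z -> lt_oo x z.
Proof. by move=> xy /orP [/eqP <- //|]; apply: lt_oo_trans. Qed.

Lemma le_oo_Some (a b : G) : le_oo (Some a) (Some b) = (a <= b).
Proof. by rewrite le_eqVlt. Qed.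

Definition agrees_on (S : Psi -> option G) a b := forall x : Psi,
  le_oo a (Some (val x)) -> lt_oo (Some (val x)) b -> F x = S x.

Definition piecewise (a b : option G) : Prop :=
  exists (n : nat) (alpha : nat -> option G),
    [/\ alpha 0%N = a,
        alpha n = b,
        forall k, (k <= n)%N -> Psi_oo psi (alpha k),
        forall k, (k < n)%N -> lt_oo (alpha k) (alpha k.+1)
      & forall k, (k < n)%N ->
          exists2 S : Psi -> option G, s_function S &
            agrees_on S (alpha k) (alpha k.+1)].

Lemma piecewise1 a b S : Psi_oo psi a -> Psi_oo psi b -> lt_oo a b ->
  s_function S -> agrees_on S a b -> piecewise a b.
Proof.
move=> Pa Pb ab HS H; exists 1%N, (fun k => if k is 0 then a else b).
by split=> // -[|[]] // _; exists S.
Qed.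

Lemma piecewise_cat a b c : piecewise a b -> piecewise b c -> piecewise a c.
Proof.
move=> [m [f [f0 fm fP flt fS]]] [n [g [g0 gn gP glt gS]]].
pose h k := if (k < m)%N then f k else g (k - m)%N.
have hE k : (k <= m)%N -> h k = f k.
  rewrite /h leq_eqVlt => /orP [/eqP ->|->//].
  by rewrite ltnn subnn g0 fm.
have hE' k : (m <= k)%N -> h k = g (k - m)%N by rewrite /h ltnNge => ->.
exists (m + n)%N, h; split.
- by rewrite hE.
- by rewrite hE' ?leq_addr // addKn.
- move=> k kn; case: (leqP k m) => [km|/ltnW mk]; first by rewrite hE //; apply: fP.
  by rewrite hE' //; apply: gP; rewrite leq_subLR.
- move=> k kn; case: (leqP k.+1 m) => [km|mk].
    by rewrite !hE // ?(ltnW km) //; apply: flt.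
  rewrite !hE' ?leqW // subSn //; apply: glt.
  by rewrite ltn_subLR.
- move=> k kn; case: (leqP k.+1 m) => [km|mk].
    by rewrite !hE // ?(ltnW km) //; apply: fS.
  rewrite !hE' ?leqW // subSn //; apply: gS.
  by rewrite ltn_subLR.
Qed.

Definition total_fun (x : G) : option G :=
  if pselect (Psi x) is left H then F (SigSub (mem_set H)) else None.

Lemma total_funE (x : Psi) : total_fun (val x) = F x.
Proof.
rewrite /total_fun; case: pselect => [H|[]]; last exact: set_valP.
by congr F; apply: val_inj.
Qed.

Record bad (A : set G) (i : G * option G) : Prop := Bad {
  bad_low : Psi i.1 /\ A i.1;
  bad_high : forall d, i.2 = Some d -> Psi d /\ A d;
  bad_lt : lt_oo (Some i.1) i.2;
  bad_pw : ~ piecewise (Some i.1) i.2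
}.

(** A point c strictly inside leaves one half bad, since two piecewise descriptions can be
    concatenated; afterwards c is no longer an interior point. *)
Lemma bad_split A c i : A c -> Psi c -> bad A i ->
  exists j, [/\ bad A j, i.1 <= j.1, le_oo j.2 i.2
              & c <= j.1 \/ le_oo j.2 (Some c)].
Proof.
case: i => a b Ac Pc [/= [Pa Aa] Hb ab Hpw].
have refl (x : option G) : le_oo x x by rewrite /le_oo eqxx.
have [ca|ac] := leP c a.
  by exists (a, b); split=> //; left.
have [cb|cb] := boolP (lt_oo (Some c) b); last first.
  exists (a, b); split=> //; right => /=; move: cb; case: (b) => [d|] //=.
  by rewrite -leNgt -le_oo_Some.
have [Hac|Hac] := pselect (piecewise (Some a) (Some c)).
  exists (c, b); split=> //=; [|exact: ltW|by left].
  by split=> //= Hcb; apply: Hpw; apply: piecewise_cat Hac Hcb.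
exists (a, Some c); split=> //=; last by right.
  by split=> //= d [<-].
by rewrite /le_oo cb orbT.
Qed.

Lemma bad_sequence (A : set G) i0 : enumerable A -> bad A i0 ->
  exists i : nat -> G * option G, [/\ forall n, bad A (i n),
    forall m n, (m <= n)%N -> (i m).1 <= (i n).1 /\ le_oo (i n).2 (i m).2
  & forall c, A c -> Psi c ->
      exists n, c <= (i n).1 \/ le_oo (i n).2 (Some c)].
Proof.
move=> [e He] bad0.
have refl (x : option G) : le_oo x x by rewrite /le_oo eqxx.
have /choice [f Hf] (p : option G * (G * option G)) : exists j, bad A p.2 ->
    [/\ bad A j, p.2.1 <= j.1, le_oo j.2 p.2.2
      & forall c, p.1 = Some c -> A c -> Psi c -> c <= j.1 \/ le_oo j.2 (Some c)].
  case: p => [[c|] i] /=; last by exists i; split.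
  have [[Ac Pc]|Hc] := pselect (A c /\ Psi c); last first.
    by exists i; split=> // d [<-] Ad Pd; case: Hc.
  have [Hi|Hi] := pselect (bad A i); last by exists i.
  have [j [? ? ? Hj]] := bad_split Ac Pc Hi.
  by exists j => _; split=> // d [<-].
pose i := fix i n := if n is m.+1 then f (e m, i m) else i0.
have Hbad n : bad A (i n).
  by elim: n => // n IH; have [] := Hf (e n, i n) IH.
exists i; split=> //.
  move=> m n /subnKC <-; elim: (n - m)%N => [|k [IH1 IH2]].
    by rewrite addn0.
  rewrite addnS; have [_ H1 H2 _] := Hf (e (m + k)%N, i (m + k)%N) (Hbad _).
  split; first exact: le_trans H1.
  exact: le_oo_trans IH2.
move=> c Ac Pc; have [n En] := He _ Ac; exists n.+1.
by have [_ _ _] := Hf (e n, i n) (Hbad n); apply.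
Qed.

(** The limit cut cannot be realized by an element c of A: bisection at s c would leave an interval
    with no Psi-element except possibly c, and there F agrees with a constant. *)
Lemma bad_strict (A : set G) (HA : lclosed psi A) (i : nat -> G * option G) :
    (forall n, bad A (i n)) ->
    (forall m n, (m <= n)%N -> (i m).1 <= (i n).1 /\ le_oo (i n).2 (i m).2) ->
    (forall c, A c -> Psi c -> exists n, c <= (i n).1 \/ le_oo (i n).2 (Some c)) ->
  forall c, A c -> Psi c -> exists n, c < (i n).1 \/ le_oo (i n).2 (Some c).
Proof.
move=> Hbad Hmono Hcut c Ac Pc.
have [n [cn|cn]] := Hcut c Ac Pc; last by exists n; right.
have [m [cm|cm]] := Hcut _ (lclosed_succ HA Ac) (Psi_succ HT c).
  by exists m; left; apply: lt_le_trans cm; apply: succ_gt.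
exfalso; pose k := maxn n m.
have [nk _] := Hmono n k (leq_maxl _ _); have [_ mk] := Hmono m k (leq_maxr _ _).
have [[Pa _] Hb ab Hpw] := Hbad k.
have ck := le_trans cn nk; have kc := le_oo_trans mk cm.
have eqc x : Psi x -> c <= x -> lt_oo (Some x) (i k).2 -> x = c.
  move=> Px; rewrite le_eqVlt => /orP [/eqP //|cx] xk.
  have := lt_le_oo_trans xk kc; rewrite /= => xs.
  by have := succ_le HT Pc Px cx; rewrite leNgt xs.
apply: Hpw; apply: (piecewise1 (S := fun=> total_fun c)) => //.
- by case E : (i k).2 => [d|] //=; case: (Hb d E).
- by left; exists (total_fun c).
- move=> x; rewrite le_oo_Some => ax xb.
  rewrite -total_funE; congr total_fun; apply: eqc => //; first exact: set_valP.
  exact: le_trans ck ax.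
Qed.

End Definable.

(** * The limit cut *)

Lemma lclosed_dom (G : orderedZmodType) (psi : G -> G) (HT : T0_model psi) R :
  piso psi R -> lclosed psi [set a | exists a', R (a, a')].
Proof.
move=> HR; split=> /=.
- by exists 0; apply: (piso0 HR).
- by move=> a b [a' Ra] [b' Rb]; exists (a' - b'); apply: (pisoB HR).
- move=> n a n0 [c Rc]; have [b bE] := T0_divisible HT c n0.
  by exists b; apply: (piso_div HR n0); rewrite bE.
- by move=> a a0 [a' Ra]; exists (psi a'); apply: (piso_psi HR).
- by move=> a [a' Ra]; exists (succ psi a'); apply: (piso_succ HR).
- by move=> a Pa [a' Ra]; exists (predf psi a'); apply: (piso_pred HR).
Qed.

Section Limit.
Context {U : set_system nat} {HU : UltraFilter U}.
Hypothesis U_oo : forall m, U [set n | (m <= n)%N].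
Variables (G : orderedZmodType) (psi : G -> G) (HT : T0_model psi).
Local Notation s := (succ psi).
Local Notation Psi := (Psi psi).
Local Notation M := (Tlog_structure psi).
Local Notation GU := (upow U G).
Local Notation upsi := (@upsi U HU G psi).
Local Notation MU := (Tlog_structure upsi).
Variables (F : Psi -> option G) (phi : Lformula) (v : nat -> M).
Hypothesis phiP : forall x y : option G,
  (exists z : Psi, x = Some (val z) /\ y = F z) <->
  sat (update (update v 0 x) 1 y) phi.

Let const (c : G) : GU := cls (fun=> c).
Let vU : nat -> MU := fun i => cls_oo (HU := HU) (fun=> v i).

Lemma phi_total (x : G) (y : option G) : Psi x ->
  sat (update (update v 0 (Some x : M)) 1 (y : M)) phi <-> y = total_fun F x.
Proof.
move=> Px; rewrite -phiP; split=> [[z [[->] ->]]|->].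
  by rewrite total_funE.
exists (SigSub (mem_set Px)); split=> //.
by rewrite -total_funE.
Qed.

Lemma phi_upow (w : nat -> G) (y : option GU) : (forall n, Psi (w n)) ->
  sat (update (update vU 0 (Some (cls w) : MU)) 1 (y : MU)) phi <->
  y = cls_oo (fun n => total_fun F (w n)).
Proof.
move=> Pw; have [g <-] := cls_oo_surj y.
pose v1 (j n : nat) : option G := if j == 0%N then Some (w n) else v j.
have E1 n : (fun j => v1 j n) = update v 0 (Some (w n) : M).
  by apply: funext => j; rewrite /update /v1; case: ifP.
have -> : update vU 0 (Some (cls w) : MU) = fun j => cls_oo (v1 j).
  apply: funext => j; rewrite /update /v1 /vU; case: ifP => // _.
  by rewrite cls_oo_Some.
rewrite sat_update_cls //.
split=> [H|/cls_oo_eqE H]; first apply/cls_oo_eqE.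
  by apply: filterS H => n /=; rewrite E1 phi_total.
by apply: filterS H => n /=; rewrite E1 phi_total.
Qed.

Variables (A : set G) (HA : lclosed psi A) (EA : enumerable A).
Hypothesis vA : forall i a, v i = Some a -> A a.
Variable i : nat -> G * option G.
Hypothesis Hbad : forall n, bad F A (i n).
Hypothesis Hmono : forall m n, (m <= n)%N ->
  (i m).1 <= (i n).1 /\ le_oo (i n).2 (i m).2.
Hypothesis Hcut : forall c, A c -> Psi c ->
  exists n, c < (i n).1 \/ le_oo (i n).2 (Some c).

Definition in_cut (w : nat -> G) : Prop := forall n,
  [/\ Psi (w n), (i n).1 <= w n & lt_oo (Some (w n)) (i n).2].

Let AU : set GU := [set const c | c in A].

Lemma constB a b : const a - const b = const (a - b).
Proof. exact: clsB. Qed.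

Lemma const_eq a f : U [set n | a = f n] -> const a = cls f.
Proof. by move=> H; apply/clsE. Qed.

Lemma lclosed_const : lclosed upsi AU.
Proof.
split.
- by exists 0; [apply: (lclosed0 HA)|].
- move=> _ _ [a Aa <-] [b Ab <-]; exists (a - b); last by rewrite constB.
  exact: (lclosedB HA).
- move=> n x n0 [a Aa E]; have [b bE] := T0_divisible HT a n0.
  exists b; first by apply: (lclosed_div HA n0); rewrite bE.
  apply: (omulrnI n0); rewrite -E /const clsMn; apply: const_eq.
  by apply: ultraE.
- move=> _ /[swap] -[a Aa <-] /cls_neq0 a0; exists (psi a).
    by have [n a0'] := filter_ex a0; apply: (lclosed_psi HA).
  by rewrite /const upsiE.
- move=> _ [a Aa <-]; exists (s a); first exact: (lclosed_succ HA).
  by rewrite /const usuccE.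
- move=> _ /[swap] -[a Aa <-] Pa; exists (predf psi a); last by rewrite upredE.
  move/uPsi_gtE: Pa => /(_ HT) Pa.
  by have [n Pa'] := filter_ex Pa; apply: (lclosed_pred HA).
Qed.

Lemma enumerable_const : enumerable AU.
Proof.
apply: enumerable_sub (enumerable_pmap (fun a => Some (const a)) EA).
by move=> _ [a Aa <-]; exists a.
Qed.

(** From some index on, all intervals lie on one side of c, and hence so do almost all coordinates
    of w. The side depends only on the sequence of intervals, not on w. *)
Lemma cut_const w c : in_cut w -> A c -> Psi c ->
  (const c < cls w) = `[< exists n, c < (i n).1 >] /\ const c != cls w.
Proof.
move=> Hw Ac Pc.
have Pw n := let: And3 P _ _ := Hw n in P.
have [n [cn|cn]] := Hcut Ac Pc.
  have lt_cw : const c < cls w.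
    apply/cls_lt; apply: filterS (U_oo n) => m /= nm.
    have [_ le_m _] := Hw m; have [H _] := Hmono nm.
    exact: lt_le_trans cn (le_trans H le_m).
  rewrite lt_cw; split; first by apply/esym/asboolP; exists n.
  by rewrite lt_eqF.
have lt_wc : cls w < const c.
  apply/cls_lt; apply: filterS (U_oo n) => m /= nm.
  have [_ _ lt_m] := Hw m; have [_ H] := Hmono nm.
  exact: (lt_le_oo_trans lt_m (le_oo_trans H cn)).
split; last by rewrite gt_eqF.
rewrite (lt_gtF lt_wc); apply/esym/asboolP => -[m cm].
pose k := maxn m n.
have [mk _] := Hmono (leq_maxl m n); have [_ nk] := Hmono (leq_maxr m n).
have [_ lk uk] := Hw k.
have := lt_le_oo_trans uk (le_oo_trans nk cn).
by rewrite /= ltNge (ltW (lt_le_trans cm (le_trans mk lk))).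
Qed.

Lemma Psi_const c : Defs.Psi upsi (const c) -> Psi c.
Proof. by move=> /uPsiE /filter_ex []. Qed.

Let HTU : T0_model upsi := upow_T0 HT.
Let HD : piso upsi (diag AU) := piso_diag lclosed_const.
Let HsatU : countably_saturated upsi := upow_saturated HT U_oo.

Lemma Psi_cls w : in_cut w -> Defs.Psi upsi (cls w).
Proof. by move=> Hw; apply/uPsiE/ultraE => n; case: (Hw n). Qed.

Lemma cut_match_cls w w' : in_cut w -> in_cut w' ->
  cut_match upsi (diag AU) (cls w) (cls w').
Proof.
move=> Hw Hw'; apply: (cut_matchI HTU HD); try exact: Psi_cls.
- move=> x _ [/= [c Ac <-] ->] /Psi_const Pc.
  by have [-> _] := cut_const Hw Ac Pc; have [-> _] := cut_const Hw' Ac Pc.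
- move=> x _ [/= [c Ac <-] _]; apply/eqP => E.
  have Pc : Psi c by apply: Psi_const; rewrite E; apply: Psi_cls.
  by have [_] := cut_const Hw Ac Pc; rewrite E eqxx.
Qed.

Lemma rel_vU (R : set (GU * GU)) (x y : GU) (p q : option GU) j :
  diag AU `<=` R -> R (x, y) -> rel_oo R p q ->
  rel_oo R (update (update vU 0 (Some x : MU)) 1 (p : MU) j)
           (update (update vU 0 (Some y : MU)) 1 (q : MU) j).
Proof.
move=> DR Rxy Rpq; rewrite /update; case: ifP => // _; case: ifP => // _.
rewrite /vU; case E: (v j) => [c|]; last by rewrite cls_oo_None.
rewrite cls_oo_Some; apply: DR; split=> //=; exists c => //.
exact: vA E.
Qed.

(* The value of [F] at a point of the limit cut lies in the structure generated
   by that point over [A], and it is given by the same expression at all points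
   of the cut. *)
Lemma cut_sfunction : exists S : G -> option G,
  s_function (fun x : Psi => S (val x)) /\
  forall w, in_cut w -> exists n, total_fun F (w n) = S (w n).
Proof.
pose w0 n := (i n).1.
have Hw0 : in_cut w0.
  by move=> n; have [[Pa _] _ ab _] := Hbad n; split.
have Hcc w (Hw : in_cut w) := cut_match_cls Hw0 Hw.
have HR w (Hw : in_cut w) := piso_adjoin HTU HD (Hcc w Hw).
pose N := lgen upsi (cls w0 |` AU).
have HN : lclosed upsi N := lclosed_lgen _ _.
have EN : enumerable N by apply/(enumerable_lgen HTU)/enumerable_setU1/enumerable_const.
have DN x y : diag AU (x, y) -> N x by move=> [/= Ax _]; apply: lgen_sub; right.
have Nw0 : N (cls w0) by apply: lgen_sub; left.
have ER w (Hw : in_cut w) : enumerable (adjoin upsi (diag AU) (cls w0) (cls w)).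
  apply: (enumerable_piso (HR w Hw) EN) => x y.
  exact: (adjoin_lclosed HTU HN HD (Hcc w Hw) DN Nw0).
have DR w : diag AU `<=` adjoin upsi (diag AU) (cls w0) (cls w).
  by move=> [x y]; apply: adjoin_sub HD _ _ _ _.
have Rw w (Hw : in_cut w) : adjoin upsi (diag AU) (cls w0) (cls w) (cls w0, cls w).
  exact: (adjoin_orbit HTU HD (Hcc w Hw) 0).
have Pw w (Hw : in_cut w) n : Psi (w n) by case: (Hw n).
(* The partial isomorphism sends the class of w0 to that of w and fixes A, which contains the
   parameters of phi; so it carries the value of F at one point to the value at the other. *)
have transfer w (Hw : in_cut w) p q :
    rel_oo (adjoin upsi (diag AU) (cls w0) (cls w)) p q ->
    p = cls_oo (fun n => total_fun F (w0 n)) ->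
    q = cls_oo (fun n => total_fun F (w n)).
  move=> Rpq /(phi_upow _ (Pw _ Hw0)) Hp; apply/(phi_upow _ (Pw _ Hw)).
  apply: (iffLR (sat_piso HTU HsatU phi (HR w Hw) (ER w Hw) _) Hp) => j.
  exact: (rel_vU j (@DR w) (Rw w Hw) Rpq).
(* One common index is enough, because the final counterexample sequence violates the equality at
   every index. *)
have found (S : G -> option G) w : cls_oo (fun n => total_fun F (w n)) =
    cls_oo (fun n => S (w n)) :> option GU -> exists n, total_fun F (w n) = S (w n).
  by move=> /cls_oo_eqE /filter_ex.
case Ey: (cls_oo (HU := HU) (fun n => total_fun F (w0 n))) => [y|]; last first.
  exists (fun=> None); split; first by left; exists None.
  move=> w Hw; apply: (found (fun=> None) w); rewrite cls_oo_None.
  exact: (esym (transfer w Hw None None I (esym Ey))).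
(* Otherwise some partial isomorphism fixes w0 and A but moves y, although phi determines y from
   them. *)
have Ky : exists y', adjoin upsi (diag AU) (cls w0) (cls w0) (y, y').
  apply: contrapT => Hy.
  have HK := lclosed_dom HTU (HR w0 Hw0).
  have EK : enumerable
      [set x | exists x', adjoin upsi (diag AU) (cls w0) (cls w0) (x, x')].
    apply: enumerable_sub EN => x [x' Hx].
    exact: (adjoin_lclosed HTU HN HD (Hcc w0 Hw0) DN Nw0 Hx).
  have [R [HR' ER' KR [y' Ry /eqP y'y]]] := piso_move HTU HsatU HK EK Hy.
  apply: y'y; suff [->//] : Some y' = Some y.
  rewrite -Ey; apply/(phi_upow _ (Pw _ Hw0)).
  have Hp : sat (update (update vU 0 (Some (cls w0) : MU)) 1 (Some y : MU)) phi.
    exact/(phi_upow _ (Pw _ Hw0)).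
  apply: (iffLR (sat_piso HTU HsatU phi HR' ER' _) Hp) => j; apply: rel_vU => //.
    move=> [x x'] [/= Ax ->]; apply: KR; split=> //=.
    by exists x; apply: DR.
  by apply: KR; split=> //=; exists (cls w0); apply: Rw.
have [y' [n [P [k [b [b' [/= n0 [/= [b0 Ab0 bE] b'E] E _]]]]]]] := Ky.
have [c cE] := T0_divisible HT b0 n0.
have constc : const c *+ n = b.
  by rewrite /const clsMn -bE; apply/clsE/ultraE => m.
(* The partner of y over w solves the same equation, with the orbit of w in place of that of w0. *)
have Hyw w (Hw : in_cut w) : exists2 z, z *+ n = hcomb upsi P (orbit upsi (cls w) k) - b
    & cls_oo (fun m => total_fun F (w m)) = Some z.
  have [z zE] := T0_divisible HTU (hcomb upsi P (orbit upsi (cls w) k) - b) n0.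
  exists z => //; apply/esym; apply: (transfer w Hw (Some y)); last exact/esym.
  exists n, P, k, b, b; split=> //=; split=> //=; by exists b0.
(* The nonconstant form of an s-function has at least one term, so P = 0 is treated as the constant
   case. *)
have [P0|P0] := eqVneq P 0.
  exists (fun=> Some (- c)); split; first by left; exists (Some (- c)).
  move=> w Hw; have [z zE Ez] := Hyw w Hw; apply: (found (fun=> Some (- c)) w); rewrite Ez.
  rewrite cls_oo_Some; congr Some; apply: (omulrnI n0).
  rewrite zE P0 hcomb0 sub0r -constc -mulNrn; congr (_ *+ _).
  by rewrite /const clsN.
pose m := size (support P).
pose kk (j : 'I_m) : int := k + (nth 0%N (support P) j)%:Z.
pose q (j : 'I_m) : rat := (P`_(nth 0%N (support P) j))%:~R / n%:R.
have suppP j : (j < m)%N -> P`_(nth 0%N (support P) j) != 0.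
  by move=> jm; have := mem_nth 0%N jm; rewrite mem_filter => /andP [].
exists (sfun psi kk q c); split.
  right; exists m, kk, q, c; split=> //.
  - rewrite lt0n size_eq0 -has_filter; apply/hasP; exists (size P).-1.
      by rewrite mem_iota add0n /= prednK ?size_poly_gt0.
    by rewrite -lead_coefE lead_coef_eq0.
  - move=> j1 j2 j12; rewrite /kk ltrD2l ltz_nat.
    apply: (sorted_ltn_nth ltn_trans) => //; rewrite ?inE ?ltn_ord //.
    exact/sorted_filter/iota_ltn_sorted/ltn_trans.
  - move=> j; rewrite /q mulf_neq0 ?intr_eq0 ?suppP //.
    by rewrite invr_eq0 pnatr_eq0 -lt0n.
move=> w Hw; have [z zE Ez] := Hyw w Hw; apply: (found (sfun psi kk q c) w); rewrite Ez.
have Dw : deep upsi (cls w).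
  exact: (cut_deep HTU HD (cut_match_cls Hw Hw)).
rewrite -(hcomb_sfun HTU Dw n0 zE constc) -/m -/kk -/q /sfun.
(* The s-function formula is evaluated coordinatewise, which brings the identity in the ultrapower
   back to the original model. *)
have powE (h : int) :
    succ_pow upsi h (cls w) = cls_oo (fun n => succ_pow psi h (w n)).
  have powS l : iter l (succ_oo upsi) (Some (cls w)) =
      cls_oo (fun n => iter l (succ_oo psi) (Some (w n))).
    by elim: l => [|l IH]; rewrite ?cls_oo_Some // !iterS IH cls_oo_succ.
  have powP l : iter l (pred_oo upsi) (Some (cls w)) =
      cls_oo (fun n => iter l (pred_oo psi) (Some (w n))).
    elim: l => [|l IH]; first by rewrite cls_oo_Some.
    by rewrite iterS IH cls_oo_pred.
  by case: h => l; [exact: powS|exact: (powP l.+1)].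
have bigE (r : seq 'I_m) :
    \big[@add_oo GU/Some 0]_(j <- r) qscale_oo (q j) (succ_pow upsi (kk j) (cls w)) =
    cls_oo (fun n => \big[@add_oo G/Some 0]_(j <- r)
      qscale_oo (q j) (succ_pow psi (kk j) (w n))).
  elim: r => [|j r IH].
    rewrite big_nil -[LHS](cls_oo_Some (fun=> 0)); apply: cls_oo_eq.
    by apply: ultraE => l; rewrite big_nil.
  rewrite big_cons IH powE (cls_oo_qscale HT) cls_oo_add; apply: cls_oo_eq.
  by apply: ultraE => l; rewrite big_cons.
rewrite bigE -(cls_oo_Some (fun=> c)) cls_oo_opp cls_oo_add.
by [].
Qed.

End Limit.

Theorem theorem6p3 (G : orderedZmodType) (psi : G -> G)
    (HT : T0_model psi) (F : Psi psi -> option G) (HF : definable_fun F) :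
  exists (n : nat) (alpha : nat -> option G),
    [/\ alpha 0%N = Some (succ psi 0),
        alpha n = None,
        forall k, (k <= n)%N -> Psi_oo psi (alpha k),
        forall k, (k < n)%N -> lt_oo (alpha k) (alpha k.+1)
      & forall k, (k < n)%N ->
          exists2 S : Psi psi -> option G, s_function S &
            forall x : Psi psi,
              le_oo (alpha k) (Some (val x)) ->
              lt_oo (Some (val x)) (alpha k.+1) ->
              F x = S x].
Proof.
have [phi [v phiP]] := HF.
change (piecewise F (Some (succ psi 0)) None); apply: contrapT => Hpw.
pose X : set G := [set a | exists i, v i = Some a].
have EA : enumerable (lgen psi X).
  by apply: (enumerable_lgen HT); exists v.
have HA : lclosed psi (lgen psi X) := lclosed_lgen _ _.
have vA i a : v i = Some a -> lgen psi X a.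
  by move=> E; apply: lgen_sub; exists i.
have bad0 : bad F (lgen psi X) (succ psi 0, None).
  split=> //=; split; first exact: Psi_succ0.
  exact: (lclosed_succ HA (lclosed0 HA)).
have [i [Hbad Hmono Hcut]] := bad_sequence EA bad0.
have [U [HU U_oo]] := nonprincipal_ultrafilter.
have [S [HS Seq]] := cut_sfunction U_oo HT phiP HA EA vA Hbad Hmono
  (bad_strict HT HA Hbad Hmono Hcut).
(* S was obtained before w and serves all points of the cut. Were there no such x for some n, the
   single s-function S would describe F on the whole n-th interval. *)
have /choice [w Hw] n : exists x, [/\ Psi psi x, (i n).1 <= x,
    lt_oo (Some x) (i n).2 & total_fun F x <> S x].
  apply: contrapT => Hn; have [[Pa _] Hb ab Hpwn] := Hbad n.
  apply: Hpwn; apply: (piecewise1 (S := fun x => S (val x))) => //.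
    by case E : (i n).2 => [d|] //=; case: (Hb d E).
  move=> x; rewrite le_oo_Some => ax xb; rewrite -total_funE.
  apply: contrapT => Hx; apply: Hn; exists (val x); split=> //.
  exact: set_valP.
have [|n] := Seq w; first by move=> n; case: (Hw n).
by case: (Hw n).
Qed.
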